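(* Suppose that: (A-2) the components $x_{ji}$ ($1\le j\le p$, $1\le i\le n$) of the vectors $\mathbf{x}_1,\dots,\mathbf{x}_n$ are i.i.d. with some continuous distribution satisfying $\operatorname{Var}[x_{11}]=1$, $\mathbb{E}[x_{11}^4]>1$ and $\mathbb{E}|x_{11}|^{4+\delta}<\infty$ for some $\delta>0$; (A-3) $\inf_n\lambda_{\min}(\boldsymbol{\Sigma}_1)>0$ and $\sup_n\lambda_{\max}(\boldsymbol{\Sigma}_1)<\infty$; and that $p/n\to y\in(0,\infty)$ as $n\to\infty$. Then, under $H_0:\boldsymbol{\Sigma}_1=\dots=\boldsymbol{\Sigma}_n$, $$\frac{\hat\kappa_n}{\kappa_n}\ \xrightarrow{\ \mathbb{P}\ }\ 1\qquad(n\to\infty),$$ where $\kappa_n=\mathbb{E}\big[(x_{11}-\mathbb{E}[x_{11}])^4\big]$.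
   Context: For each $n$ (with $p=p_n$) one observes independent $p$-dimensional vectors $\mathbf{y}_i=(y_{1i},\dots,y_{pi})^\top=\boldsymbol{\Sigma}_i^{1/2}\mathbf{x}_i$, $1\le i\le n$, where $\mathbf{x}_i=(x_{1i},\dots,x_{pi})^\top$ are i.i.d. random vectors and $\boldsymbol{\Sigma}_i=\boldsymbol{\Sigma}_{i,n}\in\mathbb{R}^{p\times p}$ are covariance matrices. The distribution of the entries $x_{ji}$ does not depend on $n$; their mean need not be $0$. With $\overline{\mathbf{y}}=\frac1n\sum_{k=1}^n\mathbf{y}_k$ and $\hat{\boldsymbol{\Sigma}}^{\mathrm{cen}}=\frac{1}{n-1}\sum_{k=1}^n(\mathbf{y}_k-\overline{\mathbf{y}})(\mathbf{y}_k-\overline{\mathbf{y}})^\top$, define $$\hat\tau_n=\operatorname{tr}\big((\hat{\boldsymbol{\Sigma}}^{\mathrm{cen}})^2\big)-\frac1n\big(\operatorname{tr}\hat{\boldsymbol{\Sigma}}^{\mathrm{cen}}\big)^2,\quad \hat\nu_n=\frac{1}{n-1}\sum_{i=1}^n\Big(\|\mathbf{y}_i-\overline{\mathbf{y}}\|_2^2-\frac1n\sum_{i'=1}^n\|\mathbf{y}_{i'}-\overline{\mathbf{y}}\|_2^2\Big)^2,$$ $$\hat\omega_n=\sum_{j=1}^p\Big\{\frac1n\sum_{i=1}^n\Big(y_{ji}-\frac1n\sum_{i'=1}^n y_{ji'}\Big)^2\Big\}^2,\qquad \hat\kappa_n=\max\Big\{3+\frac{\hat\nu_n-2\hat\tau_n}{\hat\omega_n},\,1\Big\}.$$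 $\xrightarrow{\mathbb{P}}$ denotes convergence in probability. *)

(* Defs.v *)
From HB Require Import structures.
From mathcomp Require Import all_boot all_order all_algebra.
From mathcomp Require Import all_classical all_reals all_analysis.

Set Implicit Arguments.
Unset Strict Implicit.
Unset Printing Implicit Defensive.

Import Order.TTheory GRing.Theory Num.Theory.
Import numFieldNormedType.Exports.

Local Open Scope classical_set_scope.
Local Open Scope ring_scope.

Section Matrices.
Variables (R : realType) (p : nat).

Definition psdmx (S : 'M[R]_p) : Prop :=
  S^T = S /\ forall v : 'cV[R]_p, 0 <= (v^T *m S *m v) ord0 ord0.

(* The covariance matrices of p-dimensional vectors are exactly the symmetric
   positive semidefinite matrices. *)
Definition covariance_matrix (S : 'M[R]_p) : Prop := psdmx S.

(* The square root of a covariance matrix S: the unique symmetric positive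
   semidefinite A with A *m A = S (the zero matrix if there is no such A, which
   does not happen when S is a covariance matrix). *)
Definition sqrtmx (S : 'M[R]_p) : 'M[R]_p :=
  xget 0 [set A : 'M[R]_p | psdmx A /\ A *m A = S].

(* For symmetric S and 0 < p the set of eigenvalues is finite and nonempty, so
   these are its minimum and its maximum. *)
Definition lambda_min (S : 'M[R]_p) : R := inf [set a | eigenvalue S a].
Definition lambda_max (S : 'M[R]_p) : R := sup [set a | eigenvalue S a].

End Matrices.

Section Probability.
Variable R : realType.

Definition mutually_independent d (T : measurableType d) (P : probability T R)
    (I : finType) (X : I -> {RV P >-> R}) : Prop :=
  forall (J : {set I}) (B : I -> set R), (forall i, measurable (B i)) ->
    P (\bigcap_(i in [set` J]) X i @^-1` B i) =
    (\prod_(i in J) P (X i @^-1` B i))%E.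

(* The two variables may live on different probability spaces. *)
Definition same_distribution d (T : measurableType d) (P : probability T R)
    d' (T' : measurableType d') (P' : probability T' R)
    (X : {RV P >-> R}) (Y : {RV P' >-> R}) : Prop :=
  forall B : set R, measurable B -> distribution P X B = distribution P' Y B.

(* Convergence in probability to a constant; the n-th variable may live on its
   own probability space. *)
Definition cvg_in_probability (d : nat -> measure_display)
    (T : forall n, measurableType (d n)) (P : forall n, probability (T n) R)
    (Z : forall n, T n -> R) (l : R) : Prop :=
  forall e : R, 0 < e ->
    P n [set w | e < `|Z n w - l|] @[n --> \oo] --> 0%E.

Definition fourth_central_moment d (T : measurableType d) (P : probability T R)
    (X : T -> R) : R :=
  fine 'E_P[fun w => (X w - fine 'E_P[X]) ^+ 4].

End Probability.

(* The data matrix Y has the observations y_1, ..., y_n as its columns. *)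
Section Statistics.
Variables (R : realType) (p n : nat).
Implicit Type Y : 'M[R]_(p, n).

Definition sqnorm2 (v : 'cV[R]_p) : R := \sum_(j < p) v j ord0 ^+ 2.

Definition sample_mean Y : 'cV[R]_p := n%:R^-1 *: \sum_(k < n) col k Y.

Definition sample_cov Y : 'M[R]_p :=
  (n%:R - 1)^-1 *: \sum_(k < n)
    ((col k Y - sample_mean Y) *m (col k Y - sample_mean Y)^T).

Definition tau_hat Y : R :=
  \tr (sample_cov Y *m sample_cov Y) - n%:R^-1 * (\tr (sample_cov Y)) ^+ 2.

Definition nu_hat Y : R :=
  (n%:R - 1)^-1 * \sum_(i < n)
    (sqnorm2 (col i Y - sample_mean Y)
     - n%:R^-1 * \sum_(i' < n) sqnorm2 (col i' Y - sample_mean Y)) ^+ 2.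

Definition omega_hat Y : R :=
  \sum_(j < p)
    (n%:R^-1 * \sum_(i < n) (Y j i - n%:R^-1 * \sum_(i' < n) Y j i') ^+ 2) ^+ 2.

Definition kappa_hat Y : R :=
  Num.max (3 + (nu_hat Y - 2 * tau_hat Y) / omega_hat Y) 1.

Definition observations (Sigma : 'I_n -> 'M[R]_p) (X : 'M[R]_(p, n)) :
    'M[R]_(p, n) :=
  \matrix_(j, i) (sqrtmx (Sigma i) *m col i X) j ord0.

End Statistics.

(* Main.v *)
Require Import Defs.
From HB Require Import structures.
From mathcomp Require Import all_boot all_order all_algebra.
From mathcomp Require Import all_classical all_reals all_analysis.
From mathcomp Require Import complex measurable_realfun ring lra.

(** Write [S] for the common covariance matrix, [A] for its square root, [s] and
    [k] for the second and fourth moments of the centred components, and put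
    [D = \sum_j S j j ^+ 2], [Q = \sum_i \sum_j S i j ^+ 2].  The squared norm of
    one centred observation is a quadratic form in independent variables, with
    variance [(k - 3 s^2) D + 2 s^2 Q] (lemma [qform_sqr]).  The statistic
    [nu_hat] estimates this variance, [tau_hat] estimates [s^2 Q] and
    [omega_hat] estimates [s^2 D], so that for [s = 1] the ratio
    [(nu_hat - 2 tau_hat) / omega_hat] estimates [k - 3].  As the spectrum of
    [S] stays between two positive constants, [D] and [Q] are of order [p], and
    it suffices that each statistic is within [o(p)] of its target
    ([ratio_deviation], [max_ratio_deviation]).

    A second moment bound for [nu_hat] would need moments of order eight, while
    only [4 + delta] are finite.  The components are therefore clamped at the
    level [M = n^(4 / (8 + delta))] and recentred.  By Markov's inequality some
    component exceeds [M] with probability at most of order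
    [n p / M^(4 + delta)], and the eighth moments of the clamped variables are
    of order at most [M^4]; the level is chosen such that both
    [n p / M^(4 + delta)] and [M^4 / (n p)] are of order
    [n^(- 2 delta / (8 + delta))] ([tail_rate], [error_rate]).  The statistics
    do not change when a constant is added to each coordinate
    ([kappa_hat_shift]), so recentring is harmless, and by dominated convergence
    the moments of the clamped variables tend to those of the original ones
    ([trmoment_cvg]).

    For bounded variables each statistic is compared with its target by means of
    [|x| <= e + x^2 / (4 e)] ([nu_hat_deviation], [tau_hat_deviation],
    [omega_hat_deviation]): the right-hand sides are polynomials in the
    variables, with expectation at most a constant times
    [e p + (1 + b / n) / e], where [b] bounds the fourth moment of [u^2 - s]
    ([nu_error_mean], [tau_error_mean], [omega_error_mean]).  These
    expectations rest on fourth moment bounds for linear and quadratic forms,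
    which are obtained by adding the variables one at a time
    ([linform_fourth], [qform_fourth]), and on the orthogonality of the terms of
    the sums: columns of the sample are independent, and distinct entries of one
    row of the Gram matrix are uncorrelated.  For [e = sqrt ((1 + b / n) / p)]
    the bound is of order [sqrt (p (1 + b / n))], which is [o(p)];
    [kappa_hat_concentration] collects the estimates for a fixed [n]. *)


Import Order.TTheory GRing.Theory Num.Theory.
Import numFieldNormedType.Exports.

Set Implicit Arguments.
Unset Strict Implicit.
Unset Printing Implicit Defensive.

Local Open Scope classical_set_scope.
Local Open Scope ring_scope.

(** * Spectrum and square root of a covariance matrix *)

(** A function of a symmetric matrix that is a polynomial in it inherits symmetry,
    so the square root is built from a polynomial that interpolates the square
    root on the spectrum. *)
Lemma interpolation (F : fieldType) (f : F -> F) (s : seq F) :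
  exists q : {poly F}, {in s, forall a, q.[a] = f a}.
Proof.
elim: s => [|b s [q hq]]; first by exists 0.
have [bs|bs] := boolP (b \in s).
  by exists q => a; rewrite inE => /predU1P[->|]; exact: hq.
pose w : {poly F} := \prod_(a <- s) ('X - a%:P).
have wb : w.[b] != 0 by move: bs; rewrite -root_prod_XsubC.
exists (q + ((f b - q.[b]) / w.[b]) *: w) => a; rewrite inE hornerD hornerZ.
have [-> _|/= ab as_] := eqVneq a b; first by rewrite divfK// addrC subrK.
have /rootP -> : root w a by rewrite root_prod_XsubC.
by rewrite mulr0 addr0 hq.
Qed.

Section UnitaryConjugation.
Local Open Scope sesquilinear_scope.
Variable C : numClosedFieldType.

Lemma unitary_conj_mul n (U D E : 'M[C]_n) : U *m U^t* = 1%:M ->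
  (U^t* *m D *m U) *m (U^t* *m E *m U) = U^t* *m (D *m E) *m U.
Proof. by move=> UU; rewrite !mulmxA -[_ *m U *m U^t*]mulmxA UU mulmx1. Qed.

Lemma unitary_conj_horner n (U : 'M[C]_n.+1) (D : 'rV[C]_n.+1) (q : {poly C}) :
    U *m U^t* = 1%:M -> U^t* *m U = 1%:M ->
  horner_mx (U^t* *m diag_mx D *m U) q =
  U^t* *m diag_mx (map_mx (horner q) D) *m U.
Proof.
move=> UU U'U; have Uu : U \is a GRing.unit by have [] := mulmx1_unit UU.
have -> : U^t* = invmx U by rewrite -[RHS]mul1mx -U'U mulmxK.
by rewrite horner_mx_uconjC// horner_mx_diag.
Qed.

End UnitaryConjugation.

Section SymmetricMatrices.
Local Open Scope complex_scope.
Local Open Scope sesquilinear_scope.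
Variables (R : realType) (p : nat).
Implicit Types (S A : 'M[R]_p).
Local Notation toC := (map_mx (real_complex R)).

(** The spectral theorem is applied to the complexification, which is Hermitian;
    its eigenvalues are real, although the diagonalizing matrix need not be. *)
Lemma symmetric_spectral S : S^T = S ->
  exists (D : 'rV[R]_p) (U : 'M[R[i]]_p),
    [/\ U *m U^t* = 1%:M, U^t* *m U = 1%:M &
        toC S = U^t* *m diag_mx (toC D) *m U].
Proof.
move=> Ssym; pose SC := toC S.
have SCh : SC \is hermsymmx.
  apply: realsym_hermsym.
    apply/is_hermitianmxP; rewrite expr0 scale1r map_mx_id//.
    by rewrite map_trmx Ssym.
  by apply/mxOverP => i j; rewrite mxE; apply/complex_realP; exists (S i j).
have Un := spectral_unitarymx SC.
have := hermitian_spectral_diag_real SCh.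
have /orthomx_spectralP := hermitian_normalmx SCh.
rewrite invmx_unitary// => e /mxOverP Dr.
exists (map_mx (@complex.Re R) (spectral_diag SC)), (spectralmx SC).
have -> : toC (map_mx (@complex.Re R) (spectral_diag SC)) = spectral_diag SC.
  by apply/rowP => k; rewrite !mxE RRe_real ?Dr.
split; first exact/unitarymxP.
  by rewrite -invmx_unitary// mulVmx// unitarymx_unit.
exact: e.
Qed.

Section Spectrum.
Variables (S : 'M[R]_p) (D : 'rV[R]_p) (U : 'M[R[i]]_p).
Hypotheses (UU : U *m U^t* = 1%:M) (U'U : U^t* *m U = 1%:M).
Hypothesis (SE : toC S = U^t* *m diag_mx (toC D) *m U).

(** The eigenvalues are exactly the diagonal entries, since a unitary change of
    basis maps an eigenvector of [S] to one of the diagonal matrix. *)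
Lemma spectrumP a : eigenvalue S a <-> exists k, a = D ord0 k.
Proof.
rewrite -(eigenvalue_map (real_complex R)); split => [/eigenvalueP[v]|[k ->]].
  rewrite SE => e v0; pose w := v *m U^t*.
  have we : w *m diag_mx (toC D) = a%:C *: w.
    by rewrite /w scalemxAl -e !mulmxA -[RHS]mulmxA UU mulmx1.
  have /rV0Pn[k wk] : w != 0.
    apply: contra_neq v0 => w0.
    by rewrite -[v]mulmx1 -U'U mulmxA -/w w0 mul0mx.
  exists k; move: (w) wk we => w' wk /rowP/(_ k).
  rewrite mul_mx_diag !mxE mulrC => /(mulIf wk).
  by move=> [].
apply/eigenvalueP; exists (row k U); last first.
  apply/negP => /eqP r0; move/matrixP : UU => /(_ k k).
  rewrite !mxE eqxx big1 => [/esym/eqP|j _]; first by rewrite oner_eq0.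
  by move/rowP : r0 => /(_ j); rewrite !mxE => ->; rewrite mul0r.
rewrite SE -row_mul !mulmxA UU mul1mx; apply/rowP => j.
by rewrite mul_diag_mx !mxE.
Qed.

Lemma spectral_quadE (E : 'rV[R]_p) (A : 'M[R]_p) (v : 'cV[R]_p) :
    toC A = U^t* *m diag_mx (toC E) *m U ->
  ((v^T *m A *m v) ord0 ord0)%:C =
    \sum_k (E ord0 k)%:C * `|(U *m toC v) k ord0| ^+ 2.
Proof.
move=> AE; pose w := U *m toC v.
have ->: ((v^T *m A *m v) ord0 ord0)%:C = (toC (v^T *m A *m v)) ord0 ord0 by rewrite [RHS]mxE.
have -> : toC (v^T *m A *m v) = w^t* *m diag_mx (toC E) *m w.
  have vE : toC v^T = (toC v)^t*.
    apply/matrixP => k l; rewrite !mxE; apply/esym/CrealP/complex_realP.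
    by exists (v l k).
  by rewrite !map_mxM AE /w trmx_mul map_mxM vE !mulmxA.
rewrite mxE; apply: eq_bigr => k _; rewrite -/w mul_mx_diag [X in X * _]mxE.
rewrite [w^t* _ _]mxE [w^T _ _]mxE [toC E _ _]mxE normCK; ring.
Qed.

(** A diagonal entry is the value of the quadratic form at a basis vector, hence
    an average of the eigenvalues with weights that sum to one by
    [unitary_col_norm]. *)
Lemma spectral_diagE (E : 'rV[R]_p) (A : 'M[R]_p) j :
    toC A = U^t* *m diag_mx (toC E) *m U ->
  (A j j)%:C = \sum_k (E ord0 k)%:C * `|U k j| ^+ 2.
Proof.
move=> AE; have := spectral_quadE (delta_mx j 0) AE.
rewrite trmx_delta -rowE -colE !mxE => ->; apply: eq_bigr => k _.
rewrite mxE (bigD1 j)//= big1 => [|l lj]; rewrite !mxE ?eqxx ?mulr1 ?addr0//.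
by rewrite (negPf lj) mulr0.
Qed.

Lemma spectral_mul (E F : 'rV[R]_p) (A B : 'M[R]_p) :
    toC A = U^t* *m diag_mx (toC E) *m U ->
    toC B = U^t* *m diag_mx (toC F) *m U ->
  toC (A *m B) = U^t* *m diag_mx (toC (\row_k (E ord0 k * F ord0 k))) *m U.
Proof.
move=> AE BE.
have -> : toC (\row_k (E ord0 k * F ord0 k)) = \row_k (toC E ord0 k * toC F ord0 k).
  by apply/rowP => k; rewrite !mxE -rmorphM.
rewrite map_mxM AE BE -mulmx_diag; move: (toC E) (toC F) (U) UU => e f V VV.
exact: unitary_conj_mul.
Qed.

Lemma unitary_col_norm j : \sum_k `|U k j| ^+ 2 = 1.
Proof.
move/matrixP : U'U => /(_ j j); rewrite !mxE eqxx mulr1n => <-.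
by apply: eq_bigr => k _; rewrite normCK !mxE mulrC.
Qed.

End Spectrum.

Lemma psdmx_eigenvalue_ge0 S a : psdmx S -> eigenvalue S a -> 0 <= a.
Proof.
move=> [Ssym Spos] /eigenvalueP[v e v0].
have := Spos v^T; rewrite trmxK e -scalemxAl mxE.
have : 0 < (v *m v^T) ord0 ord0.
  have /rV0Pn[k vk] := v0; rewrite mxE (bigD1 k)//= ltr_pwDl//.
    by rewrite !mxE -expr2 exprn_even_gt0.
  by apply: sumr_ge0 => i _; rewrite mxE -expr2 sqr_ge0.
by move=> h; rewrite pmulr_lge0.
Qed.

Section CovarianceSpectrum.
Variables (S : 'M[R]_p) (Spsd : psdmx S).

(** The infimum and the supremum which define the extreme eigenvalues are taken
    over a nonempty bounded set: it is bounded below by positivity, and above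
    because it is contained in the finite set of diagonal entries. *)
Lemma lambda_min_max_eigenvalue a : eigenvalue S a ->
  lambda_min S <= a <= lambda_max S.
Proof.
have [Ssym _] := Spsd; have [D [U [UU U'U SE]]] := symmetric_spectral Ssym.
move=> Sa; apply/andP; split.
  apply: ge_inf => //; exists 0 => b; exact: psdmx_eigenvalue_ge0.
apply: ub_le_sup => //; exists (\sum_k `|D ord0 k|) => b.
move=> /(spectrumP UU U'U SE)[k ->].
rewrite (le_trans (ler_norm _))// (bigD1 k)//= lerDl.
by apply: sumr_ge0 => i _.
Qed.

Lemma lambda_min_diag j : lambda_min S <= S j j.
Proof.
have [Ssym _] := Spsd; have [D [U [UU U'U SE]]] := symmetric_spectral Ssym.
rewrite -lecR (spectral_diagE j SE) -[leLHS]mulr1 -(unitary_col_norm U'U j).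
rewrite mulr_sumr ler_sum// => k _; rewrite ler_wpM2r ?exprn_ge0// lecR.
have := @lambda_min_max_eigenvalue (D ord0 k).
by case/(_ _)/andP => //; apply/(spectrumP UU U'U SE); exists k.
Qed.

(** The sum of squares of a row is a diagonal entry of [S *m S], whose
    eigenvalues are the squares of those of [S]. *)
Lemma lambda_max_row L j : lambda_max S <= L -> \sum_k S j k ^+ 2 <= L ^+ 2.
Proof.
move=> SL; have [Ssym _] := Spsd; have [D [U [UU U'U SE]]] := symmetric_spectral Ssym.
have -> : \sum_k S j k ^+ 2 = (S *m S) j j.
  rewrite mxE; apply: eq_bigr => k _.
  by rewrite expr2; congr (_ * _); rewrite -{1}Ssym mxE.
have S2 := spectral_mul UU SE SE.
rewrite -lecR (spectral_diagE j S2) -[leRHS]mulr1 -(unitary_col_norm U'U j).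
rewrite mulr_sumr ler_sum// => k _; rewrite ler_wpM2r ?exprn_ge0// lecR mxE -expr2.
have Dk : eigenvalue S (D ord0 k) by apply/(spectrumP UU U'U SE); exists k.
have D0 := psdmx_eigenvalue_ge0 Spsd Dk.
have /andP[_ h] := lambda_min_max_eigenvalue Dk.
have DL := le_trans h SL.
by rewrite ler_pXn2r// nnegrE (le_trans D0).
Qed.

End CovarianceSpectrum.

End SymmetricMatrices.

Section SquareRoot.
Local Open Scope complex_scope.
Local Open Scope sesquilinear_scope.
Variable R : realType.
Local Notation toC := (map_mx (real_complex R)).

Lemma psdmx_sqrt_exists p (S : 'M[R]_p) : psdmx S ->
  exists A, psdmx A /\ A *m A = S.
Proof.
case: p S => [|p'] S Spsd.
  (* polynomials in a matrix are only defined for positive size *)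
  by exists 0; split; [split=> [|v]|]; rewrite ?thinmx0//= ?mxE ?big_ord0// flatmx0 // mulmx0 mxE.
have [Ssym _] := Spsd; have [D [U [UU U'U SE]]] := symmetric_spectral Ssym.
have [q hq] := interpolation (@Num.sqrt R) [seq D ord0 k | k : 'I__].
pose A := horner_mx S q; pose E := map_mx (@Num.sqrt R) D.
have AE : toC A = U^t* *m diag_mx (toC E) *m U.
  have -> : toC E = map_mx (horner (map_poly (real_complex R) q)) (toC D).
    by apply/rowP => k; rewrite !mxE /= horner_map hq// map_f// mem_enum.
  by rewrite -unitary_conj_horner// -SE /A map_horner_mx.
have E0 k : 0 <= E ord0 k by rewrite mxE sqrtr_ge0.
have toC_inj : injective (toC : 'M[R]_p'.+1 -> _).
  by move=> B B' /matrixP h; apply/matrixP => i j; move: (h i j); rewrite !mxE => -[].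
exists A; split; [split=> [|v]|].
- elim/poly_ind: q @A {hq AE} => [|q c]; rewrite /= ?rmorph0 ?trmx0//.
  rewrite rmorphD rmorphM /= horner_mx_X horner_mx_C linearD/= trmx_mul.
  by rewrite tr_scalar_mx Ssym => ->; congr (_ + _); apply: comm_mx_horner.
- rewrite -ler0c (spectral_quadE v AE); apply: sumr_ge0 => k _.
  by rewrite mulr_ge0 ?exprn_ge0// ler0c.
- have DE : \row_k (E ord0 k * E ord0 k) = D.
    apply/rowP => k; rewrite !mxE -expr2 sqr_sqrtr//.
    by apply: (psdmx_eigenvalue_ge0 Spsd); apply/(spectrumP UU U'U SE); exists k.
  by apply: toC_inj; rewrite (spectral_mul UU AE AE) DE -SE.
Qed.



Lemma sqrtmxP p (S : 'M[R]_p) : psdmx S ->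
  psdmx (sqrtmx S) /\ sqrtmx S *m sqrtmx S = S.
Proof.
by move=> /psdmx_sqrt_exists[A hA]; rewrite /sqrtmx; case: xgetP => [_ _ //|/(_ A)].
Qed.

End SquareRoot.

(** * Independence of functions of disjoint blocks of variables *)

Section IndependentProduct.
Context (R : realType) d (T : measurableType d) (P : probability T R).
Local Open Scope ereal_scope.

(** The joint law of two independent variables is the product of their laws,
    so that Tonelli applies.  The positive parts only serve to have an integrand
    that is nonnegative on the whole plane. *)
Lemma independent_integral_mul (f g : {RV P >-> R}) :
    (forall A B, measurable A -> measurable B ->
      P (f @^-1` A `&` g @^-1` B) = P (f @^-1` A) * P (g @^-1` B)) ->
    (forall t, 0 <= f t)%R -> (forall t, 0 <= g t)%R ->
  \int[P]_t (f t * g t)%:E = (\int[P]_t (f t)%:E) * (\int[P]_t (g t)%:E).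
Proof.
move=> fg f0 g0; pose h t := (f t, g t).
have mh : measurable_fun setT h by exact/measurable_fun_pair.
pose hmix := isMeasurableFun.Build _ _ _ _ _ mh.
pose hM : {mfun T >-> (R * R)%type} := HB.pack h hmix.
pose mu := distribution P f; pose nu := distribution P g.
have hE C : measurable C -> (mu \x nu) C = pushforward P hM C.
  by move=> mC; apply: product_measure_unique.
pose phi (z : R * R) := (Num.max 0 z.1 * Num.max 0 z.2)%:E.
have phi0 z : 0 <= phi z by rewrite lee_fin mulr_ge0// le_max lexx.
have mphi : measurable_fun setT phi.
  apply/measurable_EFinP; apply: measurable_funM.
    exact: measurable_maxr.
  exact: measurable_maxr.
have max0 (r : R) : (0 <= r)%R -> Num.max 0%R r = r by move=> r0; rewrite max_r.
transitivity (\int[pushforward P hM]_z phi z).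
  rewrite ge0_integral_pushforward//.
  by apply: eq_integral => t _; rewrite /phi /= !max0.
transitivity (\int[mu \x nu]_z phi z).
  by apply: eq_measure_integral => C mC _; apply/esym/hE.
rewrite fubini_tonelli1//= /fubini_F.
have mE (k : {RV P >-> R}) : (forall t, 0 <= k t)%R ->
    \int[P]_t (k t)%:E = \int[distribution P k]_x (Num.max 0%R x)%:E.
  move=> k0; rewrite ge0_integral_distribution//.
  - by apply: eq_integral => t _ /=; rewrite max0.
  - by apply/measurable_EFinP; exact: measurable_maxr.
  - by move=> y; rewrite lee_fin le_max lexx.
have mmax : measurable_fun [set: R] (fun y : R => (Num.max 0%R y)%:E).
  by apply/measurable_EFinP; exact: measurable_maxr.
transitivity (\int[mu]_x ((Num.max 0%R x)%:E * \int[P]_t (g t)%:E)).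
  apply: eq_integral => x _; rewrite mE// /phi/=.
  under eq_integral do rewrite EFinM.
  rewrite ge0_integralZl//.
  - by move=> y _; rewrite lee_fin le_max lexx.
  - by rewrite lee_fin le_max lexx.
rewrite ge0_integralZr// -?mE//.
- by move=> y _; rewrite lee_fin le_max lexx.
- by apply: integral_ge0 => t _; rewrite lee_fin.
Qed.

End IndependentProduct.

Section BlockIndependence.
Context (R : realType) d (T : measurableType d) (P : probability T R).
Variables (I : finType) (X : I -> {RV P >-> R}).
Hypothesis Xindep : mutually_independent X.

(** The events that constrain each variable of the block separately: a pi-system
    which generates the events determined by the block. *)
Definition cylinder (J : {set I}) : set (set T) :=
  [set A | exists2 B : I -> set R, (forall i, measurable (B i)) &
    A = \bigcap_(i in [set` J]) X i @^-1` B i].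

Lemma cylinder_measurable J A : cylinder J A -> measurable A.
Proof.
move=> [B mB ->]; apply: fin_bigcap_measurable => // i _.
exact: measurable_funPTI.
Qed.

Lemma cylinder_setI J : setI_closed (cylinder J).
Proof.
move=> _ _ [B mB ->] [B' mB' ->]; exists (fun i => B i `&` B' i).
  by move=> i; exact: measurableI.
rewrite -bigcapI; apply: eq_bigcapr => i _; by rewrite preimage_setI.
Qed.

Lemma cylinderS (J K : {set I}) : J \subset K ->
  cylinder J `<=` cylinder K.
Proof.
move=> /fintype.subsetP JK A [B mB ->].
exists (fun i => if i \in J then B i else setT).
  by move=> i; case: ifP.
apply/seteqP; split=> t At i /= Ki; first by case: ifPn => // /At.
by move: (At i (JK i Ki)); rewrite /= Ki.
Qed.

(** The two families of constraints are merged into a single one on the union of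
    the blocks, to which the product rule applies. *)
Lemma cylinder_indep (J K : {set I}) A B : {in J, forall i, i \notin K} ->
  cylinder J A -> cylinder K B -> P (A `&` B) = (P A * P B)%E.
Proof.
move=> JK [A' mA ->] [B' mB ->].
pose C i := if i \in J then A' i else B' i.
have mC i : measurable (C i) by rewrite /C; case: ifP.
have CJ i : i \in J -> C i = A' i by rewrite /C => ->.
have CK i : i \in K -> C i = B' i.
  by rewrite /C => iK; case: ifP => // /JK; rewrite iK.
have -> : \bigcap_(i in [set` J]) X i @^-1` A' i =
          \bigcap_(i in [set` J]) X i @^-1` C i.
  by apply: eq_bigcapr => i /= /CJ ->.
have -> : \bigcap_(i in [set` K]) X i @^-1` B' i =
          \bigcap_(i in [set` K]) X i @^-1` C i.
  by apply: eq_bigcapr => i /= /CK ->.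
rewrite -bigcap_setU.
have -> : [set` J] `|` [set` K] = [set` (J :|: K)%SET].
  by apply/seteqP; split=> i /=; rewrite inE => /orP.
have UE (F : I -> \bar R) :
    (\prod_(i in J :|: K) F i = (\prod_(i in J) F i) * \prod_(i in K) F i)%E.
  rewrite (big_setID J)/=; congr (_ * _)%E; apply: eq_bigl => i.
    by rewrite !inE andb_orl andbb; case: (i \in J); rewrite ?andbF.
  by rewrite !inE; case: (boolP (i \in J)) => [/JK/negPf|].
by rewrite !Xindep// UE.
Qed.

Lemma measurable_block (J : {set I}) A : <<s cylinder J >> A -> measurable A.
Proof.
apply: smallest_sub; first exact: sigma_algebra_measurable.
exact: cylinder_measurable.
Qed.

(** A probability is determined by a pi-system, so the product rule extends from
    cylinders to the sigma-algebras they generate, one factor at a time. *)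
Lemma indep_pi_system (G : set (set T)) (B : set T) :
    setI_closed G -> G `<=` measurable -> measurable B ->
    (forall A, G A -> P (A `&` B) = P A * P B)%E ->
  forall A, <<s G >> A -> (P (A `&` B) = P A * P B)%E.
Proof.
move=> GI Gm mB GB.
have sGm A : <<s G >> A -> measurable A.
  by move: A; apply: smallest_sub => //; exact: sigma_algebra_measurable.
have QC (A : set T) : measurable A -> (P (A `&` B) = P A * P B)%E ->
    (P (~` A `&` B) = P (~` A) * P B)%E.
  move=> mA AB; rewrite setIC -setDE.
  have -> : P (B `\` A) = (P B - P (B `&` A))%E.
    by apply: measureD => //; rewrite ltey_eq fin_num_measure.
  rewrite setIC AB probability_setC// muleBl ?mul1e ?fin_num_measure//.
have QU (F : (set T)^nat) : (forall n, measurable (F n)) -> trivIset setT F ->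
    (forall n, P (F n `&` B) = P (F n) * P B)%E ->
    (P (\bigcup_k F k `&` B) = P (\bigcup_k F k) * P B)%E.
  move=> mF tF FB; rewrite setI_bigcupl measure_bigcup//; last 2 first.
    by move=> n _; exact: measurableI.
    exact: trivIset_setIr.
  rewrite measure_bigcup// [RHS]muleC -(@fineK _ (P B)) ?fin_num_measure//.
  rewrite -nneseriesZl//; apply: eq_eseriesr => n _.
  by rewrite fineK ?fin_num_measure// muleC; exact: FB.
apply: (@dynkin_induction _ (g_sigma_algebraType G) G) => //.
- by rewrite setTI probability_setT mul1e.
- by move=> A /sGm; exact: QC.
- by move=> F mF tF FB; apply: QU => // n; apply: sGm; exact: mF n.
Qed.

(** The product rule is extended to one sigma-algebra with the other event fixed
    in the pi-system, then to the other one. *)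
Lemma block_indep (J K : {set I}) A B : {in J, forall i, i \notin K} ->
  <<s cylinder J >> A -> <<s cylinder K >> B -> P (A `&` B) = (P A * P B)%E.
Proof.
move=> JK sA sB; apply: (@indep_pi_system (cylinder J)) sA.
- exact: cylinder_setI.
- exact: cylinder_measurable.
- exact: measurable_block sB.
move=> A' cA'; rewrite setIC muleC.
apply: (@indep_pi_system (cylinder K)) sB.
- exact: cylinder_setI.
- exact: cylinder_measurable.
- exact: cylinder_measurable cA'.
by move=> B' cB'; rewrite setIC muleC; exact: cylinder_indep cA' cB'.
Qed.

(** Boundedness makes every polynomial expression in the variables integrable,
    and the block records which variables an expression may depend on; this is
    all that the moment computations below need to know. *)
Record bounded_block (J : {set I}) (f : T -> R) : Prop := BoundedBlock {
  block_measurable : measurable_fun [set: g_sigma_algebraType (cylinder J)] f;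
  block_bounded : exists C : R, forall t, `|f t| <= C }.
Local Notation bb := bounded_block.

Lemma bb_cst J c : bb J (fun=> c).
Proof. by split; [exact: measurable_cst|exists `|c|]. Qed.

Lemma bbD J f g : bb J f -> bb J g -> bb J (fun t => f t + g t).
Proof.
move=> [mf [C hC]] [mg [D hD]]; split; first exact: measurable_funD.
by exists (C + D) => t; rewrite (le_trans (ler_normD _ _))// lerD.
Qed.

Lemma bbM J f g : bb J f -> bb J g -> bb J (fun t => f t * g t).
Proof.
move=> [mf [C hC]] [mg [D hD]]; split; first exact: measurable_funM.
by exists (C * D) => t; rewrite normrM ler_pM.
Qed.

Lemma bbN J f : bb J f -> bb J (fun t => - f t).
Proof.
move=> [mf [C hC]]; split; first exact: measurableT_comp.
by exists C => t; rewrite normrN.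
Qed.

Lemma bbB J f g : bb J f -> bb J g -> bb J (fun t => f t - g t).
Proof. by move=> bf bg; exact: bbD bf (bbN bg). Qed.

Lemma bbX J f n : bb J f -> bb J (fun t => f t ^+ n).
Proof.
move=> [mf [C hC]]; split; first exact: measurable_funX.
by exists (C ^+ n) => t; rewrite normrX lerXn2r// nnegrE (le_trans _ (hC t)).
Qed.

Lemma bb_sum J (K : Type) (r : seq K) (Q : pred K) (F : K -> T -> R) :
  (forall k, Q k -> bb J (F k)) -> bb J (fun t => \sum_(k <- r | Q k) F k t).
Proof.
move=> bF; elim: r => [|k r IH].
  by under eq_fun do rewrite big_nil; exact: bb_cst.
under eq_fun do rewrite big_cons; case: (boolP (Q k)) => // Qk.
by apply: bbD => //; exact: bF.
Qed.

Lemma bb_norm J f : bb J f -> bb J (fun t => `|f t|).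
Proof.
move=> [mf [C hC]]; split; first exact: measurableT_comp.
by exists C => t; rewrite normr_id.
Qed.

Lemma bbS (J K : {set I}) f : J \subset K -> bb J f -> bb K f.
Proof.
move=> JK [mf hf]; split=> // mT B mB.
have h : <<s cylinder J >> `<=` <<s cylinder K >>.
  apply: smallest_sub; first exact: smallest_sigma_algebra.
  by move=> A cA; apply: sub_gen_smallest; exact: cylinderS cA.
exact: h (mf measurableT B mB).
Qed.

Lemma bb_coord i (g : R -> R) : measurable_fun setT g ->
  (exists C : R, forall x, `|g x| <= C) -> bb [set i]%SET (g \o X i).
Proof.
move=> mg [C hC]; split; last by exists C => t; exact: hC.
move=> _ B mB; rewrite setTI; apply: sub_gen_smallest.
exists (fun=> g @^-1` B); first by move=> _; rewrite -[X in measurable X]setTI; exact: mg.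
apply/seteqP; split=> [t gt j /=|t /= /(_ i)]; first by rewrite inE => /eqP ->.
by apply; rewrite /= inE.
Qed.

Local Notation Ex := (Rintegral P setT).

Lemma bb_measurable J f : bb J f -> measurable_fun setT f.
Proof. by move=> [mf _] mT B mB; apply: measurable_block; exact: mf. Qed.

Lemma bb_integrable J f : bb J f -> P.-integrable setT (EFin \o f).
Proof.
move=> bf; have mf := bb_measurable bf; case: bf => _ [C hC].
apply: measurable_bounded_integrable => //.
  by rewrite ltey_eq fin_num_measure.
exists C; split; first exact: num_real.
by move=> D CD t _; apply: le_trans (hC t) _; exact: ltW.
Qed.

Lemma Ex_cst c : Ex (fun=> c) = c.
Proof.
transitivity (c * fine (P setT)); first exact: Rintegral_cst.
by rewrite probability_setT mulr1.
Qed.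

Lemma ExD J f g : bb J f -> bb J g ->
  Ex (fun t => f t + g t) = Ex f + Ex g.
Proof.
by move=> bf bg; rewrite RintegralD//; [exact: bb_integrable bf|exact: bb_integrable bg].
Qed.

Lemma ExZ J c f : bb J f -> Ex (fun t => c * f t) = c * Ex f.
Proof. by move=> bf; rewrite RintegralZl//; exact: bb_integrable bf. Qed.

Lemma ExB J f g : bb J f -> bb J g ->
  Ex (fun t => f t - g t) = Ex f - Ex g.
Proof.
by move=> bf bg; rewrite RintegralB//; [exact: bb_integrable bf|exact: bb_integrable bg].
Qed.

Lemma Ex_le J f g : bb J f -> bb J g -> (forall t, f t <= g t) ->
  Ex f <= Ex g.
Proof.
by move=> bf bg fg; apply: le_Rintegral => //; [exact: bb_integrable bf|exact: bb_integrable bg].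
Qed.

Lemma Ex_ge0 f : (forall t, 0 <= f t) -> 0 <= Ex f.
Proof. by move=> f0; apply: Rintegral_ge0. Qed.

Lemma Ex_sum J (K : Type) (r : seq K) (Q : pred K) (F : K -> T -> R) :
    (forall k, Q k -> bb J (F k)) ->
  Ex (fun t => \sum_(k <- r | Q k) F k t) = \sum_(k <- r | Q k) Ex (F k).
Proof.
move=> bF; elim: r => [|k r IH].
  by under eq_fun do rewrite big_nil; rewrite Ex_cst big_nil.
under eq_fun do rewrite big_cons; rewrite big_cons; case: (boolP (Q k)) => // Qk.
by rewrite (@ExD J) ?IH//; [exact: bF|exact: bb_sum].
Qed.

(** Adding constants reduces the claim to nonnegative functions. *)
Lemma ExM (J K : {set I}) f g : {in J, forall i, i \notin K} ->
  bb J f -> bb K g -> Ex (fun t => f t * g t) = Ex f * Ex g.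
Proof.
move=> JK bf bg.
have ExM0 f' g' : (forall t, 0 <= f' t) -> (forall t, 0 <= g' t) ->
    bb J f' -> bb K g' -> Ex (fun t => f' t * g' t) = Ex f' * Ex g'.
  move=> f0 g0 bf' bg'.
  pose fmix := isMeasurableFun.Build _ _ _ _ _ (bb_measurable bf').
  pose gmix := isMeasurableFun.Build _ _ _ _ _ (bb_measurable bg').
  pose fM : {mfun T >-> R} := HB.pack f' fmix.
  pose gM : {mfun T >-> R} := HB.pack g' gmix.
  rewrite /Rintegral (@independent_integral_mul _ _ _ P fM gM)//.
    by rewrite fineM// integrable_fin_num//; [exact: bb_integrable bf'|exact: bb_integrable bg'].
  move=> A B mA mB; apply: (block_indep JK).
    have [mf' _] := bf'; have := mf' measurableT A mA; by rewrite setTI.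
  have [mg' _] := bg'; have := mg' measurableT B mB; by rewrite setTI.
have [[_ [C hC]] [_ [D hD]]] := (bf, bg).
have bC L c : bb L (fun=> c) := bb_cst L c.
have inT L h : bb L h -> bb [set: I]%SET h by exact: bbS (finset.subsetT _).
pose f' t := f t + C; pose g' t := g t + D.
have bf' : bb J f' by exact: bbD.
have bg' : bb K g' by exact: bbD.
have Ef : Ex f = Ex f' - C by rewrite (ExD bf (bC J C)) Ex_cst addrK.
have Eg : Ex g = Ex g' - D by rewrite (ExD bg (bC K D)) Ex_cst addrK.
have -> : (fun t => f t * g t) =
    (fun t => (f' t * g' t - C * g' t) + (C * D - D * f' t)).
  by apply/funext => t; rewrite /f' /g'; ring.
have [bf2 bg2] := (inT _ _ bf', inT _ _ bg').
have f'0 t : 0 <= f' t by rewrite /f'; have := hC t; rewrite ler_norml => /andP[]; lra.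
have g'0 t : 0 <= g' t by rewrite /g'; have := hD t; rewrite ler_norml => /andP[]; lra.
have bM := bbM bf2 bg2.
have bCg : bb [set: I]%SET (fun t => C * g' t) by exact: bbM (bC _ C) bg2.
have bDf : bb [set: I]%SET (fun t => D * f' t) by exact: bbM (bC _ D) bf2.
rewrite (ExD (bbB bM bCg) (bbB (bC _ (C * D)) bDf)) (ExB bM bCg).
rewrite (ExB (bC _ (C * D)) bDf) (ExZ _ bf2) (ExZ _ bg2) Ex_cst ExM0//.
by rewrite Ef Eg; ring.
Qed.

End BlockIndependence.

(** * Moments of linear and quadratic forms *)

Section BlockTactics.
Context (R : realType) d (T : measurableType d) (P : probability T R).
Variables (I : finType) (X : I -> {RV P >-> R}).
Local Notation bb := (bounded_block X).
Local Notation full := [set: I]%SET.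

Lemma bb_full J f : bb J f -> bb full f.
Proof. exact: bbS (finset.subsetT _). Qed.

Lemma bb_Ul J K f : bb J f -> bb (J :|: K)%SET f.
Proof. exact: bbS (finset.subsetUl _ _). Qed.

Lemma bb_Ur J K f : bb K f -> bb (J :|: K)%SET f.
Proof. exact: bbS (finset.subsetUr _ _). Qed.
End BlockTactics.

Create HintDb bb.
#[global] Hint Resolve bb_cst : bb.
(** Checks that an expression built from sums, products and powers is a bounded
    function of a block; the leaves are found among the hypotheses, possibly for
    a smaller block. *)
Ltac bb_base :=
  try lazymatch goal with |- bounded_block ?X ?J (fun t => ?f t) =>
    change (bounded_block X J f) end;
  first [ solve [auto 3 with bb] | eapply bb_full; solve [eauto 3 with bb] ].
Ltac bbt := lazymatch goal with
  | |- bounded_block ?X ?J (fun t => (@?f t + @?g t)%R) => apply (@bbD _ _ _ _ _ X J f g); bbt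
  | |- bounded_block ?X ?J (fun t => (@?f t * @?g t)%R) => apply (@bbM _ _ _ _ _ X J f g); bbt
  | |- bounded_block ?X ?J (fun t => (- @?f t)%R) => apply (@bbN _ _ _ _ _ X J f); bbt
  | |- bounded_block ?X ?J (fun t => (@?f t ^+ ?n)%R) => apply (@bbX _ _ _ _ _ X J f n); bbt
  | |- bounded_block ?X ?J (fun t => `|@?f t|%R) => apply (@bb_norm _ _ _ _ _ X J f); bbt
  | |- bounded_block ?X ?J (fun t => @bigop.body _ _ _ (@?r t) (@?F t)) => apply bb_sum; intros; bbt
  | |- bounded_block _ _ (fun _ => ?c) => apply bb_cst
  | |- bounded_block _ _ _ => bb_base
  | |- _ => idtac
  end.

Section NumericInequalities.
Variable R : realFieldType.
Implicit Types (Q K k s : R).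

(** The term of first order in [a + b] is kept exactly, because its expectation
    vanishes in [qform_fourth]; the others are bounded by even powers.  The
    difference of the two sides is a sum of squares. *)
Lemma fourth_power_increment Q a b :
  (Q + (a + b)) ^+ 4 <= Q ^+ 4 + 4 * Q ^+ 3 * (a + b)
    + 16 * (Q ^+ 2 * a ^+ 2) + 16 * (Q ^+ 2 * b ^+ 2) + 24 * a ^+ 4 + 24 * b ^+ 4.
Proof.
rewrite -subr_ge0.
have -> : Q ^+ 4 + 4 * Q ^+ 3 * (a + b) + 16 * (Q ^+ 2 * a ^+ 2) +
  16 * (Q ^+ 2 * b ^+ 2) + 24 * a ^+ 4 + 24 * b ^+ 4 - (Q + (a + b)) ^+ 4 =
  2 * ((a + b) * (Q - (a + b))) ^+ 2 + 8 * (Q * (a - b)) ^+ 2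
  + 18 * ((a - b) * (a + b)) ^+ 2 + 3 * ((a - b) ^+ 2) ^+ 2.
  ring.
by rewrite !addr_ge0// mulr_ge0// sqr_ge0.
Qed.

Lemma mul_le_weighted_sqr (x y e : R) : 0 < e -> x * y <= (e * x ^+ 2 + y ^+ 2 / e) / 2.
Proof.
move=> e0; rewrite -subr_ge0.
have -> : (e * x ^+ 2 + y ^+ 2 / e) / 2 - x * y = (e * x - y) ^+ 2 / (2 * e).
  by field; rewrite gt_eqF.
by rewrite divr_ge0 ?sqr_ge0// mulr_ge0// ltW.
Qed.

Lemma variance_bound (k s K rs U V : R) : 0 <= U -> U <= V -> V <= K * rs ->
    s ^+ 2 <= k -> 0 <= k -> k <= K ->
  (k - 3 * s ^+ 2) * U + 2 * s ^+ 2 * V <= 3 * K ^+ 2 * rs.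
Proof.
move=> U0 UV VK sk k0 kK.
have V0 : 0 <= V by exact: le_trans UV.
have : k * V <= K * (K * rs) by apply: ler_pM.
have : k * U <= k * V by apply: ler_wpM2l.
have : s ^+ 2 * V <= k * V by apply: ler_wpM2r.
have : 0 <= s ^+ 2 * U by apply: mulr_ge0; rewrite ?sqr_ge0.
rewrite (_ : 3 * K ^+ 2 * rs = 3 * (K * (K * rs))); last by ring.
rewrite (_ : _ + _ = k * U - 3 * (s ^+ 2 * U) + 2 * (s ^+ 2 * V)); last by ring.
by lra.
Qed.

(** The arithmetic of one step of [qform_fourth].  The mixed term [x] is split
    with the weight [64 K N], so that at most half of the increment allowed
    by the induction hypothesis is used up by [q4]. *)
Lemma fourth_moment_step (K b N rs q4 q2 x l4 k s c2 c4 w : R) :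
    1 <= K -> 1 <= N -> 0 <= rs -> rs + 1 <= N -> 0 <= b -> 0 <= s -> s ^+ 2 <= k ->
    s <= K -> k <= K -> 0 <= c2 -> c2 <= K -> c4 = c2 ^+ 2 -> 0 <= w -> w <= b ->
    0 <= q2 -> q2 <= 3 * K ^+ 2 * rs -> 0 <= q4 -> 0 <= l4 -> l4 <= 3 * K ^+ 3 ->
    x <= (q4 / (64 * K * N) + l4 * (64 * K * N)) / 2 ->
    q4 <= rs * (2 ^+ 15 * K ^+ 5 * (N + b)) ->
  q4 + 16 * c2 * (k - s ^+ 2) * q2 + 64 * s * x + 24 * c4 * w + 384 * k * l4
    <= (rs + 1) * (2 ^+ 15 * K ^+ 5 * (N + b)).
Proof.
move=> K1 N1 rs0 rsN b0 s0 sk sK kK c0 cK -> w0 wb q20 q2K q40 l40 l4K xl q4D.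
have K0 : 0 < K by exact: lt_le_trans K1.
have N0 : 0 < N by exact: lt_le_trans N1.
have k0 : 0 <= k by rewrite (le_trans _ sk)// sqr_ge0.
set D := 2 ^+ 15 * K ^+ 5 * (N + b) in q4D *.
have K5 : 0 <= K ^+ 5 by rewrite exprn_ge0// ltW.
have KN : 0 <= K ^+ 5 * N by rewrite mulr_ge0// ltW.
have Kb : 0 <= K ^+ 5 * b by rewrite mulr_ge0.
have pw m : (m <= 5)%N -> K ^+ m <= K ^+ 5 by move=> m5; rewrite ler_weXn2l.
(* apart from the half of D spent on the mixed term, each increment is at most
   a multiple of K^5 N or of K^5 b *)
have e1 : 16 * c2 * (k - s ^+ 2) * q2 <= 48 * (K ^+ 5 * N).
  have h1 : c2 * (k - s ^+ 2) <= K * K.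
    by apply: ler_pM => //; [rewrite subr_ge0|rewrite (le_trans _ kK)// gerBl sqr_ge0].
  have h2 : c2 * (k - s ^+ 2) * q2 <= K * K * (3 * K ^+ 2 * rs).
    by apply: ler_pM => //; apply: mulr_ge0 => //; rewrite subr_ge0.
  have h3 : K * K * (3 * K ^+ 2 * rs) <= 3 * (K ^+ 5 * N).
    rewrite (_ : K * K * _ = 3 * (K ^+ 4 * rs)); last by ring.
    rewrite ler_pM2l// ler_pM//; [by rewrite exprn_ge0// ltW|exact: pw|by rewrite (le_trans _ rsN)// lerDl].
  have -> : 16 * c2 * (k - s ^+ 2) * q2 = 16 * (c2 * (k - s ^+ 2) * q2) by ring.
  by move: h2 h3; clear; lra.
have e2 : 64 * s * x <= D / 2 + 2 ^+ 13 * (K ^+ 5 * N).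
  have h1 : s * (q4 / (64 * K * N)) <= D / 64.
    have -> : s * (q4 / (64 * K * N)) = (s / K) * (q4 / N) / 64 by field; rewrite !gt_eqF.
    rewrite ler_pM2r// -[leRHS]mul1r ler_pM//.
    - by rewrite divr_ge0// ltW.
    - by rewrite divr_ge0// ltW.
    - by rewrite ler_pdivrMr// mul1r.
    - rewrite ler_pdivrMr// (le_trans q4D)// mulrC ler_wpM2l//; last by rewrite (le_trans _ rsN)// lerDl.
      by apply: mulr_ge0; [apply: mulr_ge0 => //; exact: exprn_ge0|apply: addr_ge0 => //; exact: ltW].
  have h2 : s * (l4 * (64 * K * N)) <= 192 * (K ^+ 5 * N).
    have -> : 192 * (K ^+ 5 * N) = K * ((3 * K ^+ 3) * (64 * K * N)) by ring.
    have kn : 0 <= 64 * K * N by rewrite !mulr_ge0// ltW.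
    apply: ler_pM => //; first exact: mulr_ge0.
    by apply: ler_wpM2r.
  have h3 : s * x <= s * ((q4 / (64 * K * N) + l4 * (64 * K * N)) / 2) by exact: ler_wpM2l.
  have -> : 64 * s * x = 64 * (s * x) by ring.
  have h4 : s * ((q4 / (64 * K * N) + l4 * (64 * K * N)) / 2) =
    (s * (q4 / (64 * K * N)) + s * (l4 * (64 * K * N))) / 2 by ring.
  rewrite h4 in h3; move: h1 h2 h3.
  set a1 := s * (_ / _); set a2 := s * (_ * _); set a3 := s * x; move: KN; clear; lra.
have e3 : 24 * c2 ^+ 2 * w <= 24 * (K ^+ 5 * b).
  rewrite -mulrA ler_pM2l// ler_pM ?sqr_ge0//.
  by rewrite (le_trans _ (pw 2%N _))// ler_pXn2r ?nnegrE// ltW.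
have e4 : 384 * k * l4 <= 2 ^+ 11 * (K ^+ 5 * N).
  have h1 : k * l4 <= K * (3 * K ^+ 3) by apply: ler_pM.
  have h2 : K ^+ 4 * 1 <= K ^+ 5 * N.
    by apply: ler_pM => //; [rewrite exprn_ge0// ltW|exact: pw].
  have -> : 384 * k * l4 = 384 * (k * l4) by ring.
  have h3 : K * (3 * K ^+ 3) = 3 * (K ^+ 4 * 1) by ring.
  by move: h1 h2 h3 KN; clear; lra.
have DE : D = 2 ^+ 15 * (K ^+ 5 * N) + 2 ^+ 15 * (K ^+ 5 * b) by rewrite /D; ring.
by rewrite mulrDl mul1r; move: e1 e2 e3 e4 DE q4D KN Kb; clear; lra.
Qed.

End NumericInequalities.

Section Moments.
Context (R : realType) d (T : measurableType d) (P : probability T R).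
Variables (I : finType) (X : I -> {RV P >-> R}).
Hypothesis Xindep : mutually_independent X.
Local Notation bb := (bounded_block X).
Local Notation Ex := (Rintegral P setT).
Local Notation full := [set: I]%SET.
Local Notation ED := (ExD (X := X) (J := full)).
Local Notation EZ := (ExZ (X := X) (J := full)).
Local Notation ES := (Ex_sum (X := X) (J := full)).

Variables (u : I -> T -> R) (s m3 k : R).
Hypothesis bu : forall i, bb [set i]%SET (u i).
Hypothesis u1 : forall i, Ex (u i) = 0.
Hypothesis u2 : forall i, Ex (fun t => u i t ^+ 2) = s.
Hypothesis u3 : forall i, Ex (fun t => u i t ^+ 3) = m3.
Hypothesis u4 : forall i, Ex (fun t => u i t ^+ 4) = k.

Lemma Ex_split (W : {set I}) i f g : bb W f -> i \notin W ->
  bb [set i]%SET g -> Ex (fun t => f t * g t) = Ex f * Ex g.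
Proof.
move=> bf iW bg; apply: (ExM Xindep _ bf bg) => j jW; rewrite inE.
by apply: contraNneq iW => <-.
Qed.

Lemma Ex_mul1 (W : {set I}) i f : bb W f -> i \notin W ->
  Ex (fun t => f t * u i t) = 0.
Proof. by move=> bf iW; rewrite (Ex_split bf iW) ?u1 ?mulr0. Qed.

Lemma Ex_mul2 (W : {set I}) i f : bb W f -> i \notin W ->
  Ex (fun t => f t * u i t ^+ 2) = Ex f * s.
Proof. by move=> bf iW; rewrite (Ex_split bf iW) ?u2//; bbt. Qed.

Lemma Ex_mul3 (W : {set I}) i f : bb W f -> i \notin W ->
  Ex (fun t => f t * u i t ^+ 3) = Ex f * m3.
Proof. by move=> bf iW; rewrite (Ex_split bf iW) ?u3//; bbt. Qed.

Lemma Ex_mul4 (W : {set I}) i f : bb W f -> i \notin W ->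
  Ex (fun t => f t * u i t ^+ 4) = Ex f * k.
Proof. by move=> bf iW; rewrite (Ex_split bf iW) ?u4//; bbt. Qed.

Definition linform (r : seq I) (w : I -> T -> R) t := \sum_(i <- r) w i t * u i t.
Definition sqweight (r : seq I) (w : I -> T -> R) t := \sum_(i <- r) w i t ^+ 2.
Definition setof (r : seq I) : {set I} := [set i in r]%SET.

(** The weights may themselves be random as long as they depend on other
    variables than the form: an off-diagonal Gram entry is a linear form in the
    second column with weights that depend on the first. *)
Section RandomWeights.
Variables (W : {set I}) (w : I -> T -> R).
Hypothesis bw : forall i, bb W (w i).

Lemma bb_linform r : bb (W :|: setof r)%SET (linform r w).
Proof.
rewrite /linform; elim: r => [|i r IH].
  by under eq_fun do rewrite big_nil; bbt.
under eq_fun do rewrite big_cons.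
apply: bbD; last first.
  by apply: bbS IH; apply/fintype.subsetP => j; rewrite !inE => /orP[->|->]; rewrite ?orbT.
apply: bbM; first exact: bb_Ul.
by apply: bbS (bu i); apply/fintype.subsetP => j; rewrite !inE => ->; rewrite orbT.
Qed.

Lemma bb_sqweight r : bb W (sqweight r w).
Proof. by rewrite /sqweight; bbt. Qed.

Lemma linform_mean r h : bb W h -> {in r, forall i, i \notin W} ->
  Ex (fun t => linform r w t * h t) = 0.
Proof.
move=> bh rW; rewrite /linform; under eq_fun do rewrite mulr_suml.
under eq_fun do rewrite big_seq.
rewrite ES => [|i _]; last first.
  by bbt.
apply: big1_seq => i /andP[_ ir].
rewrite (_ : (fun t => _) = (fun t => (w i t * h t) * u i t)); last first.
  by apply/funext => t; ring.
by rewrite (Ex_mul1 (W := W)) ?rW//; bbt.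
Qed.

Lemma linform_sqr r h : uniq r -> bb W h -> {in r, forall i, i \notin W} ->
  Ex (fun t => linform r w t ^+ 2 * h t) = s * Ex (fun t => sqweight r w t * h t).
Proof.
move=> + bh; rewrite /linform /sqweight; elim: r => [_ _|i r IH /= /andP[ir ur] rW].
  under eq_fun do rewrite big_nil expr0n mul0r.
  by under [in RHS]eq_fun do rewrite big_nil mul0r; rewrite Ex_cst mulr0.
have {}IH := IH ur (fun j jr => rW j (mem_behead (s := i :: r) jr)).
have iW : i \notin W by rewrite rW ?mem_head.
under eq_fun do rewrite big_cons -/(linform r w _).
under [in RHS]eq_fun do rewrite big_cons -/(sqweight r w _).
have bL := bb_linform r; have bV := bb_sqweight r.
have iWr : i \notin (W :|: setof r)%SET by rewrite !inE negb_or iW.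
have bW f : bb W f -> bb (W :|: setof r)%SET f by exact: bb_Ul.
rewrite (_ : (fun t => _) = (fun t => linform r w t ^+ 2 * h t
   + (2 * (linform r w t * w i t * h t)) * u i t + (w i t ^+ 2 * h t) * u i t ^+ 2)); last first.
  by apply/funext => t; ring.
rewrite ED; [|by bbt..].
rewrite ED; [|by bbt..].
rewrite (Ex_mul1 (W := (W :|: setof r)%SET))//; last by bbt.
rewrite (Ex_mul2 (W := W))//; last by bbt.
rewrite addr0 IH.
under [in RHS]eq_fun do rewrite mulrDl addrC.
rewrite ED; [|by bbt..].
by rewrite mulrDr [s * Ex (fun t => w i t ^+ 2 * _)]mulrC.
Qed.

(** The variables are added one at a time.  The new variable has mean
    zero, and its third power is multiplied by a term that is linear in the form
    and so has mean zero too; what remains is dominated by the square of the sum of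
    squared weights because [s ^+ 2 <= k]. *)
Lemma linform_fourth r : uniq r -> {in r, forall i, i \notin W} ->
  s ^+ 2 <= k ->
  Ex (fun t => linform r w t ^+ 4) <= 3 * k * Ex (fun t => sqweight r w t ^+ 2).
Proof.
move=> + + sk; elim: r => [_ _|i r IH /= /andP[ir ur] rW].
  rewrite /linform /sqweight; under eq_fun do rewrite big_nil expr0n.
  by under [in leRHS]eq_fun do rewrite big_nil expr0n; rewrite Ex_cst mulr0.
have rW' j : j \in r -> j \notin W by move=> jr; rewrite rW// inE jr orbT.
have {}IH := IH ur rW'.
have iW : i \notin W by rewrite rW ?mem_head.
have LE t : linform (i :: r) w t = w i t * u i t + linform r w t.
  by rewrite /linform big_cons.
have VE t : sqweight (i :: r) w t = w i t ^+ 2 + sqweight r w t.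
  by rewrite /sqweight big_cons.
under eq_fun do rewrite LE; under [in leRHS]eq_fun do rewrite VE.
have bL := bb_linform r; have bV := bb_sqweight r.
have iWr : i \notin (W :|: setof r)%SET by rewrite !inE negb_or iW.
have bW f : bb W f -> bb (W :|: setof r)%SET f by exact: bb_Ul.
have bw2 : bb W (fun t => w i t ^+ 2) by bbt.
have bw3 : bb W (fun t => w i t ^+ 3) by bbt.
have bw4 : bb W (fun t => w i t ^+ 4) by bbt.
have -> : Ex (fun t => (w i t * u i t + linform r w t) ^+ 4) =
    Ex (fun t => linform r w t ^+ 4) + 6 * s ^+ 2 * Ex (fun t => sqweight r w t * w i t ^+ 2)
    + k * Ex (fun t => w i t ^+ 4).
  rewrite (_ : (fun t => _) = (fun t => linform r w t ^+ 4
    + (4 * (linform r w t ^+ 3 * w i t)) * u i t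
    + (6 * (linform r w t ^+ 2 * w i t ^+ 2)) * u i t ^+ 2
    + (4 * (linform r w t * w i t ^+ 3)) * u i t ^+ 3
    + w i t ^+ 4 * u i t ^+ 4)); last by apply/funext => t; ring.
  do 4![rewrite ED; [|by bbt..]].
  rewrite (Ex_mul1 (W := (W :|: setof r)%SET))//; [|by bbt..].
  rewrite (Ex_mul2 (W := (W :|: setof r)%SET))//; [|by bbt..].
  rewrite (Ex_mul3 (W := (W :|: setof r)%SET))//; [|by bbt..].
  rewrite (Ex_mul4 (W := W))//; [|by bbt..].
  rewrite !EZ; [|by bbt..].
  rewrite linform_sqr// linform_mean//; ring.
rewrite (_ : (fun t => (_ + _) ^+ 2) = (fun t => w i t ^+ 4
   + 2 * (sqweight r w t * w i t ^+ 2) + sqweight r w t ^+ 2)); last first.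
  by apply/funext => t; ring.
do 2![rewrite ED; [|by bbt..]]; rewrite EZ; [|by bbt].
set A := Ex _ in IH *; set B := Ex _ in IH *; set C := Ex _; set D := Ex _.
have C0 : 0 <= C.
  apply: Ex_ge0 => t; rewrite mulr_ge0 ?sqr_ge0//.
  by apply: sumr_ge0 => j _; rewrite sqr_ge0.
have D0 : 0 <= D by apply: Ex_ge0 => t; rewrite (exprM _ 2 2) sqr_ge0.
have k0 : 0 <= k by rewrite (le_trans _ sk)// sqr_ge0.
nra.
Qed.

End RandomWeights.

Section QuadraticForm.
Variable c : I -> I -> R.
Hypothesis csym : forall i j, c i j = c j i.

Definition qform (r : seq I) t :=
  \sum_(i <- r) \sum_(j <- r) c i j * u i t * u j t - s * \sum_(i <- r) c i i.

Local Notation L i r := (linform r (fun j _ => c i j)).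

(** The increment is the sum of a centred square and of twice the product of the
    new variable with a linear form in the previous ones. *)
Lemma qform_cons i r t :
  qform (i :: r) t = qform r t + (c i i * (u i t ^+ 2 - s) + 2 * (u i t * L i r t)).
Proof.
rewrite /qform !big_cons.
under [\sum_(_ <- r) \sum_(_ <- _ :: _) _]eq_bigr do rewrite big_cons.
rewrite big_split/= /linform.
have -> : \sum_(j <- r) c j i * u j t * u i t = u i t * \sum_(j <- r) c i j * u j t.
  by rewrite mulr_sumr; apply: eq_bigr => j _; rewrite csym; ring.
have -> : \sum_(j <- r) c i j * u i t * u j t = u i t * \sum_(j <- r) c i j * u j t.
  by rewrite mulr_sumr; apply: eq_bigr => j _; ring.
ring.
Qed.

Lemma bb_qform r : bb (setof r) (qform r).
Proof.
have bj j : j \in r -> bb (setof r) (u j).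
  by move=> jr; apply: bbS (bu j); apply/fintype.subsetP => l; rewrite !inE => /eqP ->.
rewrite /qform.
apply: bbB; last exact: bb_cst.
under eq_fun do rewrite big_seq.
apply: bb_sum => i ir; under eq_fun do rewrite big_seq.
by apply: bb_sum => j jr; apply: bbM; [apply: bbM; [exact: bb_cst|]|]; exact: bj.
Qed.

Lemma bb_weights i r : bb (setof r) (L i r).
Proof.
have := @bb_linform finset.set0 (fun j _ => c i j) (fun j => bb_cst _ _ _) r.
by rewrite finset.set0U.
Qed.

Let notin0 (r : seq I) : {in r, forall i, i \notin (finset.set0 : {set I})}.
Proof. by move=> i _; rewrite inE. Qed.

Let bbc i := fun j => bb_cst X finset.set0 (c i j).

Lemma weights_mean i r : Ex (L i r) = 0.
Proof.
have := @linform_mean finset.set0 (fun j _ => c i j) (bbc i) r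
  (fun=> 1) (bb_cst _ _ _) (@notin0 r).
by under eq_fun do rewrite mulr1.
Qed.

Lemma weights_sqr i r : uniq r -> Ex (fun t => L i r t ^+ 2) = s * \sum_(j <- r) c i j ^+ 2.
Proof.
move=> ur; have := @linform_sqr finset.set0 (fun j _ => c i j) (bbc i) r
  (fun=> 1) ur (bb_cst _ _ _) (@notin0 r).
under eq_fun do rewrite mulr1; move=> ->.
by under eq_fun do rewrite mulr1; rewrite /sqweight Ex_cst.
Qed.

Lemma weights_fourth i r : uniq r -> s ^+ 2 <= k ->
  Ex (fun t => L i r t ^+ 4) <= 3 * k * (\sum_(j <- r) c i j ^+ 2) ^+ 2.
Proof.
move=> ur sk; have := @linform_fourth finset.set0 (fun j _ => c i j) (bbc i)
  r ur (@notin0 r) sk.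
by rewrite /sqweight Ex_cst.
Qed.

Lemma qform_mean r : uniq r -> Ex (qform r) = 0.
Proof.
elim: r => [_|i r IH /= /andP[ir ur]].
  rewrite (_ : qform [::] = fun=> 0) ?Ex_cst//.
  by apply/funext => t; rewrite /qform !big_nil mulr0 subr0.
have bQ := bb_qform r; have bL := bb_weights i r.
rewrite (_ : qform (i :: r) = (fun t => qform r t + (- s * c i i)
   + 2 * (L i r t * u i t) + c i i * u i t ^+ 2)); last first.
  by apply/funext => t; rewrite qform_cons; ring.
have iWr : i \notin setof r by rewrite inE.
do 3![rewrite ED; [|by bbt..]]; rewrite !EZ; [|by bbt..].
by rewrite IH// (Ex_mul1 bL)// u2 Ex_cst; ring.
Qed.

(** For Gaussian moments [k = 3 s ^+ 2] only the second term remains, which is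
    why the excess kurtosis can be read off. *)
Lemma qform_sqr r : uniq r ->
  Ex (fun t => qform r t ^+ 2) = (k - 3 * s ^+ 2) * \sum_(i <- r) c i i ^+ 2
    + 2 * s ^+ 2 * \sum_(i <- r) \sum_(j <- r) c i j ^+ 2.
Proof.
elim: r => [_|i r IH /= /andP[ir ur]].
  rewrite /qform; under eq_fun do rewrite !big_nil mulr0 subr0 expr0n.
  by rewrite Ex_cst !big_nil /= !mulr0 addr0.
have bQ := bb_qform r; have bL := bb_weights i r.
under eq_fun do rewrite qform_cons.
have iWr : i \notin setof r by rewrite inE.
rewrite (_ : (fun t => _) = (fun t => (qform r t ^+ 2 + (- 2 * (s * c i i)) * qform r t + (s * c i i) ^+ 2)
   + (4 * ((qform r t - s * c i i) * L i r t)) * u i t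
   + (2 * c i i * qform r t + (- 2 * (s * c i i) * c i i + 4 * L i r t ^+ 2)) * u i t ^+ 2
   + (4 * c i i * L i r t) * u i t ^+ 3 + (c i i ^+ 2) * u i t ^+ 4)); last first.
  by apply/funext => t; ring.
do 6![rewrite ED; [|by bbt..]].
rewrite (Ex_mul1 (W := setof r))//; [|by bbt..].
rewrite (Ex_mul2 (W := setof r))//; [|by bbt..].
rewrite (Ex_mul3 (W := setof r))//; [|by bbt..].
rewrite (Ex_mul4 (W := setof r))//; [|by bbt..].
do 2![rewrite ED; [|by bbt..]].
rewrite !EZ; [|by bbt..].
rewrite IH// qform_mean// weights_mean weights_sqr// !Ex_cst !big_cons.
have -> : \sum_(j <- r) \sum_(l <- i :: r) c j l ^+ 2 =
    \sum_(j <- r) c i j ^+ 2 + \sum_(j <- r) \sum_(l <- r) c j l ^+ 2.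
  rewrite -big_split/=; apply: eq_bigr => j _.
  by rewrite big_cons csym.
ring.
Qed.


(** The rows of the coefficient matrix have bounded norm, so adding a variable
    increases the fourth moment by a constant times [N + b]: the mixed terms are
    controlled by the variance of the form, of order [N], and by the fourth
    moment of a row form, of order one.  The number [N] bounds all sizes at once
    so that the increment does not vary along the induction. *)
Lemma qform_fourth (K b : R) (N : nat) r : uniq r -> (size r <= N)%N ->
    0 <= s -> s ^+ 2 <= k -> 1 <= K -> s <= K -> k <= K ->
    {in r, forall i, \sum_(j <- r) c i j ^+ 2 <= K} ->
    (forall i, Ex (fun t => (u i t ^+ 2 - s) ^+ 4) <= b) ->
  Ex (fun t => qform r t ^+ 4) <=
  (size r)%:R * (2 ^+ 15 * K ^+ 5 * (N%:R + b)).
Proof.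
move=> + + s0 sk K1 sK kK + hb.
have k0 : 0 <= k by rewrite (le_trans _ sk)// sqr_ge0.
have K0 : 0 <= K by lra.
elim: r => [_ _ _|i r IH /= /andP[ir ur] rN rowK].
  rewrite (_ : (fun t => _) = fun=> 0) ?Ex_cst ?mul0r//.
  by apply/funext => t; rewrite /qform !big_nil mulr0 subr0 expr0n.
have rowc j : j \in i :: r -> c j i ^+ 2 + \sum_(l <- r) c j l ^+ 2 <= K.
  by move=> /rowK; rewrite big_cons.
have sqs j : 0 <= \sum_(l <- r) c j l ^+ 2 by apply: sumr_ge0 => l _; exact: sqr_ge0.
have rowK' : {in r, forall j, \sum_(l <- r) c j l ^+ 2 <= K}.
  move=> j jr; have := rowc j; rewrite inE jr orbT => /(_ isT).
  by have := sqr_ge0 (c j i); lra.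
have {}IH := IH ur (ltnW rN) rowK'.
set rs : R := (size r)%:R; have rs0 : 0 <= rs by exact: ler0n.
have rsN : rs + 1 <= N%:R by rewrite natr1 ler_nat.
have N1 : 1 <= N%:R :> R by rewrite (le_trans _ rsN)// lerDr.
have ci : c i i ^+ 2 <= K by rewrite (le_trans _ (rowc i (mem_head _ _)))// lerDl.
have cr : \sum_(l <- r) c i l ^+ 2 <= K.
  by rewrite (le_trans _ (rowc i (mem_head _ _)))// lerDr sqr_ge0.
have bQ := bb_qform r; have bL := bb_weights i r.
have iWr : i \notin setof r by rewrite inE.
pose Q := qform r; pose l := L i r.
have bQf : bb full Q by exact: bb_full bQ.
have blf : bb full l by exact: bb_full bL.
have buf : bb full (u i) by exact: bb_full (bu i).
have Q2 : Ex (fun t => Q t ^+ 2) <= 3 * K ^+ 2 * rs.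
  rewrite /Q qform_sqr//.
  have h1 : \sum_(j <- r) c j j ^+ 2 <= \sum_(j <- r) \sum_(l <- r) c j l ^+ 2.
    rewrite [leLHS]big_seq [leRHS]big_seq; apply: ler_sum => j jr.
    by rewrite [leRHS](big_rem j jr)/= lerDl; apply: sumr_ge0 => l' _; exact: sqr_ge0.
  have h2 : \sum_(j <- r) \sum_(l <- r) c j l ^+ 2 <= K * rs.
    rewrite [leLHS]big_seq.
    apply: (@le_trans _ _ (\sum_(j <- r | j \in r) K)); first exact: ler_sum.
    by rewrite -big_seq big_const_seq count_predT iter_addr addr0 mulr_natr.
  have h3 : 0 <= \sum_(j <- r) c j j ^+ 2 by apply: sumr_ge0 => j _; exact: sqr_ge0.
  exact: variance_bound.
have l4 : Ex (fun t => l t ^+ 4) <= 3 * K ^+ 3.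
  rewrite /l (le_trans (weights_fourth i ur sk))//.
  rewrite (_ : 3 * K ^+ 3 = 3 * K * K ^+ 2); last by ring.
  rewrite ler_pM ?mulr_ge0// ?sqr_ge0//; first by rewrite ler_pM2l.
  by rewrite ler_pXn2r ?nnegrE.
have bG : bb full (fun t => Q t ^+ 2 * l t ^+ 2) by bbt.
have x2 : Ex (fun t => Q t ^+ 2 * l t ^+ 2) <=
    (Ex (fun t => Q t ^+ 4) / (64 * K * N%:R) + Ex (fun t => l t ^+ 4) * (64 * K * N%:R)) / 2.
  have e0 : 0 < (64 * K * N%:R)^-1.
    by rewrite invr_gt0 !mulr_gt0// (lt_le_trans ltr01).
  have -> : (Ex (fun t => Q t ^+ 4) / (64 * K * N%:R) + Ex (fun t => l t ^+ 4) * (64 * K * N%:R)) / 2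
      = Ex (fun t => ((64 * K * N%:R)^-1 / 2) * Q t ^+ 4 + (64 * K * N%:R / 2) * l t ^+ 4).
    rewrite ED; [|by bbt..]; rewrite !EZ; [|by bbt..]; ring.
  apply: (Ex_le bG) => [|t]; first by bbt.
  rewrite (le_trans (mul_le_weighted_sqr _ _ e0))// invrK -!exprM le_eqVlt.
  by apply/orP; left; apply/eqP; ring.
rewrite -natr1 -/rs.
apply: le_trans (fourth_moment_step (c2 := c i i ^+ 2) K1 N1 rs0 rsN _ s0 sk sK kK _ ci
  (erefl _) _ (hb i) _ Q2 _ _ l4 x2 IH); try (by apply: Ex_ge0 => t; rewrite ?(exprM _ 2 2) sqr_ge0); last 2 first.
- rewrite (le_trans _ (hb i))//; by apply: Ex_ge0 => t; rewrite ?(exprM _ 2 2) sqr_ge0.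
- exact: sqr_ge0.
(* the increment of [qform_cons], with its cubic term still exact, inserted in
   [fourth_power_increment] and expanded in powers of the new variable *)
pose G t := Q t ^+ 4 + (4 * c i i * Q t ^+ 3) * u i t ^+ 2 + (- 4 * c i i * s) * Q t ^+ 3
   + (8 * Q t ^+ 3 * l t) * u i t + (16 * c i i ^+ 2 * Q t ^+ 2) * u i t ^+ 4
   + (- 32 * c i i ^+ 2 * s * Q t ^+ 2) * u i t ^+ 2 + (16 * c i i ^+ 2 * s ^+ 2) * Q t ^+ 2
   + (64 * (Q t ^+ 2 * l t ^+ 2)) * u i t ^+ 2
   + (24 * c i i ^+ 4) * (u i t ^+ 2 - s) ^+ 4 + (384 * l t ^+ 4) * u i t ^+ 4.
have bGf : bb full G by rewrite /G; bbt.
apply: (@le_trans _ _ (Ex G)).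
  apply: Ex_le bGf _ => [|t].
    by have := bb_full (bb_qform (i :: r)) => bq; bbt.
  rewrite qform_cons -/(Q t) -/(l t) (le_trans (fourth_power_increment _ _ _))//.
  by rewrite le_eqVlt; apply/orP; left; apply/eqP; rewrite /G; ring.
rewrite /G.
do 9![rewrite ED; [|by bbt..]].
rewrite (Ex_mul1 (W := setof r) (i := i))//; [|by bbt..].
do 3![rewrite (Ex_mul2 (W := setof r) (i := i))//; [|by bbt..]].
do 2![rewrite (Ex_mul4 (W := setof r) (i := i))//; [|by bbt..]].
rewrite !EZ; [|by bbt..].
rewrite le_eqVlt; apply/orP; left; apply/eqP.
ring.
Qed.

End QuadraticForm.
End Moments.

(** * Deterministic deviation bounds *)

Section Deviations.
Variable R : realFieldType.

Lemma sum_sqr_le (m : nat) (F : 'I_m -> R) :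
  (\sum_i F i) ^+ 2 <= m%:R * \sum_i F i ^+ 2.
Proof.
rewrite expr2 mulr_suml.
under eq_bigr do rewrite mulr_sumr.
apply: (@le_trans _ _ (\sum_(i < m) \sum_(j < m) (F i ^+ 2 + F j ^+ 2) / 2)).
  apply: ler_sum => i _; apply: ler_sum => j _.
  by have := sqr_ge0 (F i - F j); rewrite sqrrB -mulr_natr; lra.
under eq_bigr do rewrite -mulr_suml big_split/= sumr_const card_ord.
rewrite -mulr_suml big_split/= sumr_const card_ord sumrMnl -mulr_natl.
by rewrite le_eqVlt; apply/orP; left; apply/eqP; field.
Qed.

Lemma sum_centered_sqr (n : nat) (c : 'I_n -> R) : (0 < n)%N ->
  \sum_i (c i - n%:R^-1 * \sum_i' c i') ^+ 2 =
  \sum_i c i ^+ 2 - n%:R^-1 * (\sum_i c i) ^+ 2.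
Proof.
move=> n0; set m := _ * _.
under eq_bigr do rewrite sqrrB -mulr_natl.
rewrite big_split/= sumrB sumr_const card_ord -mulr_sumr -mulr_suml -mulr_natl /m.
by field; rewrite pnatr_eq0 -lt0n.
Qed.

(** Trades an absolute value, whose expectation is hard to compute, for a square
    at the price of a small constant. *)
Lemma norm_le_weighted_sqr (x e : R) : 0 < e -> `|x| <= e + x ^+ 2 / (4 * e).
Proof.
move=> e0; rewrite -subr_ge0 -(real_normK (num_real x)).
have -> : e + `|x| ^+ 2 / (4 * e) - `|x| = (2 * e - `|x|) ^+ 2 / (4 * e).
  by field; rewrite gt_eqF.
by rewrite divr_ge0 ?sqr_ge0// mulr_ge0// ltW.
Qed.

Lemma norm_mul_le (x y e : R) : 0 < e -> 2 * `|x * y| <= e * x ^+ 2 + y ^+ 2 / e.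
Proof.
move=> e0; have := mul_le_weighted_sqr `|x| `|y| e0.
by rewrite normrM !real_normK ?num_real//; lra.
Qed.

Lemma norm_sum_le (n : nat) (F G : 'I_n -> R) : (forall i, `|F i| <= G i) ->
  `|\sum_i F i| <= \sum_i G i.
Proof. by move=> FG; rewrite (le_trans (ler_norm_sum _ _ _))// ler_sum. Qed.

(** The main term is the deviation of the mean of the [r i ^+ 2] from [v]; the
    perturbation [a] and the empirical centring only enter through sums of
    squares. *)
Lemma variance_deviation (n : nat) (r a c : 'I_n -> R) (v q e N : R) :
    (1 < n)%N -> 0 < e -> 0 < q -> 0 <= v -> N = n%:R - 1 ->
    (forall i, c i = r i - 2 * a i) ->
  `|N^-1 * \sum_i (c i - n%:R^-1 * \sum_i' c i') ^+ 2 - v| <=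
  e * q + (\sum_i (r i ^+ 2 - v)) ^+ 2 / (4 * e * q * N ^+ 2)
  + N^-1 * (2 * e * \sum_i r i ^+ 2 + (2 / e + 12) * \sum_i a i ^+ 2
            + 2 * n%:R^-1 * (\sum_i r i) ^+ 2 + v).
Proof.
move=> n1 e0 q0 v0 NE cE.
have nR0 : 0 < n%:R :> R by rewrite ltr0n ltnW.
have N0 : 0 < N by rewrite NE subr_gt0 ltr1n.
rewrite sum_centered_sqr; last exact: ltnW.
set W := \sum_i (r i ^+ 2 - v).
have WE : \sum_i c i ^+ 2 - n%:R^-1 * (\sum_i c i) ^+ 2 = 
    N * v + (W + (\sum_i (- 4 * (r i * a i) + 4 * a i ^+ 2)
                  - n%:R^-1 * (\sum_i c i) ^+ 2 + v)).
  have -> : \sum_i c i ^+ 2 = W + \sum_i (- 4 * (r i * a i) + 4 * a i ^+ 2) + n%:R * v.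
    rewrite mulr_natl -[X in v *+ X](card_ord n) -sumr_const /W -!big_split/=.
    by apply: eq_bigr => i _; rewrite cE; ring.
  by rewrite NE; ring.
set Z := _ + v in WE.
have -> : N^-1 * (\sum_i c i ^+ 2 - n%:R^-1 * (\sum_i c i) ^+ 2) - v = W / N + N^-1 * Z.
  by rewrite WE; field; rewrite gt_eqF.
apply: (le_trans (ler_normD _ _)); apply: lerD.
  apply: (le_trans (norm_le_weighted_sqr _ (mulr_gt0 e0 q0))).
  rewrite le_eqVlt; apply/orP; left; apply/eqP; field.
  by rewrite !gt_eqF.
rewrite normrM gtr0_norm ?invr_gt0// ler_pM2l ?invr_gt0//.
have h1 : `|\sum_i (- 4 * (r i * a i) + 4 * a i ^+ 2)| <=
    2 * e * \sum_i r i ^+ 2 + (2 / e + 4) * \sum_i a i ^+ 2.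
  rewrite !mulr_sumr -big_split/=; apply: norm_sum_le => i.
  apply: le_trans (ler_normD _ _) _.
  rewrite normrM normrN normr_nat [`|4 * _|]ger0_norm; last first.
    by apply: mulr_ge0 => //; exact: sqr_ge0.
  have := norm_mul_le (r i) (a i) e0; have := sqr_ge0 (a i); rewrite [(2 / e + 4) * _]mulrDl.
  have -> : 2 / e * a i ^+ 2 = 2 * (a i ^+ 2 / e) by ring.
  by lra.
have h2 : n%:R^-1 * (\sum_i c i) ^+ 2 <=
    2 * n%:R^-1 * (\sum_i r i) ^+ 2 + 8 * \sum_i a i ^+ 2.
  have ra := sum_sqr_le a.
  have -> : \sum_i c i = \sum_i r i - 2 * \sum_i a i by rewrite mulr_sumr -sumrB; exact: eq_bigr.
  rewrite ler_pdivrMl// mulrDr.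
  have -> : n%:R * (2 * n%:R^-1 * (\sum_i r i) ^+ 2) = 2 * (\sum_i r i) ^+ 2.
    by field; rewrite gt_eqF.
  have := sqr_ge0 (\sum_i r i + 2 * \sum_i a i); rewrite sqrrB sqrrD exprMn; lra.
have h3 : 0 <= n%:R^-1 * (\sum_i c i) ^+ 2 by rewrite mulr_ge0 ?sqr_ge0// invr_ge0 ltW.
move: h1; rewrite /Z !ler_norml => /andP[h1 h1'].
rewrite mulrDl in h1 h1' *.
by apply/andP; split; lra.
Qed.

(** There are [n * N] off-diagonal pairs while the normalization is [N ^- 2];
    the last term accounts for this difference. *)
Lemma offdiag_deviation (n : nat) (g h : 'I_n -> 'I_n -> R) (v w q e N : R) :
    (1 < n)%N -> 0 < e -> e <= 1 -> 0 < q -> 0 <= w -> N = n%:R - 1 ->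
  `|N ^- 2 * (\sum_i \sum_(j < n | j != i) (g i j + h i j) ^+ 2) + N^-1 * v - w| <=
  N^-1 * `|v| + e * q + (\sum_i \sum_(j < n | j != i) (g i j ^+ 2 - w)) ^+ 2 / (4 * e * q * N ^+ 4)
  + N ^- 2 * (e * \sum_i \sum_(j < n | j != i) g i j ^+ 2 
     + 2 / e * \sum_i \sum_(j < n | j != i) h i j ^+ 2) + N^-1 * w.
Proof.
move=> n1 e0 e1 q0 w0 NE.
have N0 : 0 < N by rewrite NE subr_gt0 ltr1n.
set W := \sum_i \sum_(j < n | j != i) (g i j ^+ 2 - w).
pose Z := \sum_i \sum_(j < n | j != i) (2 * (g i j * h i j) + h i j ^+ 2).
have WE : \sum_i \sum_(j < n | j != i) (g i j + h i j) ^+ 2 = W + Z + N * n%:R * w.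
  have -> : N * n%:R * w = \sum_(i < n) \sum_(j < n | j != i) w.
    under eq_bigr do rewrite sumr_const.
    under eq_bigr => i _.
      rewrite (_ : #|_| = n.-1); last first.
        by rewrite cardC1 card_ord.
      over.
    rewrite sumr_const card_ord -[RHS]mulr_natl -[w *+ _]mulr_natl -subn1 natrB 1?ltnW// NE; ring.
  rewrite /W /Z -!big_split/=; apply: eq_bigr => i _.
  rewrite -!big_split/=; apply: eq_bigr => j _; ring.
have -> : N ^- 2 * (\sum_i \sum_(j < n | j != i) (g i j + h i j) ^+ 2) + N^-1 * v - w =
   N^-1 * v + W / N ^+ 2 + N ^- 2 * Z + N^-1 * w.
  rewrite WE (_ : n%:R = N + 1); last by rewrite NE subrK.
  by field; rewrite gt_eqF.
apply: (le_trans (ler_normD _ _)); apply: lerD; last first.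
  by rewrite ger0_norm// mulr_ge0// invr_ge0 ltW.
apply: (le_trans (ler_normD _ _)); apply: lerD; last first.
  rewrite normrM gtr0_norm ?invr_gt0 ?exprn_gt0// ler_pM2l ?invr_gt0 ?exprn_gt0//.
  rewrite /Z !mulr_sumr -big_split/=; apply: norm_sum_le => i.
  rewrite !mulr_sumr -big_split/= (le_trans (ler_norm_sum _ _ _))//; apply: ler_sum => j _.
  apply: le_trans (ler_normD _ _) _.
  rewrite normrM normr_nat [`|h i j ^+ 2|]ger0_norm ?sqr_ge0//.
  have := norm_mul_le (g i j) (h i j) e0.
  have : h i j ^+ 2 <= h i j ^+ 2 / e by rewrite ler_pdivlMr// ler_piMr// sqr_ge0.
  by rewrite mulrAC; lra.
apply: (le_trans (ler_normD _ _)); rewrite -addrA; apply: lerD.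
  by rewrite normrM gtr0_norm ?invr_gt0.
apply: (le_trans (norm_le_weighted_sqr _ (mulr_gt0 e0 q0))).
rewrite le_eqVlt; apply/orP; left; apply/eqP; field.
by rewrite !gt_eqF.
Qed.

Lemma sqr_deviation (p : nat) (m w : 'I_p -> R) (K e : R) :
    0 < e -> (forall j, w j ^+ 2 <= K) ->
  `|\sum_j m j ^+ 2 - \sum_j w j ^+ 2| <=
  e * p%:R + (K / e + 1) * \sum_j (m j - w j) ^+ 2.
Proof.
move=> e0 wK; rewrite -sumrB mulr_sumr mulr_natr -[X in e *+ X](card_ord p) -sumr_const.
rewrite -big_split/=; apply: norm_sum_le => j.
have -> : m j ^+ 2 - w j ^+ 2 = 2 * (1 * (w j * (m j - w j))) + (m j - w j) ^+ 2 by ring.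
apply: le_trans (ler_normD _ _) _.
rewrite normrM normr_nat [`|(m j - w j) ^+ 2|]ger0_norm ?sqr_ge0//.
have := norm_mul_le 1 (w j * (m j - w j)) e0; rewrite expr1n mulr1 exprMn.
have : w j ^+ 2 * (m j - w j) ^+ 2 / e <= K * (m j - w j) ^+ 2 / e.
  by rewrite ler_pM2r ?invr_gt0// ler_wpM2r ?sqr_ge0.
by rewrite mulrDl mul1r mulrAC; lra.
Qed.

End Deviations.

(** * The statistics in terms of the Gram matrix *)

Section GramStatistics.
Variables (R : realType) (p n : nat) (Y : 'M[R]_(p, n)).
Let m (j : 'I_p) := n%:R^-1 * \sum_(k < n) Y j k.

Definition gramY k l := \sum_j Y j k * Y j l.
Definition rowmeanY k := n%:R^-1 * \sum_l gramY k l.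
Definition sqmeanY := n%:R^-1 * \sum_k rowmeanY k.
(** The Gram matrix of the empirically centred columns, by [cgramYE]. *)
Definition cgramY k l := gramY k l - rowmeanY k - rowmeanY l + sqmeanY.

Lemma sample_meanE j : sample_mean Y j ord0 = m j.
Proof. by rewrite !mxE summxE; congr (_ * _); apply: eq_bigr => k _; rewrite mxE. Qed.

Lemma rowmeanYE k : rowmeanY k = \sum_j Y j k * m j.
Proof.
rewrite /rowmeanY /gramY exchange_big/= mulr_sumr; apply: eq_bigr => j _.
by rewrite /m -mulr_sumr; ring.
Qed.

Lemma sqmeanYE : sqmeanY = \sum_j m j ^+ 2.
Proof.
rewrite /sqmeanY; under eq_bigr do rewrite rowmeanYE.
rewrite exchange_big/= mulr_sumr; apply: eq_bigr => j _.
by rewrite -mulr_suml mulrA expr2.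
Qed.

Lemma cgramYE k l : \sum_j (Y j k - m j) * (Y j l - m j) = cgramY k l.
Proof.
rewrite /cgramY !rowmeanYE sqmeanYE /gramY -!sumrB -big_split/=.
by apply: eq_bigr => j _; ring.
Qed.

Lemma sqnorm2E k : sqnorm2 (col k Y - sample_mean Y) = cgramY k k.
Proof.
rewrite -cgramYE; apply: eq_bigr => j _.
by rewrite !mxE -sample_meanE !mxE expr2.
Qed.

Lemma nu_hatE : nu_hat Y = (n%:R - 1)^-1 *
  \sum_k (cgramY k k - n%:R^-1 * \sum_k' cgramY k' k') ^+ 2.
Proof.
rewrite /nu_hat; congr (_ * _); apply: eq_bigr => k _.
rewrite sqnorm2E; congr ((_ - _ * _) ^+ 2).
by apply: eq_bigr => k' _; rewrite sqnorm2E.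
Qed.

Lemma sample_covE i j : sample_cov Y i j =
  (n%:R - 1)^-1 * \sum_k (Y i k - m i) * (Y j k - m j).
Proof.
rewrite !mxE summxE; congr (_ * _); apply: eq_bigr => k _.
by rewrite mxE big_ord1 -!sample_meanE !mxE.
Qed.

Lemma trace_sample_cov : \tr (sample_cov Y) = (n%:R - 1)^-1 * \sum_k cgramY k k.
Proof.
rewrite /mxtrace; under eq_bigr do rewrite sample_covE.
rewrite -mulr_sumr exchange_big/=; congr (_ * _); apply: eq_bigr => k _.
exact: cgramYE.
Qed.

(** The sample covariance matrix and the centred Gram matrix are, up to a factor,
    the two products of one matrix with its transpose, so their squares have the
    same trace. *)
Lemma trace_sample_cov_sqr : \tr (sample_cov Y *m sample_cov Y) =
  (n%:R - 1) ^- 2 * \sum_k \sum_l cgramY k l ^+ 2.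
Proof.
rewrite /mxtrace.
transitivity (\sum_i \sum_j (n%:R - 1) ^- 2 *
  \sum_k \sum_l ((Y i k - m i) * (Y i l - m i)) * ((Y j k - m j) * (Y j l - m j))).
  apply: eq_bigr => i _; rewrite mxE; apply: eq_bigr => j _.
  rewrite !sample_covE -exprVn expr2 mulrACA; congr (_ * _).
  rewrite mulr_suml; apply: eq_bigr => k _; rewrite mulr_sumr; apply: eq_bigr => l _.
  ring.
under eq_bigr do rewrite -mulr_sumr.
rewrite -mulr_sumr; congr (_ * _).
under eq_bigr do rewrite exchange_big/=.
rewrite exchange_big/=; apply: eq_bigr => k _.
under eq_bigr do rewrite exchange_big/=.
rewrite exchange_big/=; apply: eq_bigr => l _.
rewrite -cgramYE expr2 mulr_suml; apply: eq_bigr => i _.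
by rewrite mulr_sumr.
Qed.

(** The diagonal part of the sum of squares is, after centring, a multiple of
    nu_hat, which is of smaller order. *)
Lemma tau_hatE : (1 < n)%N -> tau_hat Y =
  (n%:R - 1) ^- 2 * (\sum_k \sum_(l < n | l != k) cgramY k l ^+ 2)
  + (n%:R - 1)^-1 * nu_hat Y.
Proof.
move=> n1; have N0 : (n%:R - 1 : R) != 0 by rewrite subr_eq0 pnatr_eq1 gtn_eqF.
have nR0 : n%:R != 0 :> R by rewrite pnatr_eq0 -lt0n ltnW.
rewrite /tau_hat trace_sample_cov_sqr trace_sample_cov nu_hatE.
rewrite sum_centered_sqr; last exact: ltnW.
have -> : \sum_k \sum_l cgramY k l ^+ 2 =
    \sum_k \sum_(l < n | l != k) cgramY k l ^+ 2 + \sum_k cgramY k k ^+ 2.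
  rewrite -big_split/=; apply: eq_bigr => k _.
  by rewrite (bigD1 k)//= addrC.
by field; rewrite N0 nR0.
Qed.

Lemma omega_hatE : (0 < n)%N -> omega_hat Y =
  \sum_j (n%:R^-1 * \sum_i Y j i ^+ 2 - m j ^+ 2) ^+ 2.
Proof.
move=> n0; have nR0 : n%:R != 0 :> R by rewrite pnatr_eq0 -lt0n.
rewrite /omega_hat; apply: eq_bigr => j _; rewrite sum_centered_sqr//.
by rewrite /m; congr (_ ^+ 2); field.
Qed.

End GramStatistics.

(** * Collecting the orders of magnitude *)

Section NumericBounds.
Variable R : realFieldType.
Variables (K e p n b N v : R).
Hypotheses (K1 : 1 <= K) (e0 : 0 < e) (e1 : e <= 1) (p1 : 1 <= p) (n2 : 2 <= n).
Hypotheses (pK : p <= K * n) (NE : N = n - 1) (b0 : 0 <= b).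
Hypotheses (v0 : 0 <= v) (vK : v <= 3 * K ^+ 2 * p).

Let beta := (1 + b / n) / e.
Let K0 : 0 < K. Proof. exact: lt_le_trans K1. Qed.
Let p0 : 0 < p. Proof. exact: lt_le_trans p1. Qed.
Let n0 : 0 < n. Proof. exact: lt_le_trans n2. Qed.
Let N0 : 0 < N. Proof. by rewrite NE subr_gt0 (lt_le_trans _ n2)// ltr1n. Qed.
Let N1 : 1 <= N. Proof. by rewrite NE; move: n2; lra. Qed.
Let nN : n <= 2 * N. Proof. by rewrite NE; move: n2; lra. Qed.
Let Kge0 := ltW K0. Let pge0 := ltW p0. Let nge0 := ltW n0. Let Nge0 := ltW N0.
Let ege0 := ltW e0.
Let powK m : (m <= 6)%N -> K ^+ m <= K ^+ 6. Proof. by move=> ?; rewrite ler_weXn2l. Qed.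
Let einv : 1 <= e^-1. Proof. by rewrite invf_ge1. Qed.
Let bn : 0 <= b / n. Proof. by rewrite divr_ge0// ltW. Qed.
Let beta_e : e^-1 <= beta.
Proof. by rewrite /beta ler_peMl ?lerDl// invr_ge0 ltW. Qed.
Let beta1 : 1 <= beta. Proof. exact: le_trans beta_e. Qed.
Let K6 : 0 <= K ^+ 6. Proof. by rewrite exprn_ge0// ltW. Qed.

(** Everything of order [p] that is divided by [N] is absorbed by the part of the
    bound which does not grow with [p], thanks to [p <= K * n]. *)
Let bound_pn m x : (m.+1 <= 6)%N -> 0 <= x -> x <= K ^+ m * p -> x / N <= 2 * (K ^+ 6 * beta).
Proof.
move=> m6 x0 xp; rewrite ler_pdivrMr//.
apply: (le_trans xp); apply: (@le_trans _ _ (K ^+ m * (K * n))).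
  by rewrite ler_wpM2l ?exprn_ge0// ltW.
have h : K ^+ m.+1 * n <= K ^+ 6 * n by rewrite ler_wpM2r ?powK// ltW.
have h2 : K ^+ 6 * n <= K ^+ 6 * (2 * N) by rewrite ler_wpM2l.
have h3 : K ^+ 6 * (2 * N) <= K ^+ 6 * (2 * N) * beta.
  by rewrite ler_peMr// !mulr_ge0// ltW.
have -> : K ^+ m * (K * n) = K ^+ m.+1 * n by rewrite exprSr; ring.
have -> : 2 * (K ^+ 6 * beta) * N = K ^+ 6 * (2 * N) * beta by ring.
by rewrite (le_trans h)// (le_trans h2).
Qed.

(** Each term is bounded by a multiple of [K ^+ 6 * (e * p)] or of
    [K ^+ 6 * beta]; the exponents of two leave room for the sum of the
    constants. *)
Lemma nu_error_budget (x2 r2 a2 sr2 : R) :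
    x2 <= n * (p * (2 ^+ 15 * K ^+ 5 * (p + b))) -> r2 <= n * v ->
    0 <= a2 -> a2 <= n * (9 * K ^+ 5) -> sr2 <= n * v ->
  e * p + x2 / (4 * e * p * N ^+ 2)
    + N^-1 * (2 * e * r2 + (2 / e + 12) * a2 + 2 * n^-1 * sr2 + v)
  <= 2 ^+ 16 * K ^+ 6 * (e * p + (1 + b / n) / e).
Proof.
move=> hx hr ha_ge0 ha hs; rewrite -/beta.
have KE : 0 <= K ^+ 6 * (e * p) by rewrite !mulr_ge0// ltW.
have KB : K ^+ 6 <= K ^+ 6 * beta by rewrite ler_peMr.
have t0 : e * p <= K ^+ 6 * (e * p).
  by rewrite ler_peMl ?exprn_ege1// mulr_ge0// ltW.
have t1 : x2 / (4 * e * p * N ^+ 2) <= 2 ^+ 15 * (K ^+ 6 * beta).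
  have den : 0 < 4 * e * p * N ^+ 2 by rewrite !mulr_gt0 ?exprn_gt0.
  rewrite ler_pdivrMr//; apply: (le_trans hx).
  have -> : 2 ^+ 15 * (K ^+ 6 * beta) * (4 * e * p * N ^+ 2) =
     2 ^+ 15 * p * (K ^+ 6 * ((1 + b / n) * (2 * N) ^+ 2)).
    rewrite /beta; field; by rewrite !gt_eqF.
  have -> : n * (p * (2 ^+ 15 * K ^+ 5 * (p + b))) =
     2 ^+ 15 * p * (K ^+ 5 * (n * (p + b))) by ring.
  apply: ler_wpM2l; first by rewrite mulr_ge0 ?exprn_ge0// ltW.
  apply: (@le_trans _ _ (K ^+ 5 * (n * (K * n + K * b)))).
    apply: ler_wpM2l; first exact: exprn_ge0.
    by apply: ler_wpM2l => //; apply: lerD => //; rewrite ler_peMl.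
  have -> : K ^+ 5 * (n * (K * n + K * b)) = K ^+ 6 * ((1 + b / n) * n ^+ 2).
    by field; rewrite gt_eqF.
  apply: ler_wpM2l => //; apply: ler_wpM2l; first by rewrite addr_ge0.
  by rewrite ler_pXn2r// nnegrE ?mulr_ge0// ltW.
have t2 : N^-1 * (2 * e * r2) <= 12 * (K ^+ 6 * (e * p)).
  rewrite ler_pdivrMl//.
  apply: (@le_trans _ _ (2 * e * ((2 * N) * (3 * K ^+ 2 * p)))).
    apply: ler_wpM2l; first by rewrite mulr_ge0// ltW.
    apply: (le_trans hr); apply: ler_pM => //; exact: ltW.
  have -> : 2 * e * (2 * N * (3 * K ^+ 2 * p)) = 12 * N * (e * p) * K ^+ 2 by ring.
  have -> : N * (12 * (K ^+ 6 * (e * p))) = 12 * N * (e * p) * K ^+ 6 by ring.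
  by apply: ler_wpM2l; [rewrite !mulr_ge0// ltW|exact: powK].
have t3 : N^-1 * ((2 / e + 12) * a2) <= 252 * (K ^+ 6 * beta).
  rewrite ler_pdivrMl//.
  apply: (@le_trans _ _ ((14 * e^-1) * ((2 * N) * (9 * K ^+ 6)))).
    apply: ler_pM => //.
    - by rewrite addr_ge0 ?divr_ge0// ltW.
    - by move: einv; lra.
    - apply: (le_trans ha); apply: ler_pM => //; first by rewrite mulr_ge0 ?exprn_ge0.
      by rewrite ler_pM2l// powK.
  have -> : 14 / e * (2 * N * (9 * K ^+ 6)) = (252 * N * K ^+ 6) * e^-1 by ring.
  have -> : N * (252 * (K ^+ 6 * beta)) = (252 * N * K ^+ 6) * beta by ring.
  apply: ler_wpM2l; last exact: beta_e.
  by apply: mulr_ge0; [apply: mulr_ge0; [exact: ler0n|exact: Nge0]|exact: K6].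
have t4 : N^-1 * (2 * n^-1 * sr2) <= 12 * (K ^+ 6 * beta).
  apply: (@le_trans _ _ (6 * ((v / 3) / N))).
    rewrite (_ : 6 * _ = N^-1 * (2 * v)); last by field; rewrite gt_eqF.
    rewrite ler_pM2l ?invr_gt0// -mulrA ler_pM2l// ler_pdivrMl//.
  have := bound_pn (m := 2) (x := v / 3) isT.
  rewrite divr_ge0// ler_pdivrMr// (_ : K ^+ 2 * p * 3 = 3 * K ^+ 2 * p); last by ring.
  by move=> /(_ isT vK); lra.
have t5 : N^-1 * v <= 6 * (K ^+ 6 * beta).
  have := bound_pn (m := 2) (x := v / 3) isT.
  rewrite divr_ge0// ler_pdivrMr// (_ : K ^+ 2 * p * 3 = 3 * K ^+ 2 * p); last by ring.
  by move=> /(_ isT vK); rewrite [v / 3 / N]mulrAC [v / N]mulrC; lra.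
rewrite !mulrDr.
have -> : 2 ^+ 16 * K ^+ 6 * (e * p) = 2 ^+ 16 * (K ^+ 6 * (e * p)) by ring.
have -> : 2 ^+ 16 * K ^+ 6 * beta = 2 ^+ 16 * (K ^+ 6 * beta) by ring.
move: t0 t1 t2 t3 t4 t5 KE KB K6.
set A := K ^+ 6 * (e * p); set B := K ^+ 6 * beta; lra.
Qed.

Lemma tau_error_budget (hnu x2 g2 h2 w : R) :
    hnu <= 2 ^+ 16 * K ^+ 6 * (e * p + (1 + b / n) / e) ->
    x2 <= 4 * n ^+ 3 * (9 * K ^+ 4 * p ^+ 2) -> g2 <= n ^+ 2 * (K ^+ 2 * p) ->
    h2 <= n ^+ 2 * (81 * K ^+ 5) -> 0 <= hnu -> 0 <= g2 -> 0 <= h2 -> 0 <= w -> w <= K ^+ 2 * p ->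
  N^-1 * (hnu + v) + e * p + x2 / (4 * e * p * N ^+ 4)
   + N ^- 2 * (e * g2 + 2 / e * h2) + N^-1 * w
  <= 2 ^+ 17 * K ^+ 6 * (e * p + (1 + b / n) / e).
Proof.
move=> hh hx hg h2K hnu0 g20 h20 w0 wK; rewrite -/beta in hh *.
have KE : 0 <= K ^+ 6 * (e * p) by rewrite !mulr_ge0// ltW.
have KB : K ^+ 6 <= K ^+ 6 * beta by rewrite ler_peMr.
have t0 : e * p <= K ^+ 6 * (e * p).
  by rewrite ler_peMl ?exprn_ege1// mulr_ge0// ltW.
have t1 : N^-1 * hnu <= 2 ^+ 16 * (K ^+ 6 * (e * p)) + 2 ^+ 16 * (K ^+ 6 * beta).
  apply: (@le_trans _ _ hnu); first by rewrite ler_piMl// invf_le1.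
  by rewrite (le_trans hh)// le_eqVlt; apply/orP; left; apply/eqP; ring.
have t2 : N^-1 * v <= 6 * (K ^+ 6 * beta).
  have := bound_pn (m := 2) (x := v / 3) isT.
  rewrite divr_ge0// ler_pdivrMr// (_ : K ^+ 2 * p * 3 = 3 * K ^+ 2 * p); last by ring.
  by move=> /(_ isT vK); rewrite [v / 3 / N]mulrAC [v / N]mulrC; lra.
have n2N : n ^+ 2 <= 4 * N ^+ 2.
  rewrite (_ : 4 * N ^+ 2 = (2 * N) ^+ 2); last by ring.
  by rewrite ler_pXn2r// nnegrE ?mulr_ge0// ltW.
have t3 : x2 / (4 * e * p * N ^+ 4) <= 144 * (K ^+ 6 * beta).
  have den : 0 < 4 * e * p * N ^+ 4 by rewrite !mulr_gt0 ?exprn_gt0.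
  rewrite ler_pdivrMr//; apply: (le_trans hx).
  apply: (@le_trans _ _ (4 * n ^+ 3 * (9 * K ^+ 4 * (p * (K * n))))).
    apply: ler_wpM2l; first by rewrite mulr_ge0 ?exprn_ge0// ltW.
    apply: ler_wpM2l; first by rewrite mulr_ge0 ?exprn_ge0// ltW.
    by rewrite expr2 ler_pM2l.
  have -> : 4 * n ^+ 3 * (9 * K ^+ 4 * (p * (K * n))) = 36 * p * (K ^+ 5 * (n ^+ 2) ^+ 2) by ring.
  apply: (@le_trans _ _ (36 * p * (K ^+ 6 * (4 * N ^+ 2) ^+ 2))).
    apply: ler_wpM2l; first by rewrite mulr_ge0// ltW.
    apply: ler_pM; rewrite ?exprn_ge0// ?powK//; try exact: ltW.
    by rewrite ler_pXn2r// nnegrE ?mulr_ge0 ?exprn_ge0// ltW.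
  have -> : 144 * (K ^+ 6 * beta) * (4 * e * p * N ^+ 4) =
     (36 * p * (K ^+ 6 * (4 * N ^+ 2) ^+ 2)) * (e * beta) by ring.
  rewrite ler_peMr//; first by rewrite !mulr_ge0 ?exprn_ge0 ?mulr_ge0// ltW.
  by rewrite -(mulfV (lt0r_neq0 e0)) ler_wpM2l// ltW.
have N2 : 0 < N ^+ 2 by rewrite exprn_gt0.
have t4 : N ^- 2 * (e * g2) <= 4 * (K ^+ 6 * (e * p)).
  rewrite ler_pdivrMl//.
  have -> : N ^+ 2 * (4 * (K ^+ 6 * (e * p))) = e * ((4 * N ^+ 2) * (K ^+ 6 * p)) by ring.
  apply: ler_wpM2l; first exact: ltW.
  apply: (le_trans hg); apply: ler_pM => //; first exact: exprn_ge0.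
    by rewrite mulr_ge0// exprn_ge0.
  by rewrite ler_pM2r// powK.
have t5 : N ^- 2 * (2 / e * h2) <= 648 * (K ^+ 6 * beta).
  rewrite ler_pdivrMl//.
  have -> : N ^+ 2 * (648 * (K ^+ 6 * beta)) = (2 * beta) * ((4 * N ^+ 2) * (81 * K ^+ 6)) by ring.
  apply: ler_pM => //; first by rewrite divr_ge0// ltW.
    by rewrite ler_pM2l.
  apply: (le_trans h2K); apply: ler_pM => //; first exact: exprn_ge0.
    by rewrite mulr_ge0// exprn_ge0.
  by rewrite ler_pM2l// powK.
have t6 : N^-1 * w <= 2 * (K ^+ 6 * beta) by rewrite mulrC; exact: (bound_pn (m := 2)).
rewrite !mulrDr.
have -> : 2 ^+ 17 * K ^+ 6 * (e * p) = 2 ^+ 17 * (K ^+ 6 * (e * p)) by ring.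
have -> : 2 ^+ 17 * K ^+ 6 * beta = 2 ^+ 17 * (K ^+ 6 * beta) by ring.
move: t0 t1 t2 t3 t4 t5 t6 KE KB K6.
set A := K ^+ 6 * (e * p); set B := K ^+ 6 * beta; lra.
Qed.

End NumericBounds.

(** * Deviation of the three statistics for bounded variables *)

Section Sample.
Context (R : realType) d (T : measurableType d) (P : probability T R).
Variables (p n : nat).
Local Notation I := ('I_p * 'I_n)%type.
Variable X : I -> {RV P >-> R}.
Hypothesis Xindep : mutually_independent X.
Local Notation bb := (bounded_block X).
Local Notation Ex := (Rintegral P setT).
Local Notation full := [set: I]%SET.
Local Notation ED := (ExD (X := X) (J := full)).
Local Notation EB := (ExB (X := X) (J := full)).
Local Notation EZ := (ExZ (X := X) (J := full)).
Local Notation ES := (Ex_sum (X := X) (J := full)).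

Variables (u : I -> T -> R) (s m3 kp K b : R).
Hypothesis bu : forall i, bb [set i]%SET (u i).
Hypothesis u1 : forall i, Ex (u i) = 0.
Hypothesis u2 : forall i, Ex (fun t => u i t ^+ 2) = s.
Hypothesis u3 : forall i, Ex (fun t => u i t ^+ 3) = m3.
Hypothesis u4 : forall i, Ex (fun t => u i t ^+ 4) = kp.
Hypothesis ub : forall i, Ex (fun t => (u i t ^+ 2 - s) ^+ 4) <= b.
Hypotheses (s0 : 0 <= s) (sk : s ^+ 2 <= kp) (K1 : 1 <= K) (sK : s <= K) (kK : kp <= K).

Variable S : 'M[R]_p.
Hypothesis Ssym : forall i j, S i j = S j i.
Hypothesis Srow : forall i, \sum_j S i j ^+ 2 <= K.

(** The variables of one column of the sample, as the list over which the forms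
    of the preceding part are taken. *)
Definition column (l : 'I_n) : seq I := [seq (j, l) | j <- index_enum 'I_p].
Definition colset (l : 'I_n) : {set I} := [set a : I | a.2 == l]%SET.

(** The inner product of two observations: with [A] the square root of [S], the
    [k]-th observation is [A] applied to the [k]-th column of the variables. *)
Definition gram k l t := \sum_j \sum_j' S j j' * u (j, k) t * u (j', l) t.
Let c (a a' : I) : R := S a.1 a'.1.

Lemma column_uniq l : uniq (column l).
Proof. by rewrite map_inj_uniq ?index_enum_uniq// => i j []. Qed.

Lemma mem_column l a : (a \in column l) = (a.2 == l).
Proof.
apply/mapP/eqP => [[j _ ->]//|<-]; exists a.1; rewrite ?mem_index_enum//.
by case: a.
Qed.

Lemma size_column l : size (column l) = p.
Proof. by rewrite size_map -sum1_size -[RHS](card_ord p) -sum1_card; exact: eq_bigl. Qed.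

Lemma setof_column l : setof (column l) = colset l.
Proof. by apply/finset.setP => a; rewrite !inE mem_column. Qed.

Lemma bb_col j l : bb (colset l) (u (j, l)).
Proof. by apply: bbS (bu _); apply/fintype.subsetP => a; rewrite !inE => /eqP ->. Qed.

Lemma bb_gram k l : bb (colset k :|: colset l)%SET (gram k l).
Proof.
apply: bb_sum => j _; apply: bb_sum => j' _.
apply: bbM; last by apply: bb_Ur; exact: bb_col.
by apply: bbM; [exact: bb_cst|apply: bb_Ul; exact: bb_col].
Qed.

Let bg k l : bb full (gram k l) := bb_full (bb_gram k l).

Definition traceS := \sum_j S j j.
Definition sumdiag2 := \sum_j S j j ^+ 2.
Definition sumsqr := \sum_j \sum_j' S j j' ^+ 2.
(** The variance of the squared norm of an observation, by [gdiag_sqr]; the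
    target of [nu_hat]. *)
Definition nu0 := (kp - 3 * s ^+ 2) * sumdiag2 + 2 * s ^+ 2 * sumsqr.
Definition gdiag l t := gram l l t - s * traceS.

Lemma gdiag_qform l : gdiag l = qform u s c (column l).
Proof.
apply/funext => t; rewrite /gdiag /qform /gram /c !big_map.
by congr (_ - _); apply: eq_bigr => j _; rewrite big_map.
Qed.

Let csym a a' : c a a' = c a' a. Proof. exact: Ssym. Qed.

Lemma bb_gdiag l : bb (colset l) (gdiag l).
Proof. by rewrite gdiag_qform -setof_column; exact: bb_qform. Qed.

Lemma gdiag_mean l : Ex (gdiag l) = 0.
Proof. by rewrite gdiag_qform; exact: (qform_mean Xindep bu u1 u2 csym (column_uniq l)). Qed.

Lemma gdiag_sqr l : Ex (fun t => gdiag l t ^+ 2) = nu0.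
Proof.
rewrite gdiag_qform (qform_sqr Xindep bu u1 u2 u3 u4 csym (column_uniq l)) !big_map /nu0.
congr (_ + _ * _); apply: eq_bigr => j _; by rewrite big_map.
Qed.

Lemma gdiag_fourth l :
  Ex (fun t => gdiag l t ^+ 4) <= p%:R * (2 ^+ 15 * K ^+ 5 * (p%:R + b)).
Proof.
rewrite gdiag_qform.
have sizeN : (size (column l) <= p)%N by rewrite size_column.
have rowK : {in column l, forall a, \sum_(a' <- column l) c a a' ^+ 2 <= K}.
  by move=> a _; rewrite big_map; exact: Srow.
have := qform_fourth Xindep bu u1 u2 u3 u4 csym (column_uniq l) sizeN s0 sk K1 sK kK rowK ub.
by rewrite [in (size _)%:R](size_column l).
Qed.

Definition gweight k (a : I) t := \sum_j S j a.1 * u (j, k) t.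

Lemma gram_linform k l : gram k l = linform u (column l) (gweight k).
Proof.
apply/funext => t; rewrite /gram /linform big_map exchange_big/=.
by apply: eq_bigr => j _; rewrite mulr_suml.
Qed.

Lemma gweight_linform k a : gweight k a = linform u (column k) (fun a' _ => c a a').
Proof.
by apply/funext => t; rewrite /linform big_map; apply: eq_bigr => j _; rewrite /c Ssym.
Qed.

Lemma bb_gweight k a : bb (colset k) (gweight k a).
Proof. by apply: bb_sum => j _; apply: bbM; [exact: bb_cst|exact: bb_col]. Qed.

Let col_notin k l : k != l -> {in column l, forall a, a \notin colset k}.
Proof. by move=> kl a; rewrite mem_column inE => /eqP ->; rewrite eq_sym. Qed.

Lemma gram_sqr k l : k != l -> Ex (fun t => gram k l t ^+ 2) = s ^+ 2 * sumsqr.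
Proof.
move=> kl; rewrite gram_linform.
have := linform_sqr Xindep bu u1 u2 (bb_gweight k) (column_uniq l)
  (bb_cst X (colset k) 1) (col_notin kl).
under eq_fun do rewrite mulr1; move=> ->.
under eq_fun do rewrite mulr1 /sqweight big_map.
have bw j : bb full (gweight k (j, l)) by exact: bb_full (bb_gweight k _).
rewrite ES => [|j _]; last by bbt.
rewrite expr2 -mulrA; congr (_ * _); rewrite mulr_sumr; apply: eq_bigr => j _.
by rewrite gweight_linform (weights_sqr Xindep bu u1 u2 c _ (column_uniq k)) big_map.
Qed.

(** Conditionally on the first column this is a linear form with weights that are
    themselves linear forms in the first column. *)
Lemma gram_fourth k' l : k' != l -> Ex (fun t => gram k' l t ^+ 4) <= 9 * K ^+ 4 * p%:R ^+ 2.
Proof.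
move=> kl; rewrite gram_linform.
have k0 : 0 <= kp by rewrite (le_trans _ sk)// sqr_ge0.
have K0 : 0 <= K by rewrite (le_trans _ K1).
have bw a : bb full (gweight k' a) by exact: bb_full (bb_gweight k' _).
apply: le_trans (linform_fourth Xindep bu u1 u2 u3 u4 (bb_gweight k') (column_uniq l)
  (col_notin kl) sk) _.
rewrite (_ : 9 * _ * _ = (3 * K) * (3 * K ^+ 3 * p%:R ^+ 2)); last by ring.
apply: ler_pM; rewrite ?mulr_ge0//.
- by apply: Ex_ge0 => t; rewrite sqr_ge0.
- by rewrite ler_pM2l.
apply: (@le_trans _ _ (Ex (fun t => p%:R * \sum_j gweight k' (j, l) t ^+ 4))).
  apply: (Ex_le (X := X) (J := full)) => [||t]; rewrite /sqweight; [by bbt|by bbt|].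
  rewrite big_map (le_trans (sum_sqr_le _))//.
  by under eq_bigr do rewrite -exprM.
rewrite EZ; last by bbt.
rewrite ES => [|j _]; last by bbt.
rewrite (_ : 3 * K ^+ 3 * p%:R ^+ 2 = p%:R * (3 * K ^+ 3 *+ p)); last by ring.
rewrite ler_wpM2l// -[X in _ *+ X]card_ord -sumr_const; apply: ler_sum => j _.
rewrite gweight_linform.
apply: le_trans (weights_fourth Xindep bu u1 u2 u3 u4 c _ (column_uniq k') sk) _.
rewrite big_map /c /= (_ : 3 * K ^+ 3 = 3 * K * K ^+ 2); last by ring.
apply: ler_pM; [exact: mulr_ge0|exact: sqr_ge0|by rewrite ler_pM2l|].
rewrite ler_pXn2r ?nnegrE//.
by apply: sumr_ge0 => j' _; exact: sqr_ge0.
Qed.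

(** The first entry is a linear form in a column on which the second does not
    depend. *)
Lemma gram_orth k' l l' : k' != l -> l' != l ->
  Ex (fun t => gram k' l t * gram k' l' t) = 0.
Proof.
move=> kl ll; rewrite gram_linform.
pose W := (colset k' :|: colset l')%SET.
apply: (linform_mean Xindep bu u1 (W := W)) => [a||a].
- by apply: bb_Ul; exact: bb_gweight.
- exact: bb_gram.
- by rewrite mem_column !inE => /eqP ->; rewrite negb_or ![l == _]eq_sym kl ll.
Qed.

Lemma Ex_sqr_sum_orth (m : nat) (F : 'I_m -> T -> R) :
    (forall i, bb full (F i)) ->
    (forall i j, i != j -> Ex (fun t => F i t * F j t) = 0) ->
  Ex (fun t => (\sum_i F i t) ^+ 2) = \sum_i Ex (fun t => F i t ^+ 2).
Proof.
move=> bF orth.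
under eq_fun do rewrite expr2 mulr_suml.
rewrite ES => [|i _]; last by bbt.
apply: eq_bigr => i _; under eq_fun do rewrite mulr_sumr.
rewrite ES => [|j _]; last by bbt.
rewrite (bigD1 i)//= big1 ?addr0// => j ji.
by rewrite orth// eq_sym.
Qed.

Hypotheses (p0 : (0 < p)%N) (n1 : (1 < n)%N) (pK : p%:R <= K * n%:R).

Let K0 : 0 <= K. Proof. exact: le_trans K1. Qed.
Let kp0 : 0 <= kp. Proof. exact: le_trans (sqr_ge0 s) sk. Qed.
Let nR0 : 0 < n%:R :> R. Proof. by rewrite ltr0n ltnW. Qed.
Let pR1 : 1 <= p%:R :> R. Proof. by rewrite ler1n. Qed.
Let pR0 : 0 < p%:R :> R. Proof. by rewrite ltr0n. Qed.
Let s2K : s ^+ 2 <= K. Proof. exact: le_trans kK. Qed.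

Lemma sumsqr_le : sumsqr <= K * p%:R.
Proof.
apply: (@le_trans _ _ (\sum_(j < p) K)); first exact: ler_sum.
by rewrite sumr_const card_ord mulr_natr.
Qed.

Lemma sumdiag2_le : sumdiag2 <= sumsqr.
Proof.
apply: ler_sum => j _; rewrite (bigD1 j)//= lerDl.
by apply: sumr_ge0 => j' _; exact: sqr_ge0.
Qed.

Lemma sumdiag2_ge0 : 0 <= sumdiag2.
Proof. by apply: sumr_ge0 => j _; exact: sqr_ge0. Qed.

Let sumsqr_ge0 : 0 <= sumsqr. Proof. exact: le_trans sumdiag2_ge0 sumdiag2_le. Qed.

Lemma nu0_le : nu0 <= 3 * K ^+ 2 * p%:R.
Proof.
exact: variance_bound sumdiag2_ge0 sumdiag2_le sumsqr_le sk kp0 kK.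
Qed.

Lemma nu0_ge0 : 0 <= nu0.
Proof.
rewrite -(gdiag_sqr (Ordinal (ltnW n1))).
by apply: Ex_ge0 => t; exact: sqr_ge0.
Qed.

Lemma Kpow i j : (i <= j)%N -> K ^+ i <= K ^+ j.
Proof. by move=> ij; rewrite ler_weXn2l. Qed.

Definition rowmean l t := n%:R^-1 * \sum_l' gram l l' t.

Let brow l : bb full (rowmean l). Proof. by rewrite /rowmean; bbt. Qed.

Lemma gram_diag_sqr l : Ex (fun t => gram l l t ^+ 2) <= 8 * K ^+ 3 * p%:R ^+ 2.
Proof.
have bd : bb full (gdiag l) by exact: bb_full (bb_gdiag l).
have trK : traceS ^+ 2 <= K * p%:R ^+ 2.
  apply: le_trans (sum_sqr_le _) _; rewrite expr2 mulrA mulrC.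
  by apply: ler_wpM2r => //; exact: le_trans sumdiag2_le sumsqr_le.
have -> : (fun t => gram l l t ^+ 2) =
    (fun t => gdiag l t ^+ 2 + (2 * (s * traceS) * gdiag l t + (s * traceS) ^+ 2)).
  by apply/funext => t; rewrite /gdiag; ring.
rewrite ED; [|by bbt..]; rewrite ED; [|by bbt..].
rewrite EZ; last by bbt.
rewrite gdiag_sqr gdiag_mean mulr0 add0r Ex_cst exprMn.
have h1 : s ^+ 2 * traceS ^+ 2 <= K * (K * p%:R ^+ 2).
  by apply: ler_pM => //; exact: sqr_ge0.
have h2 : K ^+ 2 * p%:R <= K ^+ 3 * p%:R ^+ 2.
  by apply: ler_pM => //; [exact: exprn_ge0|exact: Kpow|rewrite ler_eXnr].
have h3 : K ^+ 2 * p%:R ^+ 2 <= K ^+ 3 * p%:R ^+ 2.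
  by rewrite ler_wpM2r ?sqr_ge0// Kpow.
have h4 : 0 <= K ^+ 3 * p%:R ^+ 2 by rewrite mulr_ge0 ?sqr_ge0// exprn_ge0.
have h0 := nu0_le.
have e1 : K * (K * p%:R ^+ 2) = K ^+ 2 * p%:R ^+ 2 by ring.
rewrite e1 in h1; rewrite -!mulrA in h0 *.
by lra.
Qed.

(** The off-diagonal entries of a row are orthogonal, so the square of their
    sum has an expectation of order [n * p]; the diagonal entry contributes
    [p ^+ 2], and both are at most of order [n ^+ 2]. *)
Lemma rowmean_sqr l : Ex (fun t => rowmean l t ^+ 2) <= 9 * K ^+ 5.
Proof.
rewrite (_ : (fun t => _) = (fun t => n%:R ^- 2 * (\sum_l' gram l l' t) ^+ 2)); last first.
  by apply/funext => t; rewrite exprMn exprVn.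
rewrite EZ; last by bbt.
rewrite Ex_sqr_sum_orth => [||i j ij]; last 2 first.
- by move=> i; exact: bg.
- have [li|li] := eqVneq l i.
    under eq_fun do rewrite mulrC.
    by apply: gram_orth => //; rewrite li.
  by apply: gram_orth => //; rewrite eq_sym.
rewrite mulrC ler_pdivrMr ?exprn_gt0// (bigD1 l)//=.
have h1 : \sum_(i < n | i != l) Ex (fun t => gram l i t ^+ 2) <= n%:R * (K * (K * p%:R)).
  apply: (@le_trans _ _ (\sum_(i < n) (K * (K * p%:R)))); last first.
    by rewrite sumr_const card_ord mulr_natl.
  rewrite [leRHS](bigD1 l)//= (le_trans (ler_sum _ (G := fun=> K * (K * p%:R)) _))//.
    move=> i il; rewrite gram_sqr 1?eq_sym// ler_pM ?sqr_ge0//; exact: sumsqr_le.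
  by rewrite lerDr !mulr_ge0.
apply: le_trans (lerD (gram_diag_sqr l) h1) _.
have h2 : p%:R ^+ 2 <= (K * n%:R) ^+ 2 by rewrite ler_pXn2r ?nnegrE ?mulr_ge0.
have h3 : 8 * K ^+ 3 * p%:R ^+ 2 <= 8 * K ^+ 3 * (K * n%:R) ^+ 2.
  by rewrite ler_wpM2l ?mulr_ge0 ?exprn_ge0.
have h4 : n%:R * (K * (K * p%:R)) <= n%:R * (K * (K * (K * n%:R))).
  by do 3![apply: ler_wpM2l => //].
have h5 : K ^+ 3 * n%:R ^+ 2 <= K ^+ 5 * n%:R ^+ 2.
  by rewrite ler_wpM2r ?sqr_ge0// Kpow.
have e3 : 8 * K ^+ 3 * (K * n%:R) ^+ 2 = 8 * (K ^+ 5 * n%:R ^+ 2) by ring.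
have e4 : n%:R * (K * (K * (K * n%:R))) = K ^+ 3 * n%:R ^+ 2 by ring.
rewrite e3 in h3; rewrite e4 in h4; rewrite -[leRHS]mulrA.
by lra.
Qed.

Definition sqmean t := n%:R^-1 * \sum_l rowmean l t.

Let bsq : bb full sqmean. Proof. by rewrite /sqmean; bbt. Qed.

(** Convexity of the square, applied to the mean of the row means. *)
Lemma sqmean_sqr : Ex (fun t => sqmean t ^+ 2) <= 9 * K ^+ 5.
Proof.
apply: (@le_trans _ _ (Ex (fun t => n%:R^-1 * \sum_l rowmean l t ^+ 2))).
  apply: (Ex_le (X := X) (J := full)) => [||t]; [by bbt|by bbt|].
  rewrite /sqmean exprMn expr2 -!mulrA ler_pM2l ?invr_gt0//.
  by rewrite ler_pdivrMl// sum_sqr_le.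
rewrite EZ; last by bbt.
rewrite ES => [|l _]; last by bbt.
rewrite ler_pdivrMl//; apply: (@le_trans _ _ (\sum_(l < n) 9 * K ^+ 5)).
  by apply: ler_sum => l _; exact: rowmean_sqr.
by rewrite sumr_const card_ord -[leLHS]mulr_natl.
Qed.

Let N : R := n%:R - 1.
Let N0 : 0 < N. Proof. by rewrite subr_gt0 ltr1n. Qed.
Let n2 : 2 <= n%:R :> R. Proof. by rewrite ler_nat. Qed.
Let b0 : 0 <= b.
Proof.
apply: le_trans (ub (Ordinal p0, Ordinal (ltnW n1))).
by apply: Ex_ge0 => t; rewrite (exprM _ 2 2) sqr_ge0.
Qed.

(** The right-hand side of [variance_deviation] for the centred diagonal entries
    of the Gram matrix. *)
Definition nu_error (e : R) t :=
  e * p%:R + (4 * e * p%:R * N ^+ 2)^-1 * (\sum_l (gdiag l t ^+ 2 - nu0)) ^+ 2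
  + N^-1 * (2 * e * \sum_l gdiag l t ^+ 2 + (2 / e + 12) * \sum_l rowmean l t ^+ 2
     + 2 * n%:R^-1 * (\sum_l gdiag l t) ^+ 2 + nu0).

Let bgd l : bb full (gdiag l). Proof. exact: bb_full (bb_gdiag l). Qed.

Lemma bb_nu_error e : bb full (nu_error e).
Proof. by rewrite /nu_error; bbt. Qed.

Let col_disjoint k l : k != l -> {in colset k, forall a, a \notin colset l}.
Proof. by move=> kl a; rewrite !inE => /eqP ->. Qed.

(** Both the centred diagonal entries and their centred squares are independent
    over the columns, so the squares of their sums have the expectation of the
    sums of squares. *)
Lemma nu_error_mean e : 0 < e -> e <= 1 ->
  Ex (nu_error e) <= 2 ^+ 16 * K ^+ 6 * (e * p%:R + (1 + b / n%:R) / e).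
Proof.
move=> e0 e1; rewrite /nu_error.
pose Z l t := gdiag l t ^+ 2 - nu0.
have bZl l : bb (colset l) (Z l).
  by have h := bb_gdiag l; rewrite /Z; apply: bbB; [exact: bbX|exact: bb_cst].
have bZ l : bb full (Z l) by exact: bb_full (bZl l).
have EZ0 l : Ex (Z l) = 0.
  by rewrite /Z (EB (bbX _ (bgd l)) (bb_cst X full nu0)) gdiag_sqr Ex_cst subrr.
have hx : Ex (fun t => (\sum_l Z l t) ^+ 2) <=
    n%:R * (p%:R * (2 ^+ 15 * K ^+ 5 * (p%:R + b))).
  rewrite Ex_sqr_sum_orth => [||i j ij]; last 2 first.
  - exact: bZ.
  - by rewrite (ExM Xindep (col_disjoint ij) (bZl i) (bZl j)) EZ0 mul0r.
  rewrite [leRHS]mulr_natl -[X in _ *+ X](card_ord n) -sumr_const; apply: ler_sum => l _.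
  apply: le_trans (gdiag_fourth l).
  have -> : (fun t => Z l t ^+ 2) = (fun t => gdiag l t ^+ 4 + ((- 2 * nu0) * gdiag l t ^+ 2 + nu0 ^+ 2)).
    by apply/funext => t; rewrite /Z; ring.
  rewrite ED; [|by bbt..]; rewrite ED; [|by bbt..].
  rewrite EZ; last by bbt.
  rewrite gdiag_sqr Ex_cst gerDl.
  have -> : -2 * nu0 * nu0 + nu0 ^+ 2 = - nu0 ^+ 2 by ring.
  by rewrite oppr_le0 sqr_ge0.
have hr : Ex (fun t => \sum_l gdiag l t ^+ 2) = n%:R * nu0.
  rewrite ES => [|l _]; last by bbt.
  by under eq_bigr do rewrite gdiag_sqr; rewrite sumr_const card_ord mulr_natl.
have hs : Ex (fun t => (\sum_l gdiag l t) ^+ 2) = n%:R * nu0.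
  rewrite Ex_sqr_sum_orth => [||i j ij]; last 2 first.
  - exact: bgd.
  - by rewrite (ExM Xindep (col_disjoint ij) (bb_gdiag i) (bb_gdiag j)) gdiag_mean mul0r.
  by under eq_bigr do rewrite gdiag_sqr; rewrite sumr_const card_ord mulr_natl.
have ha0 : 0 <= Ex (fun t => \sum_l rowmean l t ^+ 2).
  by apply: Ex_ge0 => t; apply: sumr_ge0 => l _; exact: sqr_ge0.
have ha : Ex (fun t => \sum_l rowmean l t ^+ 2) <= n%:R * (9 * K ^+ 5).
  rewrite ES => [|l _]; last by bbt.
  rewrite [leRHS]mulr_natl -[X in _ *+ X](card_ord n) -sumr_const.
  by apply: ler_sum => l _; exact: rowmean_sqr.
rewrite -/(Z _ _).
rewrite ED; [|by bbt..]; rewrite ED; [|by bbt..]; rewrite !EZ; [|by bbt..].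
do 3![rewrite ED; [|by bbt..]].
rewrite !EZ; [|by bbt..].
rewrite !Ex_cst hr hs.
have := nu_error_budget K1 e0 e1 pR1 n2 pK (erefl N) b0 nu0_ge0 nu0_le hx (lexx _) ha0 ha (lexx _).
by rewrite [(4 * _ * _ * _)^-1 * _]mulrC.
Qed.

(** The target of [tau_hat].  Squares of off-diagonal Gram entries are
    uncorrelated when their index pairs are disjoint, so that the variance of
    their sum is governed by the number of overlapping pairs of pairs, which is
    cubic in [n]. *)
Let w0 := s ^+ 2 * sumsqr.
Let w0_ge0 : 0 <= w0. Proof. by rewrite mulr_ge0 ?sqr_ge0. Qed.
Let w0_le : w0 <= K ^+ 2 * p%:R.
Proof. by rewrite expr2 -mulrA ler_pM ?sqr_ge0//; exact: sumsqr_le. Qed.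

Let Z k l t := gram k l t ^+ 2 - w0.
Let bZl k l : bb (colset k :|: colset l)%SET (Z k l).
Proof. by have h := bb_gram k l; rewrite /Z; apply: bbB; [exact: bbX|exact: bb_cst]. Qed.
Let bZ k l : bb full (Z k l). Proof. exact: bb_full (bZl k l). Qed.

Let Z_mean k l : k != l -> Ex (Z k l) = 0.
Proof.
by move=> kl; rewrite /Z (EB (bbX _ (bg k l)) (bb_cst X full w0)) gram_sqr// Ex_cst subrr.
Qed.

Let Z_sqr k l : k != l -> Ex (fun t => Z k l t ^+ 2) <= 9 * K ^+ 4 * p%:R ^+ 2.
Proof.
move=> kl; apply: le_trans (gram_fourth kl).
have -> : (fun t => Z k l t ^+ 2) = (fun t => gram k l t ^+ 4 + ((- 2 * w0) * gram k l t ^+ 2 + w0 ^+ 2)).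
  by apply/funext => t; rewrite /Z; ring.
rewrite ED; [|by bbt..]; rewrite ED; [|by bbt..].
rewrite EZ; last by bbt.
rewrite gram_sqr// Ex_cst gerDl -/w0.
have -> : -2 * w0 * w0 + w0 ^+ 2 = - w0 ^+ 2 by ring.
by rewrite oppr_le0 sqr_ge0.
Qed.

(** At least one when the pairs share an index; the sum over all pairs is
    then computed exactly by [sum_overlap]. *)
Let overlap (k l k' l' : 'I_n) : R :=
  (k == k')%:R + (k == l')%:R + (l == k')%:R + (l == l')%:R.

Let Z_cov k l k' l' : k != l -> k' != l' ->
  Ex (fun t => Z k l t * Z k' l' t) <= 9 * K ^+ 4 * p%:R ^+ 2 * overlap k l k' l'.
Proof.
move=> kl kl'.
have M0 : 0 <= 9 * K ^+ 4 * p%:R ^+ 2.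
  by apply: mulr_ge0; [apply: mulr_ge0 => //; exact: exprn_ge0|exact: exprn_ge0].
have [ov|] := boolP [|| k == k', k == l', l == k' | l == l'].
  apply: (@le_trans _ _ (9 * K ^+ 4 * p%:R ^+ 2)); last first.
    rewrite ler_peMr// /overlap -!natrD ler1n; move: ov.
    by case: (k == k'); case: (k == l'); case: (l == k'); case: (l == l').
  apply: (@le_trans _ _ (Ex (fun t => 2^-1 * Z k l t ^+ 2 + 2^-1 * Z k' l' t ^+ 2))).
    apply: (Ex_le (X := X) (J := full)) => [||t]; [by bbt|by bbt|].
    by have := sqr_ge0 (Z k l t - Z k' l' t); rewrite sqrrB -mulr_natr; lra.
  rewrite ED; [|by bbt..]; rewrite !EZ; [|by bbt..].
  by have := Z_sqr kl; have := Z_sqr kl'; lra.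
rewrite !negb_or => /and4P[h1 h2 h3 h4].
rewrite (ExM Xindep _ (bZl k l) (bZl k' l')); last first.
  by move=> a; rewrite !inE negb_or => /orP[] /eqP ->; apply/andP.
by rewrite Z_mean// mul0r mulr_ge0// /overlap !addr_ge0//.
Qed.

Lemma sum_overlap : \sum_k \sum_l \sum_k' \sum_l' overlap k l k' l' = 4 * n%:R ^+ 3.
Proof.
have d1 (i : 'I_n) : \sum_(j < n) (i == j)%:R = 1 :> R.
  rewrite (bigD1 i)//= eqxx big1 ?addr0// => j; by rewrite eq_sym => /negPf ->.
have sc (x : R) : \sum_(j < n) x = n%:R * x by rewrite sumr_const card_ord mulr_natl.
have e1 k l k' : \sum_l' overlap k l k' l' =
    n%:R * (k == k')%:R + 1 + n%:R * (l == k')%:R + 1.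
  by rewrite /overlap !big_split/= !sc !d1.
have e2 k l : \sum_k' \sum_l' overlap k l k' l' = 4 * n%:R.
  under eq_bigr do rewrite e1.
  by rewrite !big_split/= -!mulr_sumr !d1 !sc; ring.
under eq_bigr do under eq_bigr do rewrite e2.
under eq_bigr do rewrite sc.
by rewrite sc; ring.
Qed.

Let offsum t := \sum_k \sum_(l < n | l != k) Z k l t.

Lemma offsum_sqr : Ex (fun t => offsum t ^+ 2) <=
  4 * n%:R ^+ 3 * (9 * K ^+ 4 * p%:R ^+ 2).
Proof.
have M0 : 0 <= 9 * K ^+ 4 * p%:R ^+ 2.
  by apply: mulr_ge0; [apply: mulr_ge0 => //; exact: exprn_ge0|exact: exprn_ge0].
have -> : (fun t => offsum t ^+ 2) = (fun t => \sum_k \sum_(l < n | l != k)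
     \sum_k' \sum_(l' < n | l' != k') Z k l t * Z k' l' t).
  apply/funext => t; rewrite expr2 {1}/offsum mulr_suml; apply: eq_bigr => k _.
  rewrite mulr_suml; apply: eq_bigr => l _.
  rewrite /offsum mulr_sumr; apply: eq_bigr => k' _; by rewrite mulr_sumr.
rewrite -sum_overlap mulrC mulr_sumr.
rewrite ES => [|k _]; last by bbt.
apply: ler_sum => k _; rewrite mulr_sumr.
rewrite ES => [|l _]; last by bbt.
rewrite [leLHS]big_mkcond/=; apply: ler_sum => l _.
have ov0 k' l' : 0 <= 9 * K ^+ 4 * p%:R ^+ 2 * overlap k l k' l'.
  by rewrite mulr_ge0// /overlap !addr_ge0//.
rewrite mulr_sumr; case: ifP => lk; last first.
  by apply: sumr_ge0 => k' _; rewrite mulr_sumr; apply: sumr_ge0.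
rewrite ES => [|k' _]; last by bbt.
apply: ler_sum => k' _; rewrite mulr_sumr.
rewrite ES => [|l' _]; last by bbt.
rewrite [leLHS]big_mkcond/=; apply: ler_sum => l' _.
by case: ifP => // lk'; apply: Z_cov; rewrite eq_sym ?lk ?lk'.
Qed.

(** The correction by which the empirically centred Gram matrix differs from the
    Gram matrix. *)
Let h k l t := sqmean t - rowmean k t - rowmean l t.

Lemma centring_sqr k l : Ex (fun t => h k l t ^+ 2) <= 81 * K ^+ 5.
Proof.
apply: (@le_trans _ _ (Ex (fun t => 3 * sqmean t ^+ 2 + (3 * rowmean k t ^+ 2 + 3 * rowmean l t ^+ 2)))).
  have bh : bb full (h k l) by rewrite /h; bbt.
  apply: (Ex_le (X := X) (J := full)) => [||t]; [by bbt|by bbt|].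
  rewrite -subr_ge0 /h.
  have -> : 3 * sqmean t ^+ 2 + (3 * rowmean k t ^+ 2 + 3 * rowmean l t ^+ 2) - (sqmean t - rowmean k t - rowmean l t) ^+ 2
    = (sqmean t + rowmean k t) ^+ 2 + (sqmean t + rowmean l t) ^+ 2 + (rowmean k t - rowmean l t) ^+ 2 by ring.
  by rewrite !addr_ge0 ?sqr_ge0.
rewrite ED; [|by bbt..]; rewrite ED; [|by bbt..].
rewrite !EZ; [|by bbt..].
by have := sqmean_sqr; have := rowmean_sqr k; have := rowmean_sqr l; lra.
Qed.

(** The right-hand side of [offdiag_deviation] for the Gram matrix; the diagonal
    contributes a multiple of [nu_hat] by [tau_hatE]. *)
Definition tau_error (e : R) t :=
  N^-1 * (nu_error e t + nu0) + e * p%:R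
  + (4 * e * p%:R * N ^+ 4)^-1 * offsum t ^+ 2
  + N ^- 2 * (e * \sum_k \sum_(l < n | l != k) gram k l t ^+ 2
     + 2 / e * \sum_k \sum_(l < n | l != k) h k l t ^+ 2) + N^-1 * w0.

Let bh k l : bb full (h k l). Proof. by rewrite /h; bbt. Qed.

Let boff : bb full offsum. Proof. by rewrite /offsum; bbt. Qed.

Lemma bb_tau_error e : bb full (tau_error e).
Proof. by have bnu := bb_nu_error e; rewrite /tau_error; bbt. Qed.

Let double_sum_le (F : 'I_n -> 'I_n -> R) (M : R) : 0 <= M ->
  (forall k l, k != l -> F k l <= M) ->
  \sum_k \sum_(l < n | l != k) F k l <= n%:R ^+ 2 * M.
Proof.
move=> M0 FM; rewrite expr2 -mulrA [leRHS]mulr_natl -[X in _ *+ X](card_ord n) -sumr_const.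
apply: ler_sum => k _; rewrite [leRHS]mulr_natl -[X in _ *+ X](card_ord n) -sumr_const.
rewrite [leLHS]big_mkcond/=; apply: ler_sum => l _.
by case: ifP => // lk; rewrite FM// eq_sym lk.
Qed.

Lemma tau_error_mean e : 0 < e -> e <= 1 ->
  Ex (tau_error e) <= 2 ^+ 17 * K ^+ 6 * (e * p%:R + (1 + b / n%:R) / e).
Proof.
move=> e0 e1; have bnu := bb_nu_error e; rewrite /tau_error.
have sum_ex (F : 'I_n -> 'I_n -> T -> R) : (forall k l, bb full (F k l)) ->
    Ex (fun t => \sum_k \sum_(l < n | l != k) F k l t) =
    \sum_k \sum_(l < n | l != k) Ex (F k l).
  move=> bF; rewrite ES => [|k _]; last by bbt.
  by apply: eq_bigr => k _; rewrite ES.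
have hg : Ex (fun t => \sum_k \sum_(l < n | l != k) gram k l t ^+ 2) <= n%:R ^+ 2 * (K ^+ 2 * p%:R).
  rewrite sum_ex; last by move=> k l; bbt.
  apply: double_sum_le => [|k l kl]; first by rewrite mulr_ge0// sqr_ge0.
  by rewrite gram_sqr.
have hh : Ex (fun t => \sum_k \sum_(l < n | l != k) h k l t ^+ 2) <= n%:R ^+ 2 * (81 * K ^+ 5).
  rewrite sum_ex; last by move=> k l; bbt.
  apply: double_sum_le => [|k l kl]; last exact: centring_sqr.
  by rewrite mulr_ge0// exprn_ge0.
have sum0 (F : 'I_n -> 'I_n -> T -> R) :
    0 <= Ex (fun t => \sum_k \sum_(l < n | l != k) F k l t ^+ 2).
  by apply: Ex_ge0 => t; apply: sumr_ge0 => k _; apply: sumr_ge0 => l _; exact: sqr_ge0.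
have nu_ge0 : 0 <= Ex (nu_error e).
  apply: Ex_ge0 => t; rewrite /nu_error.
  have sums (F : 'I_n -> T -> R) : 0 <= \sum_l F l t ^+ 2.
    by apply: sumr_ge0 => l _; exact: sqr_ge0.
  have e0' := ltW e0; have N0' := ltW N0; have v0 := nu0_ge0.
  have den : 0 <= (4 * e * p%:R * N ^+ 2)^-1.
    by rewrite invr_ge0; apply: mulr_ge0; [do 2![apply: mulr_ge0 => //]|exact: sqr_ge0].
  have e2 : 0 <= 2 / e + 12 by rewrite addr_ge0// divr_ge0.
  apply: addr_ge0; [apply: addr_ge0|].
  - exact: mulr_ge0.
  - by apply: mulr_ge0 => //; exact: sqr_ge0.
  apply: mulr_ge0; rewrite ?invr_ge0//.
  apply: addr_ge0 => //; apply: addr_ge0; last first.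
    by apply: mulr_ge0; [rewrite mulr_ge0// invr_ge0 ler0n|exact: sqr_ge0].
  by apply: addr_ge0; apply: mulr_ge0 => //; exact: mulr_ge0.
move: (nu_error_mean e0 e1) nu_ge0 bnu; move: (nu_error e) => Hn hHn Hn0 bHn.
do 4![rewrite ED; [|by bbt..]]; rewrite !EZ; [|by bbt..].
have -> : Ex (fun t => Hn t + nu0) = Ex Hn + nu0 by rewrite (ED bHn (bb_cst _ _ nu0)) Ex_cst.
rewrite ED; [|by bbt..]; rewrite !EZ; [|by bbt..]; rewrite !Ex_cst.
have := tau_error_budget K1 e0 e1 pR1 n2 pK (erefl N) b0 nu0_ge0 nu0_le
  hHn offsum_sqr hg hh Hn0 (sum0 _) (sum0 _) w0_ge0 w0_le.
by rewrite [(4 * _ * _ * _)^-1 * _]mulrC.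
Qed.

Variable A : 'M[R]_p.
Hypothesis Arow : forall j, \sum_k A j k ^+ 2 = S j j.

Definition entry j i t := \sum_k A j k * u (k, i) t.
Definition coordmean j t := n%:R^-1 * \sum_i entry j i t.
Definition coorddev j t :=
  n%:R^-1 * \sum_i entry j i t ^+ 2 - coordmean j t ^+ 2 - s * S j j.

Let cA (a a' : I) : R := A a.1 a'.1.

Lemma entry_linform j i : entry j i = linform u (column i) (fun a _ => cA (j, i) a).
Proof. by apply/funext => t; rewrite /linform big_map. Qed.

Lemma bb_entry j i : bb (colset i) (entry j i).
Proof. by apply: bb_sum => k _; apply: bbM; [exact: bb_cst|exact: bb_col]. Qed.

Let bE j i : bb full (entry j i). Proof. exact: bb_full (bb_entry j i). Qed.

Let Sdiag_le j : S j j ^+ 2 <= K.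
Proof.
apply: le_trans (Srow j); rewrite (bigD1 j)//= lerDl.
by apply: sumr_ge0 => j' _; exact: sqr_ge0.
Qed.

Lemma entry_sqr j i : Ex (fun t => entry j i t ^+ 2) = s * S j j.
Proof.
rewrite entry_linform (weights_sqr Xindep bu u1 u2 cA (j, i) (column_uniq i)).
by rewrite big_map /cA/= Arow.
Qed.

Lemma entry_fourth j i : Ex (fun t => entry j i t ^+ 4) <= 3 * K ^+ 2.
Proof.
rewrite entry_linform.
apply: le_trans (weights_fourth Xindep bu u1 u2 u3 u4 cA (j, i) (column_uniq i) sk) _.
rewrite big_map /cA/= Arow [K ^+ 2]expr2 mulrA.
by apply: ler_pM; [exact: mulr_ge0|exact: sqr_ge0|rewrite ler_pM2l|exact: Sdiag_le].
Qed.

(** The mean of a coordinate is a linear form in all the variables, with weights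
    [A j k / n] of squared norm [S j j / n]. *)
Lemma coordmean_fourth j : Ex (fun t => coordmean j t ^+ 4) <= 3 * K ^+ 2 / n%:R.
Proof.
pose cN (a a' : I) : R := A j a'.1 / n%:R.
have nz : n%:R != 0 :> R by rewrite gt_eqF.
have a0 : I := (Ordinal p0, Ordinal (ltnW n1)).
have -> : coordmean j = linform u (index_enum I) (fun a _ => cN a0 a).
  apply/funext => t; rewrite /linform /coordmean /entry exchange_big/=.
  rewrite (pair_bigA _ (fun k i => A j k * u (k, i) t))/= mulr_sumr.
  by apply: eq_bigr => -[k i] _ /=; rewrite /cN/=; ring.
apply: le_trans (weights_fourth Xindep bu u1 u2 u3 u4 cN a0 (index_enum_uniq I) sk) _.
have -> : \sum_(a <- index_enum I) cN a0 a ^+ 2 = S j j / n%:R.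
  rewrite -(pair_bigA _ (fun k i => (A j k / n%:R) ^+ 2))/= -Arow mulr_suml.
  apply: eq_bigr => k _; rewrite sumr_const card_ord -mulr_natl.
  by field.
rewrite expr_div_n -mulrA (_ : 3 * K ^+ 2 / n%:R = (3 * K) * (K / n%:R)); last by ring.
rewrite [in leLHS]mulrA.
apply: ler_pM; [exact: mulr_ge0|by rewrite divr_ge0 ?sqr_ge0|by rewrite ler_pM2l|].
apply: ler_pM => //; first exact: sqr_ge0.
rewrite lef_pV2 ?posrE ?exprn_gt0// ler_eXnr//.
by rewrite (le_trans _ n2)// ler1n.
Qed.

Let bcm j : bb full (coordmean j). Proof. by rewrite /coordmean; bbt. Qed.

Lemma coorddev_sqr j : Ex (fun t => coorddev j t ^+ 2) <= 12 * K ^+ 2 / n%:R.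
Proof.
pose D i t := entry j i t ^+ 2 - s * S j j.
have bDl i : bb (colset i) (D i).
  have h' := bb_entry j i; rewrite /D; apply: bbB; [exact: bbX|exact: bb_cst].
have bD i : bb full (D i) by exact: bb_full (bDl i).
have D0 i : Ex (D i) = 0.
  by rewrite /D (EB (bbX _ (bE j i)) (bb_cst X full (s * S j j))) entry_sqr Ex_cst subrr.
have D2 : Ex (fun t => (\sum_i D i t) ^+ 2) <= n%:R * (3 * K ^+ 2).
  rewrite Ex_sqr_sum_orth => [||i i' ii]; last 2 first.
  - exact: bD.
  - by rewrite (ExM Xindep (col_disjoint ii) (bDl i) (bDl i')) D0 mul0r.
  rewrite [leRHS]mulr_natl -[X in _ *+ X](card_ord n) -sumr_const; apply: ler_sum => i _.
  apply: le_trans (entry_fourth j i).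
  have -> : (fun t => D i t ^+ 2) = (fun t => entry j i t ^+ 4 + ((- 2 * (s * S j j)) * entry j i t ^+ 2 + (s * S j j) ^+ 2)).
    by apply/funext => t; rewrite /D; ring.
  rewrite ED; [|by bbt..]; rewrite ED; [|by bbt..].
  rewrite EZ; last by bbt.
  rewrite entry_sqr Ex_cst gerDl.
  have -> : -2 * (s * S j j) * (s * S j j) + (s * S j j) ^+ 2 = - (s * S j j) ^+ 2 by ring.
  by rewrite oppr_le0 sqr_ge0.
have nz : n%:R != 0 :> R by rewrite gt_eqF.
have devE t : coorddev j t = n%:R^-1 * \sum_i D i t - coordmean j t ^+ 2.
  by rewrite /coorddev /D sumrB sumr_const card_ord -mulr_natl; field.
apply: (@le_trans _ _ (Ex (fun t => (2 * n%:R ^- 2) * (\sum_i D i t) ^+ 2 + 2 * coordmean j t ^+ 4))).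
  apply: (Ex_le (X := X) (J := full)) => [||t].
  - by rewrite /coorddev; bbt.
  - by bbt.
  rewrite devE -subr_ge0.
  have -> : 2 / n%:R ^+ 2 * (\sum_i D i t) ^+ 2 + 2 * coordmean j t ^+ 4 - (n%:R^-1 * \sum_i D i t - coordmean j t ^+ 2) ^+ 2
    = (n%:R^-1 * \sum_i D i t + coordmean j t ^+ 2) ^+ 2 by field.
  exact: sqr_ge0.
rewrite ED; [|by bbt..]; rewrite !EZ; [|by bbt..].
have h1 : 2 / n%:R ^+ 2 * Ex (fun t => (\sum_i D i t) ^+ 2) <= 6 * K ^+ 2 / n%:R.
  apply: (@le_trans _ _ (2 / n%:R ^+ 2 * (n%:R * (3 * K ^+ 2)))).
    by apply: ler_wpM2l => //; rewrite divr_ge0// exprn_ge0.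
  by rewrite le_eqVlt; apply/orP; left; apply/eqP; field.
have h2 := coordmean_fourth j.
have -> : 12 * K ^+ 2 / n%:R = 6 * K ^+ 2 / n%:R + 2 * (3 * K ^+ 2 / n%:R) by ring.
by apply: lerD => //; rewrite ler_pM2l.
Qed.

(** The right-hand side of [sqr_deviation] for the empirical variances of the
    coordinates, whose targets are [s * S j j]. *)
Definition omega_error (e : R) t :=
  e * p%:R + (K ^+ 2 / e + 1) * \sum_j coorddev j t ^+ 2.

Lemma bb_omega_error e : bb full (omega_error e).
Proof. by rewrite /omega_error /coorddev; bbt. Qed.

Lemma omega_error_mean e : 0 < e -> e <= 1 ->
  Ex (omega_error e) <= 2 ^+ 17 * K ^+ 6 * (e * p%:R + (1 + b / n%:R) / e).
Proof.
move=> e0 e1; rewrite /omega_error.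
have bcd j : bb full (coorddev j) by rewrite /coorddev; bbt.
rewrite ED; [|by bbt..]; rewrite !EZ; [|by bbt..]; rewrite Ex_cst.
rewrite ES => [|j _]; last by bbt.
have hs : \sum_j Ex (fun t => coorddev j t ^+ 2) <= 12 * K ^+ 3.
  apply: (@le_trans _ _ (\sum_(j < p) (12 * K ^+ 2 / n%:R))).
    by apply: ler_sum => j _; exact: coorddev_sqr.
  rewrite sumr_const card_ord -[leLHS]mulr_natl mulrA ler_pdivrMr//.
  have -> : 12 * K ^+ 3 * n%:R = 12 * K ^+ 2 * (K * n%:R) by ring.
  by rewrite mulrC; apply: ler_wpM2l => //; rewrite mulr_ge0// exprn_ge0.
have e2 : 0 <= K ^+ 2 / e + 1 by rewrite addr_ge0// divr_ge0// ?exprn_ge0// ltW.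
apply: (@le_trans _ _ (e * p%:R + (K ^+ 2 / e + 1) * (12 * K ^+ 3))).
  by rewrite lerD2l ler_wpM2l.
have einv : 1 <= e^-1 by rewrite invf_ge1.
have h1 : K ^+ 2 / e + 1 <= 2 * (K ^+ 2 / e).
  have : 1 <= K ^+ 2 / e by rewrite mulr_ege1// exprn_ege1.
  by lra.
have h2 : (K ^+ 2 / e + 1) * (12 * K ^+ 3) <= 24 * K ^+ 5 / e.
  have -> : 24 * K ^+ 5 / e = 2 * (K ^+ 2 / e) * (12 * K ^+ 3) by ring.
  by apply: ler_wpM2r => //; rewrite mulr_ge0// exprn_ge0.
have h3 : 24 * K ^+ 5 / e <= 24 * (K ^+ 6 * ((1 + b / n%:R) / e)).
  rewrite -mulrA ler_pM2l//; apply: ler_pM; rewrite ?exprn_ge0 ?invr_ge0 ?Kpow//; first exact: ltW.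
  by rewrite ler_peMl ?invr_ge0 ?lerDl ?divr_ge0//; exact: ltW.
have h4 : e * p%:R <= K ^+ 6 * (e * p%:R).
  by rewrite ler_peMl ?exprn_ege1// mulr_ge0// ltW.
have h5 : 0 <= K ^+ 6 * (e * p%:R).
  by rewrite mulr_ge0 ?exprn_ge0// mulr_ge0// ltW.
have h6 : 0 <= K ^+ 6 * ((1 + b / n%:R) / e).
  by rewrite mulr_ge0 ?exprn_ge0// divr_ge0 ?addr_ge0 ?divr_ge0//; exact: ltW.
have -> : 2 ^+ 17 * K ^+ 6 * (e * p%:R + (1 + b / n%:R) / e) =
    2 ^+ 17 * (K ^+ 6 * (e * p%:R)) + 2 ^+ 17 * (K ^+ 6 * ((1 + b / n%:R) / e)) by ring.
by lra.
Qed.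

Hypothesis AA : forall k l, \sum_j A j k * A j l = S k l.

Definition datamx t : 'M[R]_(p, n) := \matrix_(j, i) entry j i t.

Lemma gramY_datamx t k l : gramY (datamx t) k l = gram k l t.
Proof.
rewrite /gramY; under eq_bigr do rewrite !mxE mulr_suml.
rewrite exchange_big/=; apply: eq_bigr => j _.
under eq_bigr do rewrite mulr_sumr.
rewrite exchange_big/=; apply: eq_bigr => j' _.
rewrite -AA !mulr_suml; apply: eq_bigr => i _; ring.
Qed.

Lemma rowmeanY_datamx t k : rowmeanY (datamx t) k = rowmean k t.
Proof. by rewrite /rowmeanY; under eq_bigr do rewrite gramY_datamx. Qed.

Lemma sqmeanY_datamx t : sqmeanY (datamx t) = sqmean t.
Proof. by rewrite /sqmeanY; under eq_bigr do rewrite rowmeanY_datamx. Qed.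

Lemma cgramY_datamx t k l : cgramY (datamx t) k l = gram k l t + h k l t.
Proof. by rewrite /cgramY gramY_datamx !rowmeanY_datamx sqmeanY_datamx /h; ring. Qed.

Lemma nu_hat_deviation e t : 0 < e -> `|nu_hat (datamx t) - nu0| <= nu_error e t.
Proof.
move=> e0; rewrite nu_hatE -/N.
pose c' i := gdiag i t - 2 * rowmean i t.
have cc i : cgramY (datamx t) i i - n%:R^-1 * \sum_i' cgramY (datamx t) i' i' =
    c' i - n%:R^-1 * \sum_i' c' i'.
  have cE j : cgramY (datamx t) j j = c' j + (s * traceS + sqmean t).
    by rewrite cgramY_datamx /c' /gdiag /h; ring.
  under eq_bigr do rewrite cE.
  rewrite cE big_split/= sumr_const card_ord -[_ *+ n]mulr_natl.
  by field; rewrite gt_eqF.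
under eq_bigr do rewrite cc.
apply: le_trans (variance_deviation n1 e0 pR0 nu0_ge0 (erefl N) (fun i => erefl (c' i))) _.
by rewrite /nu_error [_ ^+ 2 / _]mulrC.
Qed.

Lemma tau_hat_deviation e t : 0 < e -> e <= 1 ->
  `|tau_hat (datamx t) - s ^+ 2 * sumsqr| <= tau_error e t.
Proof.
move=> e0 e1; rewrite tau_hatE// -/N -/w0.
under eq_bigr do under eq_bigr do rewrite cgramY_datamx.
apply: le_trans (offdiag_deviation (fun k l => gram k l t) (fun k l => h k l t)
  (nu_hat (datamx t)) n1 e0 e1 pR0 w0_ge0 (erefl N)) _.
rewrite /tau_error -/offsum [_ ^+ 2 / (4 * _ * _ * _)]mulrC.
do 4![apply: lerD => //]; rewrite ler_pM2l ?invr_gt0//.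
have := nu_hat_deviation t e0; have := nu0_ge0.
by rewrite ler_norml => ? /andP[? ?]; rewrite ler_norml; apply/andP; split; lra.
Qed.

Lemma omega_hat_deviation e t : 0 < e ->
  `|omega_hat (datamx t) - s ^+ 2 * sumdiag2| <= omega_error e t.
Proof.
move=> e0; rewrite omega_hatE; last exact: ltnW.
have wK j : (s * S j j) ^+ 2 <= K ^+ 2.
  by rewrite exprMn [K ^+ 2]expr2; apply: ler_pM => //; exact: sqr_ge0.
have -> : s ^+ 2 * sumdiag2 = \sum_j (s * S j j) ^+ 2.
  by rewrite mulr_sumr; apply: eq_bigr => j _; rewrite exprMn.
apply: le_trans (sqr_deviation _ e0 wK) _.
rewrite le_eqVlt; apply/orP; left; apply/eqP; congr (_ + _ * _).
apply: eq_bigr => j _; rewrite /coorddev /coordmean; congr ((_ * _ - (_ * _) ^+ 2 - _) ^+ 2).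
  by apply: eq_bigr => i _; rewrite mxE.
by apply: eq_bigr => i _; rewrite mxE.
Qed.

End Sample.

(** * Truncated moments *)

Section Clamp.
Variable R : realType.
Implicit Types M v : R.

Definition clamp M v := Num.max (- M) (Num.min M v).

Lemma measurable_clamp M : measurable_fun [set: R] (clamp M).
Proof. by apply: measurable_maxr => //; exact: measurable_minr. Qed.

Lemma clamp_bounded M v : 0 <= M -> `|clamp M v| <= M.
Proof.
move=> M0; rewrite /clamp ler_norml le_max lexx/= ge_max ge_min lexx andbT.
by rewrite (le_trans _ M0)// oppr_le0.
Qed.

Lemma clamp_le M v : 0 <= M -> `|clamp M v| <= `|v|.
Proof.
move=> M0; rewrite /clamp ler_norml; apply/andP; split.
  rewrite le_max le_min; apply/orP; right; apply/andP; split.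
    by rewrite (le_trans _ M0)// oppr_le0.
  by rewrite lerNl ler_normr lexx orbT.
rewrite ge_max ge_min ler_norm orbT andbT.
by rewrite (le_trans _ (normr_ge0 v))// oppr_le0.
Qed.

Lemma clamp_id M v : `|v| <= M -> clamp M v = v.
Proof. by rewrite ler_norml => /andP[h1 h2]; rewrite /clamp (min_idPr h2) (max_idPr h1). Qed.

End Clamp.

Section TruncatedMoments.
Context (R : realType) d (T : measurableType d) (P : probability T R).
Variables (x : {RV P >-> R}) (delta : R).
Hypothesis delta0 : 0 < delta.
Hypothesis xmom : ('E_P[fun w => (`|x w| `^ (4 + delta))%R] < +oo)%E.
Local Notation Ex := (Rintegral P setT).

Let mu := fine 'E_P[x].
Definition centered w := x w - mu.
Local Notation z := centered.
(** An integrable bound for all moments up to the fourth, before and after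
    clamping. *)
Let envelope w := 9 + 8 * (`|x w| `^ (4 + delta) + mu ^+ 4).

Lemma measurable_centered : measurable_fun setT z.
Proof. by apply: measurable_funB. Qed.

Let mpow : measurable_fun setT (fun w => `|x w| `^ (4 + delta)).
Proof.
apply: (measurableT_comp (measurable_powR (4 + delta))) => //.
exact: measurableT_comp.
Qed.

Let pow_int : P.-integrable setT (EFin \o (fun w => `|x w| `^ (4 + delta))).
Proof.
apply/integrableP; split; first exact/measurable_EFinP.
apply: le_lt_trans xmom; rewrite unlock le_eqVlt; apply/orP; left; apply/eqP.
by apply: eq_integral => w _ /=; rewrite ger0_norm// powR_ge0.
Qed.

Let cst_int c : P.-integrable setT (EFin \o (fun=> c : R)).
Proof. by apply: finite_measure_integrable_cst. Qed.

Lemma envelope_integrable : P.-integrable setT (EFin \o envelope).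
Proof.
rewrite (_ : EFin \o envelope = (fun w => (9 + 8 * mu ^+ 4)%:E + 8%:E * (`|x w| `^ (4 + delta))%:E)%E); last first.
  by apply/funext => w; rewrite /envelope /= -EFinM -EFinD; congr (_%:E); ring.
apply: integrableD => //; first exact: cst_int.
exact: integrableZl.
Qed.

Lemma centered_pow_le_envelope r w : (r <= 4)%N -> `|z w| ^+ r <= envelope w.
Proof.
move=> r4.
have x4 : `|x w| ^+ 4 <= 1 + `|x w| `^ (4 + delta).
  have [x1|x1] := leP `|x w| 1.
    by apply: (@le_trans _ _ 1); [exact: exprn_ile1|rewrite lerDl powR_ge0].
  rewrite -powR_mulrn// (le_trans (ler_powR (ltW x1) (_ : 4 <= 4 + delta)))//.
    by rewrite lerDl ltW.
  by rewrite lerDr.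
have z4 : `|z w| ^+ 4 <= 8 * (`|x w| ^+ 4 + mu ^+ 4).
  rewrite -!normrX ger0_norm ?(exprM _ 2 2) ?sqr_ge0//.
  rewrite [`|_|]ger0_norm ?sqr_ge0// -!exprM /z /centered -subr_ge0.
  have -> : 8 * (x w ^+ (2 * 2) + mu ^+ 4) - (x w - mu) ^+ (2 * 2) =
    (x w + mu) ^+ 2 * (5 * (x w - mu) ^+ 2 + 2 * x w ^+ 2 + 2 * mu ^+ 2) by ring.
  by rewrite mulr_ge0 ?sqr_ge0// !addr_ge0// mulr_ge0// sqr_ge0.
have zr : `|z w| ^+ r <= 1 + `|z w| ^+ 4.
  have [z1|z1] := leP `|z w| 1.
    by apply: (@le_trans _ _ 1); [exact: exprn_ile1|rewrite lerDl exprn_ge0].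
  by rewrite (le_trans (ler_weXn2l (ltW z1) r4))// lerDr.
by rewrite /envelope; lra.
Qed.

Lemma centered_pow_integrable r : (r <= 4)%N -> P.-integrable setT (EFin \o (fun w => z w ^+ r)).
Proof.
move=> r4; apply: le_integrable envelope_integrable => //.
  by apply/measurable_EFinP; apply: measurable_funX; exact: measurable_centered.
move=> w _ /=; rewrite lee_fin normrX (le_trans (centered_pow_le_envelope w r4))//.
exact: ler_norm.
Qed.

(** Dominated convergence: the clamped variable is eventually equal to the
    original one at each point. *)
Lemma clamped_pow_cvg (M : nat -> R) r : (0 < r <= 4)%N -> (forall n, 0 <= M n) ->
    M @ \oo --> +oo ->
  Ex (fun w => clamp (M n) (z w) ^+ r) @[n --> \oo] --> Ex (fun w => z w ^+ r).
Proof.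
move=> /andP[r0 r4] M0 Moo.
have mz := measurable_centered.
have mcl n : measurable_fun setT (fun w => clamp (M n) (z w) ^+ r).
  by apply: measurable_funX; apply: measurableT_comp => //; exact: measurable_clamp.
have mE n : measurable_fun setT (fun w => (clamp (M n) (z w) ^+ r)%:E).
  exact/measurable_EFinP.
have mzE : measurable_fun setT (fun w => (z w ^+ r)%:E).
  by apply/measurable_EFinP; exact: measurable_funX.
have ptw w : (clamp (M n) (z w) ^+ r)%:E @[n --> \oo] --> (z w ^+ r)%:E.
  apply: cvg_near_cst; near=> n; congr (_ ^+ r)%:E; apply: clamp_id.
  near: n; move/cvgryPge : Moo; exact.
have dm n w : (`|(clamp (M n) (z w) ^+ r)%:E| <= (envelope w)%:E)%E.
  rewrite /= lee_fin normrX (le_trans _ (centered_pow_le_envelope w r4))//.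
  by rewrite lerXn2r ?nnegrE// clamp_le.
have [_ _ h] := @dominated_convergence _ T R P setT measurableT
   (fun n w => (clamp (M n) (z w) ^+ r)%:E) (fun w => (z w ^+ r)%:E) (EFin \o envelope)
   mE mzE (aeW _ (fun w _ => ptw w)) envelope_integrable (aeW _ (fun w n _ => dm n w)).
rewrite /Rintegral; apply: fine_cvg; rewrite fineK; first exact: h.
exact: integrable_fin_num (centered_pow_integrable r4).
Unshelve. all: by end_near. Qed.


Lemma centered_mean : Ex z = 0.
Proof.
have x_int : P.-integrable setT (EFin \o x).
  rewrite (_ : EFin \o x = (fun w => (z w ^+ 1)%:E + mu%:E)%E); last first.
    by apply/funext => w; rewrite /= -EFinD expr1 subrK.
  by apply: integrableD => //; [exact: centered_pow_integrable|exact: cst_int].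
rewrite (RintegralB measurableT x_int (cst_int mu)).
rewrite Ex_cst /mu unlock; apply/eqP; rewrite subr_eq0; exact/eqP.
Qed.

Lemma fourth_central_momentE : fourth_central_moment P x = Ex (fun w => z w ^+ 4).
Proof. by rewrite /fourth_central_moment /centered /mu unlock. Qed.

Lemma centered_sqr : 'V_P[x] = 1%E -> Ex (fun w => z w ^+ 2) = 1.
Proof.
rewrite /variance unlock => h.
rewrite /Rintegral -[RHS]/(fine 1%E) -h /centered /mu unlock; congr fine.
Qed.

(** Clamping moves the mean, so the mean of the clamped variable is subtracted. *)
Definition truncated M (v : R) := clamp M (v - mu) - Ex (fun w => clamp M (z w)).
Definition trmoment M r := Ex (fun w => truncated M (x w) ^+ r).

Let clamp_int M r : 0 <= M -> P.-integrable setT (EFin \o (fun w => clamp M (z w) ^+ r)).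
Proof.
move=> M0; apply: le_integrable (cst_int (M ^+ r)) => //.
  apply/measurable_EFinP; apply: measurable_funX; apply: measurableT_comp.
    exact: measurable_clamp.
  exact: measurable_centered.
move=> w _ /=; rewrite lee_fin normrX [leRHS]ger0_norm ?exprn_ge0//.
by rewrite lerXn2r ?nnegrE// clamp_bounded.
Qed.

Lemma measurable_truncated M : measurable_fun setT (truncated M).
Proof.
apply: measurable_funB => //; apply: measurableT_comp; first exact: measurable_clamp.
exact: measurable_funB.
Qed.

Lemma truncated_bounded M v : 0 <= M -> `|truncated M v| <= 2 * M.
Proof.
move=> M0; rewrite /truncated (le_trans (ler_normB _ _))//.
have h : `|Ex (fun w => clamp M (z w))| <= M.
  have i1 : P.-integrable setT (EFin \o (fun w => clamp M (z w))).
    rewrite (_ : (fun w => _) = (fun w => clamp M (z w) ^+ 1)); first exact: clamp_int.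
    by apply/funext => w; rewrite expr1.
  rewrite (le_trans (le_normr_Rintegral _ i1))//.
  rewrite -[leRHS](Ex_cst P); apply: (le_Rintegral measurableT _ (cst_int M)) => [|w _]; last exact: clamp_bounded.
  exact: integrable_norm.
by have := clamp_bounded (v - mu) M0; lra.
Qed.

Lemma trmoment1 M : 0 <= M -> trmoment M 1 = 0.
Proof.
move=> M0; rewrite /trmoment /truncated.
set m := Ex (fun w => clamp M (z w)).
under eq_fun do rewrite expr1 -[clamp M _]expr1.
rewrite (RintegralB measurableT (clamp_int 1 M0) (cst_int m)) Ex_cst.
by under eq_fun do rewrite expr1; rewrite subrr.
Qed.

Let cl M r := Ex (fun w => clamp M (z w) ^+ r).

Let cl1 M : Ex (fun w => clamp M (z w)) = cl M 1.
Proof. by rewrite /cl; under [in RHS]eq_fun do rewrite expr1. Qed.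

Let lin_int c M r : 0 <= M ->
  P.-integrable setT (EFin \o (fun w => c * clamp M (z w) ^+ r)).
Proof.
move=> M0; rewrite (_ : EFin \o _ = (fun w => c%:E * (clamp M (z w) ^+ r)%:E)%E)//.
by apply: integrableZl => //; exact: clamp_int.
Qed.

Lemma trmoment2 M : 0 <= M -> trmoment M 2 = cl M 2 - cl M 1 ^+ 2.
Proof.
move=> M0; rewrite /trmoment /truncated cl1 -/(z _).
rewrite (_ : (fun w => _) = (fun w => (1 * clamp M (z w) ^+ 2 +
   (- 2 * cl M 1) * clamp M (z w) ^+ 1) + cl M 1 ^+ 2)); last first.
  by apply/funext => w; rewrite /z /centered; ring.
have i2 := lin_int 1 2 M0; have i1 := lin_int (- 2 * cl M 1) 1 M0.
rewrite (RintegralD measurableT (integrableD measurableT i2 i1) (cst_int _)).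
rewrite (RintegralD measurableT i2 i1) !(RintegralZl _ measurableT (clamp_int _ M0)).
by rewrite Ex_cst -/(cl M 1) -/(cl M 2); ring.
Qed.

Lemma trmoment4 M : 0 <= M -> trmoment M 4 =
  cl M 4 - 4 * cl M 1 * cl M 3 + 6 * cl M 1 ^+ 2 * cl M 2 - 3 * cl M 1 ^+ 4.
Proof.
move=> M0; rewrite /trmoment /truncated cl1 -/(z _).
rewrite (_ : (fun w => _) = (fun w => (1 * clamp M (z w) ^+ 4 +
   (- 4 * cl M 1) * clamp M (z w) ^+ 3) + ((6 * cl M 1 ^+ 2) * clamp M (z w) ^+ 2
   + (- 4 * cl M 1 ^+ 3) * clamp M (z w) ^+ 1) + cl M 1 ^+ 4)); last first.
  by apply/funext => w; rewrite /z /centered; ring.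
have i4 := lin_int 1 4 M0; have i3 := lin_int (- 4 * cl M 1) 3 M0.
have i2 := lin_int (6 * cl M 1 ^+ 2) 2 M0; have i1 := lin_int (- 4 * cl M 1 ^+ 3) 1 M0.
have i43 := integrableD measurableT i4 i3; have i21 := integrableD measurableT i2 i1.
rewrite (RintegralD measurableT (integrableD measurableT i43 i21) (cst_int _)).
rewrite (RintegralD measurableT i43 i21) (RintegralD measurableT i4 i3).
rewrite (RintegralD measurableT i2 i1) !(RintegralZl _ measurableT (clamp_int _ M0)).
by rewrite Ex_cst -/(cl M 1) -/(cl M 2) -/(cl M 3) -/(cl M 4); ring.
Qed.

Lemma trmoment_cvg (M : nat -> R) : 'V_P[x] = 1%E -> (forall n, 0 <= M n) ->
    M @ \oo --> +oo ->
  trmoment (M n) 2 @[n --> \oo] --> (1 : R) /\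
  trmoment (M n) 4 @[n --> \oo] --> fourth_central_moment P x.
Proof.
move=> var1 M0 Moo.
have c r : (0 < r <= 4)%N -> cl (M n) r @[n --> \oo] --> Ex (fun w => z w ^+ r).
  by move=> r4; exact: clamped_pow_cvg.
have c1 : cl (M n) 1 @[n --> \oo] --> (0 : R).
  suff -> : 0 = Ex (fun w => z w ^+ 1) by exact: c.
  by rewrite -centered_mean; congr (Rintegral P setT _); apply/funext => w; rewrite expr1.
have c2 : cl (M n) 2 @[n --> \oo] --> (1 : R) by rewrite -(centered_sqr var1); exact: c.
have c11 : cl (M n) 1 ^+ 2 @[n --> \oo] --> (0 * 0 : R) by exact: cvgM.
have c1111 : cl (M n) 1 ^+ 4 @[n --> \oo] --> (0 * 0 * 0 * 0 : R).
  by rewrite -mulrA; under eq_fun do rewrite (exprD _ 2 2); exact: cvgM.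
have c3 := c 3%N isT; have c4 := c 4%N isT.
rewrite -fourth_central_momentE in c4.
split.
- under eq_fun do rewrite trmoment2//.
  suff -> : 1 = 1 - 0 * 0 :> R by apply: cvgB => //; exact: cvgM.
  by rewrite mulr0 subr0.
- under eq_fun do rewrite trmoment4//.
  set k := fourth_central_moment P x in c4 *; set g := Ex _ in c3.
  rewrite (_ : k = k - 4 * 0 * g + 6 * (0 * 0) * 1 - 3 * (0 * 0 * 0 * 0)); last by ring.
  apply: cvgB; last first.
    by apply: cvgM; [exact: cvg_cst|exact: c1111].
  apply: cvgD; last first.
    by apply: cvgM => //; apply: cvgM; [exact: cvg_cst|exact: c11].
  apply: cvgB => //; apply: cvgM => //; apply: cvgM => //; exact: cvg_cst.
Qed.

Lemma tail_bound M : 0 < M -> 2 * `|mu| <= M ->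
  (P [set w | M < `|z w|]%R <=
   (fine 'E_P[fun w => (`|x w| `^ (4 + delta))%R] / (M / 2) `^ (4 + delta))%:E)%E.
Proof.
move=> M0 muM.
have M2 : 0 < M / 2 by rewrite divr_gt0.
have sub : [set w | M < `|z w|] `<=` [set w | ((M / 2)%:E <= `|(x w)%:E|)%E].
  move=> w /=; rewrite lee_fin => zM.
  have : `|z w| <= `|x w| + `|mu| by exact: ler_normB.
  by lra.
have mA : measurable [set w | M < `|z w|].
  rewrite -[X in measurable X]setTI; apply: (measurable_fun_ltr (measurable_cst M)) => //.
  by apply: measurableT_comp => //; exact: measurable_centered.
have mB : measurable [set w | ((M / 2)%:E <= `|(x w)%:E|)%E].
  rewrite (_ : [set w | _] = (fun w => M / 2 <= `|x w|) @^-1` [set true]).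
    rewrite -[X in measurable X]setTI; apply: (measurable_fun_ler (measurable_cst (M / 2))) => //.
    exact: measurableT_comp.
  by apply/seteqP; split=> w /=; rewrite lee_fin.
have E_fin : ('E_P[fun w => (`|x w| `^ (4 + delta))%R])%E \is a fin_num.
  by rewrite unlock; exact: (integrable_fin_num measurableT pow_int).
apply: (le_trans (le_measure P _ _ sub)); rewrite ?inE//.
have pw : 0 < (M / 2) `^ (4 + delta) by exact: powR_gt0.
rewrite [(fine _ / _)%R]mulrC [(_ * fine _)%:E]EFinM lee_pdivlMl// fineK//.
apply: (@markov _ _ _ P x (fun r => r `^ (4 + delta)) (M / 2) M2
  (measurable_powR _) (fun r _ => powR_ge0 _ _)) => a a' a0 a'0 aa'.
by apply: ge0_ler_powR => //; rewrite addr_ge0// ltW.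
Qed.


Let X0 := fun _ : unit => x.
Let u M w := truncated M (x w).
Let bu M : 0 <= M -> bounded_block X0 [set tt]%SET (u M).
Proof.
move=> M0; apply: (bb_coord X0 tt (g := truncated M)).
  exact: measurable_truncated.
by exists (2 * M) => v; exact: truncated_bounded.
Qed.

(** The variance of the square; its positivity is [trmoment_sqr_le]. *)
Lemma truncated_sqr_variance M : 0 <= M ->
  Ex (fun w => (truncated M (x w) ^+ 2 - trmoment M 2) ^+ 2) =
  trmoment M 4 - trmoment M 2 ^+ 2.
Proof.
move=> M0; have b := bu M0; set s := trmoment M 2.
have -> : (fun w => (truncated M (x w) ^+ 2 - s) ^+ 2) =
  (fun w => u M w ^+ 4 - (2 * s * u M w ^+ 2 - s ^+ 2)).
  by apply/funext => w; rewrite /u; ring.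
have b4 := bbX 4 b; have b2 := bbM (bb_cst X0 [set tt]%SET (2 * s)) (bbX 2 b).
rewrite (ExB b4 (bbB b2 (bb_cst _ _ _))) (ExB b2 (bb_cst _ _ _)) Ex_cst.
rewrite (ExZ _ (bbX 2 b)) -/(trmoment M 4) -/(trmoment M 2) -/s; ring.
Qed.

Lemma trmoment_sqr_le M : 0 <= M -> trmoment M 2 ^+ 2 <= trmoment M 4.
Proof.
move=> M0; rewrite -subr_ge0 -truncated_sqr_variance//.
by apply: Ex_ge0 => w; exact: sqr_ge0.
Qed.

Lemma trmoment2_ge0 M : 0 <= trmoment M 2.
Proof. by apply: Ex_ge0 => w; exact: sqr_ge0. Qed.

(** Two of the four factors are bounded by [4 * M ^+ 2], since both the square and
    its mean lie between zero and this constant. *)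
Lemma truncated_sqr_fourth_deviation M : 0 <= M ->
  Ex (fun w => (truncated M (x w) ^+ 2 - trmoment M 2) ^+ 4) <=
  16 * M ^+ 4 * trmoment M 4.
Proof.
move=> M0; have b := bu M0; set s := trmoment M 2.
have sqr_le w : u M w ^+ 2 <= 4 * M ^+ 2.
  rewrite (_ : 4 * M ^+ 2 = (2 * M) ^+ 2); last by ring.
  by rewrite -[leLHS]real_normK ?num_real// lerXn2r ?nnegrE ?mulr_ge0//; exact: truncated_bounded.
have s0 : 0 <= s by exact: trmoment2_ge0.
have s4 : s <= 4 * M ^+ 2.
  by rewrite -[leRHS](Ex_cst P); apply: (Ex_le (bbX 2 b) (bb_cst _ _ _)).
have bd : bounded_block X0 [set tt]%SET (fun w => u M w ^+ 2 - s).
  exact: bbB (bbX 2 b) (bb_cst _ _ _).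
apply: (@le_trans _ _ (16 * M ^+ 4 * Ex (fun w => (u M w ^+ 2 - s) ^+ 2))); last first.
  rewrite truncated_sqr_variance// ler_wpM2l ?lerBlDr ?lerDl ?sqr_ge0//.
  by rewrite mulr_ge0// exprn_ge0.
rewrite -(ExZ _ (bbX 2 bd)); apply: Ex_le (bbX 4 bd) (bbM (bb_cst _ _ _) (bbX 2 bd)) _ => w.
rewrite (exprM _ 2 2) expr2 ler_wpM2r ?sqr_ge0// (_ : 16 * M ^+ 4 = (4 * M ^+ 2) ^+ 2); last by ring.
have u0 := sqr_ge0 (u M w); have u4 := sqr_le w.
have h : `|u M w ^+ 2 - s| <= 4 * M ^+ 2 by rewrite ler_norml; lra.
by rewrite -[leLHS]real_normK ?num_real// lerXn2r ?nnegrE// (le_trans _ h).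
Qed.

(** The limit of the corresponding inequality for truncated moments. *)
Lemma fourth_central_moment_ge1 : 'V_P[x] = 1%E -> 1 <= fourth_central_moment P x.
Proof.
move=> var1.
have M0 (n : nat) : 0 <= n%:R :> R by [].
have [c2 c4] := trmoment_cvg var1 M0 (@cvgr_idn R).
rewrite -[leLHS](_ : 1 * 1 = 1); last by rewrite mulr1.
apply: ler_cvg_to (cvgM c2 c2) c4 _.
by apply: nearW => n; exact: (trmoment_sqr_le (M0 n)).
Qed.

End TruncatedMoments.

Section SameDistribution.
Context (R : realType) d (T : measurableType d) (P : probability T R)
  d' (T' : measurableType d') (P' : probability T' R).
Variables (X : {RV P >-> R}) (Y : {RV P' >-> R}).
Hypothesis XY : same_distribution X Y.

Lemma same_distribution_Rintegral (g : R -> R) : measurable_fun setT g ->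
    (exists C : R, forall v, `|g v| <= C) ->
  Rintegral P setT (g \o X) = Rintegral P' setT (g \o Y).
Proof.
move=> mg bg.
have int d1 (T1 : measurableType d1) (P1 : probability T1 R) (X1 : {RV P1 >-> R}) :
    P1.-integrable setT (EFin \o g \o X1).
  exact: (bb_integrable (bb_coord (fun _ : unit => X1) tt mg bg)).
have mE : measurable_fun setT (EFin \o g) by exact/measurable_EFinP.
rewrite /Rintegral; congr fine.
rewrite -[LHS](integral_distribution mE (int _ _ _ X)).
rewrite -[RHS](integral_distribution mE (int _ _ _ Y)).
by apply: eq_measure_integral => B mB _; exact: XY.
Qed.

End SameDistribution.

(** * Invariance, stability and tail bounds *)

Section ShiftInvariance.
Variables (R : realType) (p n : nat) (Y Y' : 'M[R]_(p, n)) (c : 'I_p -> R).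
Hypotheses (n0 : (0 < n)%N) (YY' : forall j i, Y' j i = Y j i + c j).

Let mean_shift j : n%:R^-1 * \sum_i Y' j i = n%:R^-1 * \sum_i Y j i + c j.
Proof.
under eq_bigr do rewrite YY'.
rewrite big_split/= sumr_const card_ord -[_ *+ n]mulr_natl.
by field; rewrite pnatr_eq0 -lt0n.
Qed.

Let col_shift i : col i Y' - sample_mean Y' = col i Y - sample_mean Y.
Proof.
apply/colP => j.
have e (Z : 'M[R]_(p, n)) : (col i Z - sample_mean Z) j ord0 = Z j i - sample_mean Z j ord0.
  by rewrite !mxE.
by rewrite !e !sample_meanE mean_shift YY'; ring.
Qed.

Lemma kappa_hat_shift : kappa_hat Y' = kappa_hat Y.
Proof.
have cov : sample_cov Y' = sample_cov Y.
  by rewrite /sample_cov; congr (_ *: _); apply: eq_bigr => i _; rewrite col_shift.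
have nu : nu_hat Y' = nu_hat Y.
  rewrite /nu_hat; congr (_ * _); apply: eq_bigr => i _.
  by rewrite col_shift; under eq_bigr do rewrite col_shift.
have om : omega_hat Y' = omega_hat Y.
  apply: eq_bigr => j _; congr ((_ * _) ^+ 2); apply: eq_bigr => i _.
  by rewrite mean_shift YY'; congr (_ ^+ 2); ring.
by rewrite /kappa_hat /tau_hat cov nu om.
Qed.

End ShiftInvariance.

Section Continuity.
Variable R : realFieldType.

(** The combination [nh - 2 * th - (kap - 3) * wh] is small compared with [wh]:
    the terms in [Q] cancel, and [wh] stays above [N * l / 8]. *)
Lemma ratio_deviation (nh th wh D Q s k kap K l eta N : R) :
    0 < N -> 0 < l -> eta <= l / 8 -> 4^-1 <= s ^+ 2 -> N * l <= D -> D <= K * N ->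
    `|nh - ((k - 3 * s ^+ 2) * D + 2 * s ^+ 2 * Q)| <= eta * N ->
    `|th - s ^+ 2 * Q| <= eta * N -> `|wh - s ^+ 2 * D| <= eta * N ->
  `|(nh - 2 * th) / wh - (kap - 3)| <=
    8 * (eta * (3 + `|kap - 3|) + K * `|k - kap * s ^+ 2|) / l.
Proof.
move=> N0 l0 etal s4 DN DK hn ht hw.
have Nl : 0 < N * l by rewrite mulr_gt0.
have D0 : 0 <= D by rewrite (le_trans _ DN)// ltW.
have sD : N * l / 4 <= s ^+ 2 * D.
  by rewrite [leLHS]mulrC; apply: ler_pM => //; rewrite ltW.
have etaN : eta * N <= N * l / 8 by rewrite mulrC -mulrA ler_pM2l.
have wl : N * l / 8 <= wh by move: hw; rewrite ler_norml => /andP[? _]; lra.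
have w0 : 0 < wh by rewrite (lt_le_trans _ wl)// divr_gt0.
have -> : (nh - 2 * th) / wh - (kap - 3) =
    ((nh - ((k - 3 * s ^+ 2) * D + 2 * s ^+ 2 * Q)) - 2 * (th - s ^+ 2 * Q)
     - (kap - 3) * (wh - s ^+ 2 * D) + (k - kap * s ^+ 2) * D) / wh.
  by field; rewrite gt_eqF.
rewrite normrM [`|wh^-1|]gtr0_norm ?invr_gt0// ler_pdivrMr//.
have hk : `|(k - kap * s ^+ 2) * D| <= `|k - kap * s ^+ 2| * (K * N).
  by rewrite normrM [`|D|]ger0_norm// ler_wpM2l.
have hw' : `|(kap - 3) * (wh - s ^+ 2 * D)| <= `|kap - 3| * (eta * N).
  by rewrite normrM ler_wpM2l.
have ht' : `|2 * (th - s ^+ 2 * Q)| <= 2 * (eta * N).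
  by rewrite normrM normr_nat ler_pM2l.
have eta0 : 0 <= eta by rewrite -(pmulr_lge0 _ N0) (le_trans _ hn).
have K0 : 0 <= K by rewrite -(pmulr_lge0 _ N0) (le_trans _ DK).
pose E := eta * (3 + `|kap - 3|) + K * `|k - kap * s ^+ 2|.
have E0 : 0 <= E by rewrite addr_ge0// mulr_ge0// addr_ge0.
have -> : 8 * (eta * (3 + `|kap - 3|) + K * `|k - kap * s ^+ 2|) / l * wh =
   E * (8 / l * wh) by rewrite /E; ring.
have lw : N <= 8 / l * wh by rewrite mulrAC ler_pdivlMr//; lra.
apply: (@le_trans _ _ (E * N)); last exact: ler_wpM2l.
have -> : E * N = eta * N + 2 * (eta * N) + `|kap - 3| * (eta * N) + `|k - kap * s ^+ 2| * (K * N).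
  by rewrite /E; ring.
apply: le_trans (ler_normD _ _) _; apply: lerD => //.
apply: le_trans (ler_normB _ _) _; apply: lerD => //.
by apply: le_trans (ler_normB _ _) _; apply: lerD.
Qed.

(** Since [1 <= kap], taking the maximum with one cannot increase the distance to
    [kap]. *)
Lemma max_ratio_deviation (kap r : R) : 1 <= kap ->
  `|Num.max (3 + r) 1 / kap - 1| <= `|r - (kap - 3)|.
Proof.
move=> k1; have k0 : 0 < kap by lra.
have -> : Num.max (3 + r) 1 / kap - 1 = (Num.max (3 + r) 1 - kap) / kap.
  by field; rewrite gt_eqF.
rewrite normrM [`|kap^-1|]gtr0_norm ?invr_gt0// ler_pdivrMr//.
apply: (@le_trans _ _ `|r - (kap - 3)|); last by rewrite ler_peMr.
rewrite (_ : r - (kap - 3) = 3 + r - kap); last by ring.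
have [h|h] := leP 1 (3 + r); first by [].
by rewrite ler0_norm ?ler0_norm; lra.
Qed.

End Continuity.

Section TailBounds.
Context (R : realType) d (T : measurableType d) (P : probability T R).

Lemma union_bound (I : finType) (A : set T) (F : I -> set T) :
    measurable A -> (forall i, measurable (F i)) ->
    (forall w, A w -> exists i, F i w) ->
  (P A <= \sum_i P (F i))%E.
Proof.
move=> mA mF AF.
have mU (r : seq I) : measurable (\big[setU/set0]_(i <- r) F i).
  by apply: bigsetU_measurable.
apply: (@le_trans _ _ (P (\big[setU/set0]_i F i))).
  apply: le_measure; [by rewrite inE|by rewrite inE; exact: mU|].
  by move=> w /AF[i Fi]; rewrite -bigcup_seq; exists i => //=; rewrite mem_index_enum.
elim: (index_enum I) => [|i r IH]; first by rewrite !big_nil measure0.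
rewrite !big_cons; apply: le_trans (measureU2 P (mF i) (mU r)) _.
exact: leeD2l.
Qed.

Variables (I : finType) (X : I -> {RV P >-> R}).

Lemma markov_block J (f : T -> R) (eta : R) : bounded_block X J f ->
    0 < eta -> (forall w, 0 <= f w) ->
  (P [set w | eta < f w]%R <= (Rintegral P setT f / eta)%:E)%E.
Proof.
move=> bf eta0 f0; have mf := bb_measurable bf.
have mA : measurable [set w | eta < f w].
  by rewrite -[X in measurable X]setTI; exact: (measurable_fun_ltr (measurable_cst eta)).
rewrite [(_ / _)%R]mulrC EFinM lee_pdivlMl// /Rintegral fineK; last first.
  exact: integrable_fin_num (bb_integrable bf).
have ind : (\int[P]_w (eta%:E * (\1_[set w | eta < f w]%R w)%:E) = eta%:E * P [set w | eta < f w]%R)%E.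
  rewrite ge0_integralZl//; first by rewrite integral_indic// setIT.
  - exact/measurable_EFinP/measurable_indic.
  - by rewrite lee_fin ltW.
rewrite -ind; apply: ge0_le_integral => //.
- by move=> w _; rewrite -EFinM lee_fin mulr_ge0// ltW.
- by apply/measurable_EFinP; apply: measurable_funM.
- exact/measurable_EFinP.
- move=> w _; rewrite indicE -EFinM lee_fin.
  by case: (boolP (w \in _)) => [|_]; rewrite ?inE ?mulr1 ?mulr0//= => /ltW.
Qed.

End TailBounds.

(** * Concentration of the estimator for a fixed sample size *)

Section Measurability.
Context (R : realType) d (T : measurableType d) (p n : nat).
Variable Y : T -> 'M[R]_(p, n).
Hypothesis mY : forall j i, measurable_fun setT (fun w => Y w j i).

(** Division is measurable here because [omega_hat] is nonnegative, so that its
    inverse is a real power. *)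
Lemma measurable_kappa_hat : measurable_fun setT (fun w => kappa_hat (Y w)).
Proof.
have mg k l : measurable_fun setT (fun w => gramY (Y w) k l).
  by apply: measurable_sum => j; apply: measurable_funM.
have mr k : measurable_fun setT (fun w => rowmeanY (Y w) k).
  by apply: measurable_funM => //; apply: measurable_sum => l.
have ms : measurable_fun setT (fun w => sqmeanY (Y w)).
  by apply: measurable_funM => //; apply: measurable_sum => l.
have mc k l : measurable_fun setT (fun w => cgramY (Y w) k l).
  by apply: measurable_funD => //; apply: measurable_funB => //; exact: measurable_funB.
have mnu : measurable_fun setT (fun w => nu_hat (Y w)).
  under eq_fun do rewrite nu_hatE.
  apply: measurable_funM => //; apply: measurable_sum => k; apply: measurable_funX.
  apply: measurable_funB => //; apply: measurable_funM => //.
  exact: measurable_sum.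
have mtau : measurable_fun setT (fun w => tau_hat (Y w)).
  rewrite /tau_hat; under eq_fun do rewrite trace_sample_cov trace_sample_cov_sqr.
  apply: measurable_funB; apply: measurable_funM => //.
    by apply: measurable_sum => k; apply: measurable_sum => l; exact: measurable_funX.
  by apply: measurable_funX; apply: measurable_funM => //; exact: measurable_sum.
have momega : measurable_fun setT (fun w => omega_hat (Y w)).
  apply: measurable_sum => j; apply: measurable_funX; apply: measurable_funM => //.
  apply: measurable_sum => i; apply: measurable_funX; apply: measurable_funB => //.
  by apply: measurable_funM => //; exact: measurable_sum.
have omega0 w : 0 <= omega_hat (Y w) by apply: sumr_ge0 => j _; exact: sqr_ge0.
rewrite (_ : (fun w => kappa_hat (Y w)) = (fun w =>
  Num.max (3 + (nu_hat (Y w) - 2 * tau_hat (Y w)) * omega_hat (Y w) `^ (-1)) 1)); last first.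
  by apply/funext => w; rewrite powR_inv1.
apply: measurable_maxr => //; apply: measurable_funD => //.
apply: measurable_funM; last exact: (measurableT_comp (measurable_powR (-1)) momega).
by apply: measurable_funB => //; exact: measurable_funM.
Qed.

End Measurability.

Section FiniteSample.
Context (R : realType) d (T : measurableType d) (P : probability T R) (p n : nat).
Variable X : 'I_p * 'I_n -> {RV P >-> R}.
Hypothesis Xindep : mutually_independent X.
Context d0 (T0 : measurableType d0) (P0 : probability T0 R).
Variable x : {RV P0 >-> R}.
Hypothesis Xx : forall i, same_distribution (X i) x.
Variables (A S : 'M[R]_p) (l K M tail e eta eps : R).
Hypotheses (Asym : A^T = A) (AA : A *m A = S).
Hypothesis Srow : forall i, \sum_j S i j ^+ 2 <= K.
Hypothesis Sdiag : forall j, l <= S j j.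
Hypotheses (l0 : 0 < l) (p0 : (0 < p)%N) (n1 : (1 < n)%N) (pK : p%:R <= K * n%:R).
Hypotheses (K1 : 1 <= K) (M0 : 0 <= M).
Local Notation s := (trmoment x M 2).
Local Notation kp := (trmoment x M 4).
Hypotheses (sK : s <= K) (kK : kp <= K) (s2 : 2^-1 <= s).
Local Notation mu := (fine 'E_P0[x]).
Hypothesis htail : (P0 [set w | M < `|x w - mu|]%R <= tail%:E)%E.
Local Notation kappa := (fourth_central_moment P0 x).
Hypothesis kappa1 : 1 <= kappa.
Hypotheses (e0 : 0 < e) (e1 : e <= 1) (eta0 : 0 < eta) (etal : eta <= l ^+ 2 / 8).
Hypothesis close : 8 * (eta * (3 + `|kappa - 3|) + K * `|kp - kappa * s ^+ 2|) / l ^+ 2 <= eps.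
Local Notation b := (16 * M ^+ 4 * K).
Let Y w : 'M[R]_(p, n) :=
  \matrix_(j, i) (A *m col i (\matrix_(j', i') X (j', i') w)) j ord0.

Let YE w j i : Y w j i = \sum_k A j k * X (k, i) w.
Proof. by rewrite !mxE; apply: eq_bigr => k _; rewrite !mxE. Qed.

Let u i w := truncated x M (X i w).

Let Asym' i j : A i j = A j i.
Proof. by rewrite -[in LHS]Asym mxE. Qed.

Let Arow j : \sum_k A j k ^+ 2 = S j j.
Proof. by rewrite -AA mxE; apply: eq_bigr => k _; rewrite [A k j]Asym'. Qed.

Let AA' k k' : \sum_j A j k * A j k' = S k k'.
Proof. by rewrite -AA mxE; apply: eq_bigr => j _; rewrite Asym'. Qed.

Let Ssym i j : S i j = S j i.
Proof. by rewrite -!AA'; apply: eq_bigr => k _; rewrite mulrC. Qed.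

Let tr_bounded : exists C : R, forall v, `|truncated x M v| <= C.
Proof. by exists (2 * M) => v; exact: truncated_bounded. Qed.

Let mtr := measurable_truncated x M.

Let bu i : bounded_block X [set i]%SET (u i).
Proof. exact: bb_coord. Qed.

Let Eu (g : R -> R) i : measurable_fun setT g ->
    (exists C : R, forall v, `|v| <= 2 * M -> `|g v| <= C) ->
  Rintegral P setT (fun w => g (u i w)) =
  Rintegral P0 setT (fun w => g (truncated x M (x w))).
Proof.
move=> mg [C hC].
apply: (same_distribution_Rintegral (Xx i) (g := g \o truncated x M)).
  exact: measurableT_comp.
by exists C => v; apply: hC; exact: truncated_bounded.
Qed.

Let EuX r i : Rintegral P setT (fun w => u i w ^+ r) = trmoment x M r.
Proof.
apply: (Eu (g := fun v => v ^+ r)) => //.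
by exists ((2 * M) ^+ r) => v hv; rewrite normrX lerXn2r ?nnegrE ?mulr_ge0.
Qed.

Let s0 : 0 <= s. Proof. exact: trmoment2_ge0. Qed.

Let Eu1 i : Rintegral P setT (u i) = 0.
Proof.
rewrite -(trmoment1 x M0) -(EuX 1 i).
by congr (Rintegral P setT _); apply/funext => w; rewrite expr1.
Qed.

Let Eub i : Rintegral P setT (fun w => (u i w ^+ 2 - s) ^+ 4) <= b.
Proof.
rewrite (Eu i (g := fun v => (v ^+ 2 - s) ^+ 4)).
- apply: le_trans (truncated_sqr_fourth_deviation x M0) _.
  by rewrite ler_wpM2l// mulr_ge0// exprn_ge0.
- by apply: measurable_funX; apply: measurable_funB => //; exact: measurable_funX.
- exists (((2 * M) ^+ 2 + s) ^+ 4) => v hv.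
  rewrite normrX lerXn2r ?nnegrE ?addr_ge0 ?exprn_ge0 ?mulr_ge0//.
  rewrite (le_trans (ler_normB _ _))// [`|s|]ger0_norm// lerD2r.
  by rewrite normrX lerXn2r ?nnegrE ?mulr_ge0.
Qed.

Let sk : s ^+ 2 <= kp. Proof. exact: trmoment_sqr_le. Qed.
Let u2 := EuX 2.
Let u3 := EuX 3.
Let u4 := EuX 4.

Let err w := nu_error u s kp S e w + tau_error u s kp S e w + omega_error u s K S A e w.

Let N0 : 0 < p%:R :> R. Proof. by rewrite ltr0n. Qed.

Let D_ge : p%:R * l ^+ 2 <= sumdiag2 S.
Proof.
rewrite /sumdiag2 -[p%:R](_ : \sum_(j < p) 1 = _); last first.
  by rewrite sumr_const card_ord.
rewrite mulr_suml; apply: ler_sum => j _; rewrite mul1r.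
by rewrite lerXn2r ?nnegrE// ?Sdiag// ltW// (lt_le_trans l0 (Sdiag j)).
Qed.

(** When no component is clamped, the sample differs from the truncated one by a
    constant in each coordinate, which the estimator does not see. *)
Let kappa_hat_close w : (forall i, `|X i w - mu| <= M) -> err w <= eta * p%:R ->
  `|kappa_hat (Y w) / kappa - 1| <= eps.
Proof.
move=> good errw.
(* the mean removed by centring, together with the one removed by recentring *)
pose c := mu + Rintegral P0 setT (fun w => clamp M (centered x w)).
have uE i : X i w = u i w + c.
  by rewrite /u /truncated clamp_id// /c; ring.
have -> : kappa_hat (Y w) = kappa_hat (datamx u A w).
  apply: (kappa_hat_shift (c := fun j => \sum_k A j k * c)); first exact: ltnW.
  move=> j i; rewrite YE mxE -big_split/=; apply: eq_bigr => k _.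
  by rewrite uE mulrDr.
have dn := nu_hat_deviation Xindep bu Eu1 u2 u3 u4 Ssym p0 n1 AA' w e0.
have dt := tau_hat_deviation Xindep bu Eu1 u2 u3 u4 Ssym p0 n1 AA' w e0 e1.
have dw := omega_hat_deviation u sk kK Srow n1 A w e0.
have n0 := le_trans (normr_ge0 _) dn; have t0 := le_trans (normr_ge0 _) dt.
have w0 := le_trans (normr_ge0 _) dw.
rewrite /kappa_hat; apply: le_trans (max_ratio_deviation _ kappa1) _.
apply: le_trans close.
apply: (@ratio_deviation _ _ _ _ (sumdiag2 S) (sumsqr S) s _ _ _ _ _ p%:R) => //.
- by rewrite exprn_gt0.
- by rewrite -[4^-1](_ : 2^-1 ^+ 2 = _) ?lerXn2r ?nnegrE//; field.
- exact: le_trans (sumdiag2_le S) (sumsqr_le Srow).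
- by apply: le_trans dn _; apply: le_trans errw; rewrite /err; lra.
- by apply: le_trans dt _; apply: le_trans errw; rewrite /err; lra.
- by apply: le_trans dw _; apply: le_trans errw; rewrite /err; lra.
Qed.

(** The exceptional event is contained in the union of two: some component is
    clamped, or the sum of the three errors exceeds [eta * p]. *)
Lemma kappa_hat_concentration :
  (P [set w | eps < `|kappa_hat (Y w) / kappa - 1|]%R <=
   (p%:R * n%:R * tail + 2 ^+ 19 * K ^+ 6 * (e * p%:R + (1 + b / n%:R) / e) / (eta * p%:R))%:E)%E.
Proof.
have bn := bb_nu_error s kp bu S e; have bt := bb_tau_error s kp bu S e.
have bw := bb_omega_error s K bu S A e.
have berr := bbD (bbD bn bt) bw.
have en w : 0 <= nu_error u s kp S e w.
  exact: le_trans (normr_ge0 _) (nu_hat_deviation Xindep bu Eu1 u2 u3 u4 Ssym p0 n1 AA' w e0).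
have et w : 0 <= tau_error u s kp S e w.
  exact: le_trans (normr_ge0 _) (tau_hat_deviation Xindep bu Eu1 u2 u3 u4 Ssym p0 n1 AA' w e0 e1).
have ew w : 0 <= omega_error u s K S A e w.
  exact: le_trans (normr_ge0 _) (omega_hat_deviation u sk kK Srow n1 A w e0).
have err0 w : 0 <= err w by exact: addr_ge0 (addr_ge0 (en w) (et w)) (ew w).
pose B : set T := [set w | exists i, M < `|X i w - mu|].
pose F i : set T := [set w | M < `|X i w - mu|].
have mF i : measurable (F i).
  rewrite -[X in measurable X]setTI; apply: (measurable_fun_ltr (measurable_cst M)) => //.
  by apply: measurableT_comp => //; exact: measurable_funB.
have BE : B = \bigcup_(i in [set: 'I_p * 'I_n]) F i.
  by apply/seteqP; split=> [w [i hi]|w [i _ hi]]; exists i.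
have mB : measurable B.
  rewrite BE (_ : [set: 'I_p * 'I_n] = [set` index_enum ('I_p * 'I_n)%type]); last first.
    by apply/seteqP; split=> i //= _; rewrite mem_index_enum.
  by rewrite bigcup_seq; apply: bigsetU_measurable.
have PB : (P B <= (p%:R * n%:R * tail)%:E)%E.
  have ub := @union_bound _ _ _ P _ B F mB mF (fun w Bw => Bw).
  apply: le_trans ub _.
  apply: (@le_trans _ _ (\sum_(i : 'I_p * 'I_n) tail%:E)%E).
    apply: lee_sum => i _; apply: le_trans htail; rewrite le_eqVlt; apply/orP; left.
    apply/eqP.
    suff mV : measurable [set v : R | M < `|v - mu|] by exact: Xx mV.
    rewrite -[X in measurable X]setTI; apply: (measurable_fun_ltr (measurable_cst M)) => //.
    by apply: measurableT_comp => //; exact: measurable_funB.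
  rewrite sumEFin lee_fin sumr_const card_prod !card_ord -[_ *+ _]mulr_natl natrM.
  exact: lexx.
pose E : set T := [set w | eta * p%:R < err w].
have mE : measurable E.
  rewrite -[X in measurable X]setTI; apply: (measurable_fun_ltr (measurable_cst _)) => //.
  exact: bb_measurable berr.
have etap : 0 < eta * p%:R by rewrite mulr_gt0.
have PE : (P E <= (2 ^+ 19 * K ^+ 6 * (e * p%:R + (1 + b / n%:R) / e) / (eta * p%:R))%:E)%E.
  apply: le_trans (markov_block berr etap err0) _.
  rewrite lee_fin ler_pM2r ?invr_gt0// (ExD (bbD bn bt) bw) (ExD bn bt).
  have h1 := nu_error_mean Xindep bu Eu1 u2 u3 u4 Eub s0 sk K1 sK kK Ssym Srow p0 n1 pK e0 e1.
  have h2 := tau_error_mean Xindep bu Eu1 u2 u3 u4 Eub s0 sk K1 sK kK Ssym Srow p0 n1 pK e0 e1.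
  have h3 := omega_error_mean Xindep bu Eu1 u2 u3 u4 Eub sk K1 kK Srow p0 n1 pK Arow e0 e1.
  set q := K ^+ 6 * (e * p%:R + (1 + b / n%:R) / e).
  have q0 : 0 <= q.
    have K0 := le_trans ler01 K1.
    have b0 : 0 <= b by apply: mulr_ge0 => //; apply: mulr_ge0 => //; exact: exprn_ge0.
    apply: mulr_ge0; first exact: exprn_ge0.
    apply: addr_ge0; first by apply: mulr_ge0; exact: ltW.
    by apply: divr_ge0; [apply: addr_ge0 => //; exact: divr_ge0|exact: ltW].
  have qE c : 2 ^+ c * K ^+ 6 * (e * p%:R + (1 + b / n%:R) / e) = 2 ^+ c * q.
    exact/esym/mulrA.
  move: h1 h2 h3; rewrite !qE => h1 h2 h3.
  apply: le_trans (lerD (lerD h1 h2) h3) _.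
  rewrite -!mulrDl ler_wpM2r//.
  have -> : 2 ^+ 19 = 2 ^+ 16 * 8 :> R by rewrite (exprD _ 16 3); congr (_ * _); ring.
  have -> : 2 ^+ 17 = 2 ^+ 16 * 2 :> R by rewrite exprSr.
  rewrite -{1}[2 ^+ 16]mulr1 -!mulrDr ler_wpM2l ?exprn_ge0//; lra.
have mY j i : measurable_fun setT (fun w => Y w j i).
  under eq_fun do rewrite YE.
  by apply: measurable_sum => k; exact: measurable_funM.
apply: (@le_trans _ _ (P (B `|` E))).
  apply: le_measure; rewrite ?inE.
  - rewrite -[X in measurable X]setTI; apply: (measurable_fun_ltr (measurable_cst eps)) => //.
    apply: measurableT_comp => //; apply: measurable_funB => //; apply: measurable_funM => //.
    exact: measurable_kappa_hat.
  - exact: measurableU.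
  - move=> w /= hw; apply: contrapT => /not_orP[nB nE].
    move: hw; rewrite ltNge; apply/negP/negPn; apply: kappa_hat_close.
      by move=> i; rewrite leNgt; apply/negP => h; apply: nB; exists i.
    by rewrite leNgt; apply/negP.
by apply: le_trans (measureU2 P mB mE) _; rewrite EFinD leeD.
Qed.

End FiniteSample.

(** * Rates of the truncation level *)

Section Rates.
Variable R : realType.

Lemma natr_powRN_cvg (c : R) : 0 < c -> n%:R `^ (- c) @[n --> \oo] --> (0 : R).
Proof.
move=> c0; rewrite -cvg_shiftS/=.
have -> : (fun n => n.+1%:R `^ (- c)) = (fun n => (n.+1%:R^-1 : R) `^ c).
  by apply/funext => n; rewrite -powR_inv1// -powRrM mulN1r.
have /cvg_at_rightP := powR_cvg0 c0; apply; split=> [n|]; last exact: cvg_harmonic.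
by rewrite invr_gt0 ltr0n.
Qed.

Lemma natr_powR_cvgy (c : R) : 0 < c -> n%:R `^ c @[n --> \oo] --> +oo.
Proof.
move=> c0; apply/(gtr0_cvgV0 _).1; last first.
  apply: cvg_trans (natr_powRN_cvg c0); apply: near_eq_cvg.
  by apply: nearW => n /=; rewrite powRN.
by exists 1%N => // n /= n1; rewrite powR_gt0// ltr0n.
Qed.

Variables (p : nat -> nat) (y delta : R).
Hypotheses (y0 : 0 < y) (delta0 : 0 < delta).
Hypothesis hpn : (p n)%:R / n%:R @[n --> \oo] --> y.

(** The exponent makes the clamping probability and the eighth moments balance:
    both [level n ^+ 4 / n ^+ 2] and [n ^+ 2 / level n ^ (4 + delta)] are equal
    to [theta n]. *)
Definition level (n : nat) : R := n%:R `^ (4 / (8 + delta)).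
Let c := 2 * delta / (8 + delta).
Let theta (n : nat) : R := n%:R `^ (- c).

Let d8 : 8 + delta != 0. Proof. by rewrite gt_eqF// addr_gt0. Qed.
Let c0 : 0 < c. Proof. by rewrite divr_gt0 ?mulr_gt0// addr_gt0. Qed.

Lemma level_cvgy : level @ \oo --> +oo.
Proof. by apply: natr_powR_cvgy; rewrite divr_gt0// addr_gt0. Qed.

Lemma level_ge0 n : 0 <= level n. Proof. exact: powR_ge0. Qed.

Let level4 n : (0 < n)%N -> level n ^+ 4 = n%:R ^+ 2 * theta n.
Proof.
move=> n0; rewrite -!powR_mulrn ?powR_ge0// /level -powRrM -powRD.
  by congr (_ `^ _); rewrite /c; field.
by rewrite pnatr_eq0 -lt0n n0 implybT.
Qed.

Let level_moment n : (0 < n)%N -> (level n / 2) `^ (4 + delta) =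
  n%:R ^+ 2 / theta n / 2 `^ (4 + delta).
Proof.
move=> n0; rewrite powRM// ?level_ge0// -[in LHS]powR_inv1// -[_ `^ (-1) `^ _]powRrM mulN1r powRN.
congr (_ / _); rewrite -powR_mulrn// /theta powRN invrK /level -powRrM -powRD.
  by congr (_ `^ _); rewrite /c; field.
by rewrite pnatr_eq0 -lt0n n0 implybT.
Qed.

Let hnp : n%:R / (p n)%:R @[n --> \oo] --> y^-1.
Proof.
by apply: cvg_trans (cvgV (lt0r_neq0 y0) hpn); apply: near_eq_cvg; apply: nearW => n /=; rewrite invf_div.
Qed.

Lemma tail_rate (C : R) :
  (p n)%:R * n%:R * (C / (level n / 2) `^ (4 + delta)) @[n --> \oo] --> (0 : R).
Proof.
have h : C * 2 `^ (4 + delta) * ((p n)%:R / n%:R) * theta n @[n --> \oo] --> (0 : R).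
  rewrite -[X in _ --> X](mulr0 (C * 2 `^ (4 + delta) * y)).
  by apply: cvgM (natr_powRN_cvg c0); apply: cvgMr.
apply: cvg_trans h; apply: near_eq_cvg; exists 1%N => // n /= n1.
rewrite level_moment//; field.
by rewrite pnatr_eq0 -lt0n n1 !gt_eqF ?powR_gt0 ?ltr0n.
Qed.

Lemma error_rate (K : R) :
  (1 + 16 * level n ^+ 4 * K / n%:R) / (p n)%:R @[n --> \oo] --> (0 : R).
Proof.
have h : n%:R / (p n)%:R * n%:R^-1 + 16 * K * (n%:R / (p n)%:R) * theta n
    @[n --> \oo] --> (0 : R).
  rewrite -[X in _ --> X](_ : y^-1 * 0 + 16 * K * y^-1 * 0 = 0); last by rewrite !mulr0 addr0.
  apply: cvgD.
    by apply: cvgM => //; rewrite -cvg_shiftS; exact: cvg_harmonic.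
  by apply: cvgM (natr_powRN_cvg c0); apply: cvgMr.
apply: cvg_trans h; apply: near_eq_cvg; exists 1%N => // n /= n1.
rewrite level4//; have n0 : n%:R != 0 :> R by rewrite pnatr_eq0 -lt0n.
rewrite [in RHS]mulrDl div1r; congr (_ + _).
  by rewrite mulrAC mulfV// mul1r.
by move: (p n)%:R^-1 => v; field.
Qed.

End Rates.

(** * The limit *)

Lemma ereal_inf_pos_bound (R : realType) (S : set \bar R) :
  (0 < ereal_inf S)%E -> exists2 l : R, 0 < l & forall a : R, S a%:E -> l <= a.
Proof.
move: (ereal_inf S) (@ereal_inf_lbound _ S) => [l lb l0|lb _|_ ]; last by [].
  by exists l => // a Sa; rewrite -lee_fin; exact: lb.
by exists 1 => // a /lb; rewrite leye_eq.
Qed.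

Lemma ereal_sup_fin_bound (R : realType) (S : set \bar R) :
  (ereal_sup S < +oo)%E -> exists L : R, forall a : R, S a%:E -> a <= L.
Proof.
move: (ereal_sup S) (@ereal_sup_ubound _ S) => [L ub _|_|ub _]; [|by []|].
  by exists L => a Sa; rewrite -lee_fin; exact: ub.
by exists 0 => a /ub; rewrite leeNy_eq.
Qed.

Theorem proposition1 (R : realType)
  (p : nat -> nat) (hp : forall n, (0 < n)%N -> (0 < p n)%N)
  (* for each n, the probability space carrying the n-th sample *)
  (d : nat -> measure_display) (T : forall n, measurableType (d n))
  (P : forall n, probability (T n) R)
  (* x n j i is the j-th component of the i-th vector of the n-th sample *)
  (x : forall n, 'I_(p n) -> 'I_n -> {RV (P n) >-> R})
  (* x11 is a generic copy of the components *)
  (d0 : measure_display) (T0 : measurableType d0) (P0 : probability T0 R)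
  (x11 : {RV P0 >-> R})
  (Sigma : forall n, 'I_n -> 'M[R]_(p n))
  (hSigma : forall n (i : 'I_n), covariance_matrix (Sigma n i))
  (* (A-2) *)
  (hindep : forall n, mutually_independent
     (fun ji : 'I_(p n) * 'I_n => x n ji.1 ji.2))
  (hident : forall n (j : 'I_(p n)) (i : 'I_n),
     same_distribution (x n j i) x11)
  (hcont : continuous (cdf x11))
  (hvar : 'V_P0[x11] = 1%E)
  (hmom4 : (1 < 'E_P0[fun w => (x11 w ^+ 4)%R])%E)
  (hmom : exists2 delta : R, 0 < delta &
     ('E_P0[fun w => (`|x11 w| `^ (4 + delta))%R] < +oo)%E)
  (* (A-3) *)
  (hmin : (0 < ereal_inf [set l | exists n (i : 'I_n),
     nat_of_ord i = 0%N /\ l = (lambda_min (Sigma n i))%:E])%E)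
  (hmax : (ereal_sup [set l | exists n (i : 'I_n),
     nat_of_ord i = 0%N /\ l = (lambda_max (Sigma n i))%:E] < +oo)%E)
  (* p / n --> y *)
  (y : R) (hy : 0 < y)
  (hpn : (p n)%:R / n%:R @[n --> \oo] --> y)
  (* H_0 *)
  (H0 : forall n (i i' : 'I_n), Sigma n i = Sigma n i') :
  cvg_in_probability P
    (fun n w =>
       kappa_hat (observations (Sigma n) (\matrix_(j, i) x n j i w))
       / fourth_central_moment P0 x11)
    1.
Proof.
case: hmom => delta delta0 xmom.
have [l l0 hl] := ereal_inf_pos_bound hmin.
have [L hL] := ereal_sup_fin_bound hmax.
set kappa := fourth_central_moment P0 x11.
have kappa1 : 1 <= kappa := fourth_central_moment_ge1 delta0 xmom hvar.
move=> eps eps0.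
(* one constant which dominates the second and fourth truncated moments, the
   squared row norms of the covariance matrix and the ratio p / n *)
pose K := 3 + kappa + L ^+ 2 + y.
have L2 : 0 <= L ^+ 2 := sqr_ge0 L.
have [K1 K2 Kk KL Ky] : [/\ 1 <= K, 2 <= K, kappa + 1 <= K, L ^+ 2 <= K & y + 1 <= K].
  by rewrite /K; split; lra.
have K0 := lt_le_trans ltr01 K1.
pose a := 3 + `|kappa - 3|.
have a0 : 0 < a by rewrite ltr_pwDl.
(* each half of eps is left to one of the two terms of [ratio_deviation]: this
   one, and the gap between truncated and original moments *)
pose eta := Num.min (l ^+ 2 / 8) (eps * l ^+ 2 / (16 * a)).
have l2 : 0 < l ^+ 2 by rewrite exprn_gt0.
have eta0 : 0 < eta by rewrite lt_min !divr_gt0 ?mulr_gt0.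
have etal : eta <= l ^+ 2 / 8 by rewrite ge_min lexx.
have etaa : 8 * (eta * a) <= eps * l ^+ 2 / 2.
  have : eta <= eps * l ^+ 2 / (16 * a) by rewrite ge_min lexx orbT.
  by rewrite ler_pdivlMr ?mulr_gt0//; lra.
pose M := level delta.
have M0 n : 0 <= M n := level_ge0 delta n.
have Moo : M @ \oo --> +oo := level_cvgy delta0.
(* the error bound is proportional to e + q n / e, hence the choice of the
   square root of q n for e below *)
pose q n := (1 + 16 * M n ^+ 4 * K / n%:R) / (p n)%:R.
have q0 : q @ \oo --> (0 : R) := error_rate hy delta0 hpn K.
pose C := fine 'E_P0[fun w => (`|x11 w| `^ (4 + delta))%R].
pose tail n := C / (M n / 2) `^ (4 + delta).
pose bound n := (p n)%:R * n%:R * tail n + 2 ^+ 20 * K ^+ 6 / eta * Num.sqrt (q n).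
have bound0 : bound @ \oo --> (0 : R).
  rewrite -[X in _ --> X](_ : 0 + 2 ^+ 20 * K ^+ 6 / eta * Num.sqrt 0 = 0); last first.
    by rewrite sqrtr0 mulr0 addr0.
  apply: cvgD; first exact: (tail_rate delta0 hpn C).
  apply: cvgMr; apply: (cvg_comp _ _ q0); exact: sqrt_continuous.
have [s_cvg kp_cvg] := trmoment_cvg delta0 xmom hvar M0 Moo.
rewrite -/kappa in kp_cvg.
have gap_cvg : trmoment x11 (M n) 4 - kappa * (trmoment x11 (M n) 2) ^+ 2 @[n --> \oo] --> (0 : R).
  rewrite -[X in _ --> X](_ : kappa - kappa * (1 * 1) = 0); last by rewrite !mulr1 subrr.
  by apply: cvgB => //; apply: cvgMr; exact: cvgM.
apply: (@squeeze_cvge _ _ _ _ (fun=> 0%E) _ (EFin \o bound)); last 2 first.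
- exact: cvg_cst.
- by apply: cvg_EFin => //; exact: nearW.
near=> n.
have n1 : (1 < n)%N by near: n; exact: nbhs_infty_gt.
have n0 := ltnW n1; have p0 := hp _ n0.
pose i0 : 'I_n := Ordinal n0.
have Si i : Sigma n i = Sigma n i0 by exact: H0.
have S_psd : psdmx (Sigma n i0) := hSigma n i0.
have [[Asym _] AA] := sqrtmxP S_psd.
rewrite measure_ge0/= (_ : Sigma n = fun=> Sigma n i0); last exact/funext.
have hs : trmoment x11 (M n) 2 <= 2 by near: n; apply: (cvgr_le _ s_cvg); lra.
have pn0 : 0 < (p n)%:R :> R by rewrite ltr0n.
have n0R : 0 < n%:R :> R by rewrite ltr0n.
have M1 : 1 + 2 * `|fine 'E_P0[x11]| <= M n by near: n; move/cvgryPge : Moo; exact.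
have mu0 := normr_ge0 (fine 'E_P0[x11]).
have qn0 : 0 < q n.
  rewrite divr_gt0// ltr_pwDl// divr_ge0// mulr_ge0//; last exact: ltW.
  by rewrite mulr_ge0// exprn_ge0.
have e0 : 0 < Num.sqrt (q n) by rewrite sqrtr_gt0.
have htail : (P0 [set w | M n < `|x11 w - fine 'E_P0[x11]|]%R <= (tail n)%:E)%E.
  apply: (tail_bound delta0 xmom).
    by apply: lt_le_trans M1; rewrite ltr_pwDl// mulr_ge0.
  by apply: le_trans M1; rewrite lerDr.
have := @kappa_hat_concentration R _ _ (P n) (p n) n (fun ji => x n ji.1 ji.2) (hindep n)
  _ _ P0 x11 (fun i => hident n i.1 i.2) _ _ l K (M n) (tail n) (Num.sqrt (q n)) eta eps
  Asym AA _ _ l0 p0 n1 _ K1 (M0 n) _ _ _ htail kappa1 e0 _ eta0 etal _.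
move=> h; apply: le_trans (h _ _ _ _ _ _ _ _) _; clear h.
- move=> j; apply: le_trans (lambda_max_row S_psd j _) _.
    by apply: hL; exists n, i0.
  exact: KL.
- move=> j; apply: le_trans (lambda_min_diag S_psd j).
  by apply: hl; exists n, i0.
- rewrite -ler_pdivrMr//; apply: (le_trans _ Ky).
  by near: n; apply: (cvgr_le _ hpn); rewrite ltrDl.
- exact: le_trans hs K2.
- apply: (le_trans _ Kk).
  by near: n; apply: (cvgr_le _ kp_cvg); rewrite ltrDl.
- by near: n; apply: (cvgr_ge _ s_cvg); lra.
- rewrite -[leRHS]sqrtr1 ler_wsqrtr//.
  by near: n; apply: (cvgr_le _ q0); exact: ltr01.
- rewrite ler_pdivrMr// mulrDr.
  have gap : `|trmoment x11 (M n) 4 - kappa * trmoment x11 (M n) 2 ^+ 2| <=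
      eps * l ^+ 2 / (16 * K).
    near: n; move/cvg_norm : gap_cvg; rewrite normr0 => gap_cvg.
    by apply: (cvgr_le _ gap_cvg); rewrite divr_gt0 ?mulr_gt0.
  move: gap; rewrite ler_pdivlMr ?mulr_gt0//.
  move: `|_ - _ * _| => G gap; rewrite -/kappa -/a [leRHS]splitr; apply: (lerD etaa).
  by rewrite -ler_pdivrMr// [leLHS](_ : _ = G * (16 * K))//; field.
rewrite lee_fin /bound lerD2l le_eqVlt; apply/orP; left; apply/eqP.
have qE : 1 + 16 * M n ^+ 4 * K / n%:R = Num.sqrt (q n) ^+ 2 * (p n)%:R.
  by rewrite sqr_sqrtr ?ltW// /q divfK// gt_eqF.
by rewrite qE; field; rewrite !gt_eqF.
Unshelve. all: by end_near. Qed.
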